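(* Assume that the system $g(p,x)\in C$ enjoys Robinson stability at $(\bar p,\bar x)$, and that either ${\cal P}=P$ or the cone $K$ is polyhedral. Then $$T_{\operatorname{gph}\Psi}(\bar p,\bar x,\bar x^* )=\Big\{(q,u,u^* )\ \Big|\ \exists\,z^*\in N_{T_{\operatorname{gph}\Gamma}(\bar z)}(q,u)\text{ with }\pi_{X^*}(z^* )=\bar x^*,\ \exists\,\hat\lambda\in\Lambda(\bar z,z^*;(q,u))\text{ such that } u^*\in\big(\nabla(\nabla_xg(\cdot)^*\hat\lambda)(\bar z)+{\cal H}_{\hat\lambda}\big)(q,u)+\pi_{X^*}\big(N_{{\cal K}_{\operatorname{gph}\Gamma}(\bar z,z^* )}(q,u)\big)\Big\}.$$ Consequently, for all $v=(q,u)\in Z$, $$D\Psi(\bar p,\bar x,\bar x^* )(v)=\bigcup\Big\{\big(\nabla(\nabla_xg(\cdot)^*\hat\lambda)(\bar z)+{\cal H}_{\hat\lambda}\big)v+\pi_{X^*}\big(N_{{\cal K}_{\operatorname{gph}\Gamma}(\bar z,z^* )}(v)\big)\ \Big|\ z^*\in N_{T_{\operatorname{gph}\Gamma}(\bar z)}(v),\ \pi_{X^*}(z^* )=\bar x^*,\ \hat\lambda\in\Lambda(\bar z,z^*;v)\Big\}.$$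
   Context: Notation: $X=\mathbb R^n$, $P=\mathbb R^m$, $Y=\mathbb R^l$, $Z:=P\times X$, and $E$ is finite-dimensional. Dual spaces are distinguished from primal ones, $Z^*=P^*\times X^*$, and $\pi_{X^*}(p^*,x^* ):=x^*$. $A^*$ denotes the adjoint of a linear map $A$, and $\operatorname{rge}A$ its range. For $\lambda\in Y^*$, $\nabla(\nabla_xg(\cdot)^*\lambda)(\bar z)v\in X^*$ is the derivative at $\bar z$ of $z\mapsto\nabla_xg(z)^*\lambda$, applied to $v$. For a cone $A$, $A^*:=\{a^*:\langle a^*,a\rangle\le0\ \forall a\in A\}$ is its polar, and for a closed convex cone $K$, $\operatorname{lin}K:=K\cap(-K)$. For a closed set $\Omega$ and $\bar z\in\Omega$: the tangent cone is $T_\Omega(\bar z):=\{w:\exists\, t_k\downarrow0,\ w_k\to w \text{ with } \bar z+t_kw_k\in\Omega\}$; the regular normal cone is $N_\Omega(\bar z):=\{z^*:\limsup_{z\to\bar z,\,z\in\Omega}\langle z^*,z-\bar z\rangle/\|z-\bar z\|\le0\}$ (for convex sets, this is the normal cone of convex analysis); and, for $z^*\in N_\Omega(\bar z)$, the critical cone is ${\cal K}_\Omega(\bar z,z^* ):=T_\Omega(\bar z)\cap\{z^*\}^\perp$. For a set-valued map $\Phi$, the graphical derivative is $D\Phi(\bar z,\bar u)(w):=\{v:(w,v)\in T_{\operatorname{gph}\Phi}(\bar z,\bar u)\}$. Setting: $g\colon P\times X\to Y$ is $C^2$ around $\bar z=(\bar p,\bar x)$. The set $C\subset Y$ is closed and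 $C^2$-cone reducible at $g(\bar z)$ to a closed convex cone $K\subset E$: there exist a neighborhood $V$ of $g(\bar z)$ and a $C^2$ map $h\colon V\to E$ with $h(g(\bar z))=0$, $\nabla h(g(\bar z))$ surjective, and $C\cap V=\{y\in V:h(y)\in K\}$. Set $\Gamma(p):=\{x:g(p,x)\in C\}$ with $\bar x\in\Gamma(\bar p)$, $\Psi(p,x):=N_{\Gamma(p)}(x)$, and fix $\bar x^*\in N_{\Gamma(\bar p)}(\bar x)$. Let $G:=h\circ g$ near $\bar z$. The system $g(p,x)\in C$ enjoys Robinson stability at $(\bar p,\bar x)$ if there are $\kappa\ge0$ and neighborhoods $W$ of $\bar p$ and $U$ of $\bar x$ with ${\rm dist}(x;\Gamma(p))\le\kappa\,{\rm dist}(g(p,x);C)$ for all $(p,x)\in W\times U$. The characteristic subspace is ${\cal P}:=\{q\in P:\nabla_pG(\bar z)q\in\operatorname{rge}\nabla_xG(\bar z)+\operatorname{lin}K\}$. Multipliers: for $\lambda\in N_C(g(\bar z))$, let $(\nabla h(g(\bar z))^* )^{-1}\lambda$ denote the unique $\mu\in E^*$ with $\nabla h(g(\bar z))^*\mu=\lambda$. For $z^*\in N_{\operatorname{gph}\Gamma}(\bar z)$, set $\Lambda(\bar z,z^* ):=\{\lambda\in N_C(g(\bar z)):\nabla g(\bar z)^*\lambda=z^*\}$, and for $v\in{\cal K}_{\operatorname{gph}\Gamma}(\bar z,z^* )$, $$\Lambda(\bar z,z^*;v):=\arg\max_{\lambda\in\Lambda(\bar z,z^* )}\Big(\langle\lambda,\nabla^2g(\bar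 z)(v,v)\rangle+\nabla^2\big\langle(\nabla h(g(\bar z))^* )^{-1}\lambda,h(\cdot)\big\rangle(g(\bar z))\big(\nabla g(\bar z)v,\nabla g(\bar z)v\big)\Big).$$ For $\lambda\in N_C(g(\bar z))$, the linear map ${\cal H}_\lambda\colon Z\to X^*$ is ${\cal H}_\lambda v:=\nabla_xg(\bar z)^*\nabla^2\langle(\nabla h(g(\bar z))^* )^{-1}\lambda,h(\cdot)\rangle(g(\bar z))\nabla g(\bar z)v$, where $\nabla^2\langle\mu,h(\cdot)\rangle(y)$ is the Hessian of $y\mapsto\langle\mu,h(y)\rangle$, viewed as a linear map $Y\to Y^*$. *)

(* Defs.v *)
(* Stdlib reals (R), with MathComp ordinals 'I_k and bigop only used
   to index coordinates of R^k.  All spaces are R^k = ('I_k -> R); duals are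
   identified with R^k via the Euclidean inner product [dot]. *)
From Stdlib Require Import Reals.
From mathcomp Require Import all_boot.
Set Implicit Arguments.
Unset Strict Implicit.
Unset Printing Implicit Defensive.
Open Scope R_scope.

Definition vec (k : nat) := 'I_k -> R.
Definition vzero (k : nat) : vec k := fun _ => 0.
Definition vadd k (x y : vec k) : vec k := fun i => x i + y i.
Definition vopp k (x : vec k) : vec k := fun i => - x i.
Definition vsub k (x y : vec k) : vec k := fun i => x i - y i.
Definition vscale k (t : R) (x : vec k) : vec k := fun i => t * x i.
Definition dot k (x y : vec k) : R := \big[Rplus/0]_(i < k) (x i * y i).
Definition vnorm k (x : vec k) : R := sqrt (dot x x).
Definition ebasis k (j : 'I_k) : vec k := fun i => if i == j then 1 else 0.

Definition vjoin m n (p : vec m) (x : vec n) : vec (m + n) :=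
  fun i => match split i with inl j => p j | inr j => x j end.
Definition vfst m n (z : vec (m + n)) : vec m := fun j => z (lshift n j).
Definition vsnd m n (z : vec (m + n)) : vec n := fun j => z (rshift m j).

Definition adj a b (L : vec a -> vec b) (y : vec b) : vec a :=
  fun j => dot y (L (ebasis j)).

Definition is_linear a b (L : vec a -> vec b) : Prop :=
  (forall x y, L (vadd x y) = vadd (L x) (L y)) /\
  (forall t x, L (vscale t x) = vscale t (L x)).

Definition has_deriv a b (f : vec a -> vec b) (L : vec a -> vec b) (x : vec a) : Prop :=
  is_linear L /\
  forall eps, 0 < eps -> exists delta, 0 < delta /\
    forall hv, vnorm hv < delta ->
      vnorm (vsub (vsub (f (vadd x hv)) (f x)) (L hv)) <= eps * vnorm hv.

Definition vcont_at a b (f : vec a -> vec b) (x : vec a) : Prop :=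
  forall eps, 0 < eps -> exists delta, 0 < delta /\
    forall y, vnorm (vsub y x) < delta -> vnorm (vsub (f y) (f x)) < eps.

Definition C2_on_ball a b (f : vec a -> vec b) (Df : vec a -> vec a -> vec b)
  (D2f : vec a -> vec a -> vec a -> vec b) (c : vec a) (r : R) : Prop :=
  forall z, vnorm (vsub z c) < r ->
    has_deriv f (Df z) z /\
    (forall v, has_deriv (fun w => Df w v) (D2f z v) z) /\
    (forall v w, vcont_at (fun y => D2f y v w) z).

Definition C2_near a b (f : vec a -> vec b) Df D2f (c : vec a) : Prop :=
  exists r, 0 < r /\ C2_on_ball f Df D2f c r.

Definition vseq_cv k (w : nat -> vec k) (w0 : vec k) : Prop :=
  forall eps, 0 < eps -> exists N, forall j, (N <= j)%nat -> vnorm (vsub (w j) w0) < eps.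

Definition vclosed k (S : vec k -> Prop) : Prop :=
  forall (ws : nat -> vec k) w, (forall j, S (ws j)) -> vseq_cv ws w -> S w.

Definition closed_convex_cone k (K : vec k -> Prop) : Prop :=
  vclosed K /\ K (@vzero k) /\
  (forall x y, K x -> K y -> K (vadd x y)) /\
  (forall t x, 0 <= t -> K x -> K (vscale t x)).

Definition polyhedral_cone k (K : vec k -> Prop) : Prop :=
  exists (N : nat) (A : 'I_N -> vec k), forall y, K y <-> forall i, dot (A i) y <= 0.

Definition lin_space k (K : vec k -> Prop) (y : vec k) : Prop := K y /\ K (vopp y).

Definition tangent_cone k (Om : vec k -> Prop) (zb w : vec k) : Prop :=
  Om zb /\ exists (t : nat -> R) (ws : nat -> vec k),
    (forall j, 0 < t j) /\ Un_cv t 0 /\ vseq_cv ws w /\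
    forall j, Om (vadd zb (vscale (t j) (ws j))).

(* regular (Frechet) normal cone N_Om(zb); empty if zb is not in Om.
   limsup_{z -> zb, z in Om} <zs, z - zb>/|z - zb| <= 0, unfolded. *)
Definition normal_cone k (Om : vec k -> Prop) (zb zs : vec k) : Prop :=
  Om zb /\ forall eps, 0 < eps -> exists delta, 0 < delta /\
    forall z, Om z -> vnorm (vsub z zb) < delta ->
      dot zs (vsub z zb) <= eps * vnorm (vsub z zb).

Definition crit_cone k (Om : vec k -> Prop) (zb zs w : vec k) : Prop :=
  tangent_cone Om zb w /\ dot zs w = 0.

(* distance: dist(x;S) = d means d is the infimum of |x - s|, s in S
   (dist = +infinity, i.e. no such d, when S is empty). *)
Definition is_dist k (S : vec k -> Prop) (x : vec k) (d : R) : Prop :=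
  (forall s, S s -> d <= vnorm (vsub x s)) /\
  (forall b, (forall s, S s -> b <= vnorm (vsub x s)) -> b <= d).

Definition graph_deriv a b (G : vec (a + b) -> Prop) (zb : vec a) (ub : vec b)
  (w : vec a) (ws : vec b) : Prop :=
  tangent_cone G (vjoin zb ub) (vjoin w ws).

Section System.
Variables (m n l d : nat).
Variable g : vec (m + n) -> vec l.
Variable Dg : vec (m + n) -> vec (m + n) -> vec l.
Variable D2g : vec (m + n) -> vec (m + n) -> vec (m + n) -> vec l.
Variable C : vec l -> Prop.
Variable K : vec d -> Prop.
Variable h : vec l -> vec d.
Variable Dh : vec l -> vec l -> vec d.
Variable D2h : vec l -> vec l -> vec l -> vec d.

Definition Gamma (p : vec m) (x : vec n) : Prop := C (g (vjoin p x)).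
Definition gph_Gamma (z : vec (m + n)) : Prop := C (g z).
Definition gph_Psi (w : vec ((m + n) + n)) : Prop :=
  normal_cone (Gamma (vfst (vfst w))) (vsnd (vfst w)) (vsnd w).

Definition cone_reducible (yb : vec l) : Prop :=
  exists r, 0 < r /\ C2_on_ball h Dh D2h yb r /\
    h yb = @vzero d /\
    (forall e : vec d, exists y, Dh yb y = e) /\
    (forall y, vnorm (vsub y yb) < r -> (C y <-> K (h y))).

Definition robinson_stable (pb : vec m) (xb : vec n) : Prop :=
  exists kappa r, 0 <= kappa /\ 0 < r /\
    forall p x, vnorm (vsub p pb) < r -> vnorm (vsub x xb) < r ->
      exists d1 d2, is_dist (Gamma p) x d1 /\ is_dist C (g (vjoin p x)) d2 /\
                    d1 <= kappa * d2.

Definition Dxg (z : vec (m + n)) (u : vec n) : vec l := Dg z (vjoin (@vzero m) u).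

(* nabla G(zb) = nabla h(g zb) o nabla g(zb), G = h o g (chain rule) *)
Definition DG (zb : vec (m + n)) (v : vec (m + n)) : vec d := Dh (g zb) (Dg zb v).

Definition char_subspace (zb : vec (m + n)) (q : vec m) : Prop :=
  exists (u : vec n) (y : vec d), lin_space K y /\
    DG zb (vjoin q (@vzero n)) = vadd (DG zb (vjoin (@vzero m) u)) y.

Definition Lambda (zb zs : vec (m + n)) (lam : vec l) : Prop :=
  normal_cone C (g zb) lam /\ adj (Dg zb) lam = zs.

Definition lam_obj (zb v : vec (m + n)) (lam : vec l) (val : R) : Prop :=
  exists mu : vec d, adj (Dh (g zb)) mu = lam /\
    val = dot lam (D2g zb v v) + dot mu (D2h (g zb) (Dg zb v) (Dg zb v)).

Definition Lambda_dir (zb zs v : vec (m + n)) (lam : vec l) : Prop :=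
  Lambda zb zs lam /\
  exists val, lam_obj zb v lam val /\
    forall lam' val', Lambda zb zs lam' -> lam_obj zb v lam' val' -> val' <= val.

(* nabla(nabla_x g(.)^* lam)(zb) v, the derivative at zb of
   z |-> nabla_x g(z)^* lam applied to v *)
Definition dDxg_adj (zb : vec (m + n)) (lam : vec l) (v : vec (m + n)) : vec n :=
  fun j => dot lam (D2g zb (vjoin (@vzero m) (ebasis j)) v).

Definition hess_mu_h (yb : vec l) (mu : vec d) (w : vec l) : vec l :=
  fun j => dot mu (D2h yb w (ebasis j)).

(* H_lam v, with mu = (nabla h(g zb)^* )^{-1} lam *)
Definition H_op (zb : vec (m + n)) (mu : vec d) (v : vec (m + n)) : vec n :=
  adj (Dxg zb) (hess_mu_h (g zb) mu (Dg zb v)).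

Definition rhs_set (zb : vec (m + n)) (xs : vec n) (v : vec (m + n)) (us : vec n) : Prop :=
  exists zs : vec (m + n),
    normal_cone (tangent_cone gph_Gamma zb) v zs /\
    vsnd zs = xs /\
    exists lam : vec l, Lambda_dir zb zs v lam /\
    exists mu : vec d, adj (Dh (g zb)) mu = lam /\
    exists w : vec (m + n), normal_cone (crit_cone gph_Gamma zb zs) v w /\
    us = vadd (vadd (dDxg_adj zb lam v) (H_op zb mu v)) (vsnd w).

End System.

(* Main.v *)
(* Near zb the graph of Gamma is {z | G z in K} with G = h o g, by metric
   regularity of h; put A = G'(zb) and b = G''(zb)(v, v).

   From left to right: stability gives bounded multipliers mu_k of the normals
   along a tangent sequence z_k = zb + t_k v_k, with <mu_k, G z_k> = 0. A cluster
   point mu is a multiplier of z^* = A^* mu. If P is the whole characteristic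
   subspace, the p-part of A^* (mu_k - mu) is a linear image of its x-part, so
   A^* (mu_k - mu) / t_k converges; the limit w lies in the polar of the critical
   cone, and comparing <mu, G z_k> with <mu_k, G z_k> = 0 gives both <w, v> = 0 and
   <mu, G z_k> = o(t_k^2), hence the maximality of mu. If K is polyhedral, the mu_k
   may be taken in the cone generated by those generators of the polar of K that
   vanish at every G z_k, and closedness of finitely generated cones replaces the
   convergence argument.

   From right to left: conic duality yields s with b + A s nearly in K and
   <mu, b> + <A^* mu, s> nearly nonnegative, so z = zb + t v + t^2/2 s, corrected by
   stability, is feasible with <mu, G z> >= - o(t^2). Approximating w by
   A^* nu - c A^* mu with nu in the polar of K, the function
   <(1 - t c) mu + t nu, G> is nonpositive on the graph and almost maximal at z. A
   maximiser of this function minus |x - x_z|^2 over the section through z is at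
   distance o(t) from z, and its first-order optimality condition supplies the
   required normal. *)

Require Import Defs.
From Stdlib Require Reals Lra Classical FunctionalExtensionality IndefiniteDescription.
From HB Require structures.
From mathcomp Require all_boot.

(** Working with G keeps the curvature of h inside the second derivative of G, so that C and its
    multipliers appear only in the final reduction; as h'(g zb) is onto, lambda and mu determine
    each other. The obstacle from left to right is a missing rate: mu_k tends to mu, but (mu_k - mu)
    / t_k may be unbounded, and the normal equation controls only the x-part of A^* (mu_k - mu) /
    t_k. The two alternative assumptions are two ways of recovering from this x-part a covector on
    the whole space. The obstacle from right to left is missing closedness: the conic programme may
    have no solution s, and the cone A^* (polar of K) - R_+ A^* mu may fail to be closed. Hence
    every construction there carries a small error, which the closedness of tangent cones absorbs
    ([tangent_eps]). The penalty is quadratic because a gap of order o(t^2) in the value then moves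
    the maximiser by only o(t); the gradient of the penalty is of the same order and disappears
    after division by t. *)

Module NormalMapTangent.
Import Reals Lra Classical FunctionalExtensionality IndefiniteDescription.
Import HB.structures.
Import all_boot.
Set Implicit Arguments.
Unset Strict Implicit.
Unset Printing Implicit Defensive.
Open Scope R_scope.

(** * Euclidean vectors and linear maps *)

HB.instance Definition _ := Monoid.isComLaw.Build R 0 Rplus
  (fun x y z => esym (Rplus_assoc x y z)) Rplus_comm Rplus_0_l.

Notation "x +v y" := (vadd x y) (at level 50, left associativity).
Notation "x -v y" := (vsub x y) (at level 50, left associativity).
Notation "t *v x" := (vscale t x) (at level 40, left associativity).

Ltac vext := let i := fresh "i" in
  apply: functional_extensionality => i; rewrite /vadd /vsub /vscale /vopp /vzero; try ring.

Lemma sumR_morph (f : R -> R) k (F : 'I_k -> R) :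
  (forall x y, f (x + y) = f x + f y) -> f 0 = 0 ->
  f (\big[Rplus/0]_(i < k) F i) = \big[Rplus/0]_(i < k) f (F i).
Proof. by move=> fD f0; apply: (big_morph f). Qed.

Lemma sumRZ c k (F : 'I_k -> R) : c * \big[Rplus/0]_(i < k) F i = \big[Rplus/0]_(i < k) (c * F i).
Proof. by rewrite (sumR_morph (f := fun s => c * s)) //; move=> *; ring. Qed.

Lemma sumRB k (F G : 'I_k -> R) :
  \big[Rplus/0]_(i < k) F i - \big[Rplus/0]_(i < k) G i = \big[Rplus/0]_(i < k) (F i - G i).
Proof.
rewrite (_ : _ - _ = \big[Rplus/0]_(i < k) F i + (-1) * \big[Rplus/0]_(i < k) G i); last ring.
by rewrite sumRZ -big_split; apply: eq_bigr => i _ /=; ring.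
Qed.

Lemma dotC k (x y : vec k) : dot x y = dot y x.
Proof. by apply: eq_bigr => i _; ring. Qed.

Lemma dotDl k (x y z : vec k) : dot (x +v y) z = dot x z + dot y z.
Proof. by rewrite /dot -big_split /=; apply: eq_bigr => i _; rewrite /vadd; ring. Qed.

Lemma dotZl k t (x z : vec k) : dot (t *v x) z = t * dot x z.
Proof.
by rewrite /dot sumRZ; apply: eq_bigr => i _; rewrite /vscale; ring.
Qed.

Lemma dotDr k (x y z : vec k) : dot z (x +v y) = dot z x + dot z y.
Proof. by rewrite dotC dotDl !(dotC _ z). Qed.
Lemma dotZr k t (x z : vec k) : dot z (t *v x) = t * dot z x.
Proof. by rewrite dotC dotZl dotC. Qed.

Lemma vsubE k (x y : vec k) : x -v y = x +v (-1) *v y. Proof. by vext. Qed.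
Lemma voppE k (x : vec k) : vopp x = (-1) *v x. Proof. by vext. Qed.
Lemma vzeroE k (x : vec k) : @vzero k = 0 *v x. Proof. by vext. Qed.

Lemma dotBl k (x y z : vec k) : dot (x -v y) z = dot x z - dot y z.
Proof. by rewrite vsubE dotDl dotZl; ring. Qed.
Lemma dotBr k (x y z : vec k) : dot z (x -v y) = dot z x - dot z y.
Proof. by rewrite dotC dotBl !(dotC _ z). Qed.
Lemma dotNl k (x z : vec k) : dot (vopp x) z = - dot x z.
Proof. by rewrite voppE dotZl; ring. Qed.
Lemma dotNr k (x z : vec k) : dot z (vopp x) = - dot z x.
Proof. by rewrite dotC dotNl dotC. Qed.
Lemma dot0l k (z : vec k) : dot (@vzero k) z = 0.
Proof. by rewrite (vzeroE z) dotZl; ring. Qed.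
Lemma dot0r k (z : vec k) : dot z (@vzero k) = 0.
Proof. by rewrite dotC dot0l. Qed.

Definition dotE := (dotDl, dotDr, dotBl, dotBr, dotZl, dotZr, dotNl, dotNr, dot0l, dot0r).

Lemma sumR_ge0 k (F : 'I_k -> R) : (forall i, 0 <= F i) -> 0 <= \big[Rplus/0]_(i < k) F i.
Proof. by move=> F0; apply: (big_ind (fun x => 0 <= x)) => // *; lra. Qed.

Lemma sumR_le k (F G : 'I_k -> R) : (forall i, F i <= G i) ->
  \big[Rplus/0]_(i < k) F i <= \big[Rplus/0]_(i < k) G i.
Proof. by move=> FG; apply: (big_ind2 (fun x y => x <= y)) => // *; lra. Qed.

Lemma dot_ge0 k (x : vec k) : 0 <= dot x x.
Proof. by apply: sumR_ge0 => i; apply: Rle_0_sqr. Qed.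

Lemma coord_sqr_le k (x : vec k) i : x i * x i <= dot x x.
Proof.
rewrite /dot (bigD1 i) //=.
set S := \big[_/_]_(_ < _ | _) _; suff: 0 <= S by lra.
by apply: (big_ind (fun x => 0 <= x)) => [|*|j _]; [lra|lra|apply: Rle_0_sqr].
Qed.

Lemma dot_eq0 k (x : vec k) : dot x x <= 0 -> x = @vzero k.
Proof.
move=> x0; apply: functional_extensionality => i; rewrite /vzero.
have := coord_sqr_le x i; nra.
Qed.

Lemma vnorm_ge0 k (x : vec k) : 0 <= vnorm x. Proof. exact: sqrt_pos. Qed.
Lemma vnorm_sqr k (x : vec k) : vnorm x * vnorm x = dot x x.
Proof. exact/sqrt_sqrt/dot_ge0. Qed.
Lemma vnorm0 k : vnorm (@vzero k) = 0.
Proof. by rewrite /vnorm dot0l sqrt_0. Qed.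
Lemma vnorm_eq0 k (x : vec k) : vnorm x <= 0 -> x = @vzero k.
Proof. move=> x0; apply: dot_eq0; rewrite -vnorm_sqr; have := vnorm_ge0 x; nra. Qed.

Lemma le_of_sqr a b : 0 <= b -> a * a <= b * b -> a <= b.
Proof. nra. Qed.

Lemma cauchy_schwarz k (x y : vec k) : dot x y <= vnorm x * vnorm y.
Proof.
have ny := vnorm_ge0 y; have nx := vnorm_ge0 x.
case: (Rle_lt_dec (vnorm y) 0) => [/vnorm_eq0 ->|y0].
  by rewrite dot0r vnorm0; lra.
apply: le_of_sqr; first nra.
(* The component of [x] orthogonal to [y], scaled by |y|^2 so that no division occurs. *)
have := dot_ge0 (vnorm y * vnorm y *v x -v dot x y *v y).
rewrite !dotE (dotC y x) -!vnorm_sqr => H.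
have {}H : 0 <= vnorm y * vnorm y * (vnorm x * vnorm x * (vnorm y * vnorm y) - dot x y * dot x y).
  by apply: Rle_trans H _; apply: Req_le; ring.
have y2 : 0 < vnorm y * vnorm y by nra.
nra.
Qed.

Lemma cauchy_schwarz_abs k (x y : vec k) : Rabs (dot x y) <= vnorm x * vnorm y.
Proof.
apply: Rabs_le; split; last exact: cauchy_schwarz.
have := cauchy_schwarz (vopp x) y; rewrite dotNl.
suff -> : vnorm (vopp x) = vnorm x by lra.
by rewrite /vnorm !dotE; congr sqrt; ring.
Qed.

Lemma vnormN k (x : vec k) : vnorm (vopp x) = vnorm x.
Proof. by rewrite /vnorm !dotE; congr sqrt; ring. Qed.
Lemma vnormBC k (x y : vec k) : vnorm (x -v y) = vnorm (y -v x).
Proof. by rewrite -vnormN; congr vnorm; vext. Qed.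

Lemma vnormD k (x y : vec k) : vnorm (x +v y) <= vnorm x + vnorm y.
Proof.
have := vnorm_ge0 x; have := vnorm_ge0 y => ny nx.
apply: le_of_sqr; first lra.
rewrite vnorm_sqr !dotE (dotC y x) -!vnorm_sqr; have := cauchy_schwarz x y; lra.
Qed.

Lemma vnormB k (x y : vec k) : vnorm (x -v y) <= vnorm x + vnorm y.
Proof. by rewrite -(vnormN y); apply: Rle_trans (vnormD _ _); apply: Req_le; congr vnorm; vext. Qed.

Lemma vnorm_tri k (y x z : vec k) : vnorm (x -v z) <= vnorm (x -v y) + vnorm (y -v z).
Proof. by apply: Rle_trans (vnormD _ _); apply: Req_le; congr vnorm; vext. Qed.

Lemma vnormZ k t (x : vec k) : vnorm (t *v x) = Rabs t * vnorm x.
Proof. rewrite /vnorm !dotE -Rmult_assoc sqrt_mult_alt ?sqrt_Rsqr_abs //; exact: Rle_0_sqr. Qed.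

Lemma vnormZ_pos k t (x : vec k) : 0 <= t -> vnorm (t *v x) = t * vnorm x.
Proof. by move=> t0; rewrite vnormZ Rabs_pos_eq. Qed.

Lemma vnormDB k (x y : vec k) : vnorm x <= vnorm y + vnorm (x -v y).
Proof. by apply: Rle_trans (vnormD _ _); apply: Req_le; congr vnorm; vext. Qed.

Lemma vsub_self k (x : vec k) : x -v x = @vzero k. Proof. by vext. Qed.

Lemma vsub_eq0 k (x y : vec k) : x -v y = @vzero k -> x = y.
Proof.
move=> H; apply: functional_extensionality => i.
by have := f_equal (fun v => v i) H; rewrite /vsub /vzero; lra.
Qed.

Lemma coord_le_vnorm k (x : vec k) i : Rabs (x i) <= vnorm x.
Proof.
apply: le_of_sqr; first exact: vnorm_ge0.
rewrite vnorm_sqr -Rabs_mult Rabs_pos_eq; [exact: coord_sqr_le|exact: Rle_0_sqr].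
Qed.

Lemma dot_ebasis k (x : vec k) i : dot x (ebasis i) = x i.
Proof.
rewrite /dot (bigD1 i) //= /ebasis eqxx big1 /=; first by ring.
by move=> j /negbTE ->; ring.
Qed.

Lemma vnorm_ebasis k (i : 'I_k) : vnorm (ebasis i) = 1.
Proof. by rewrite /vnorm dot_ebasis /ebasis eqxx sqrt_1. Qed.

Lemma dot_ext k (x y : vec k) : (forall z, dot x z = dot y z) -> x = y.
Proof. by move=> H; apply: functional_extensionality => i; rewrite -!dot_ebasis. Qed.

Definition vsum k a (F : 'I_a -> vec k) : vec k := fun i => \big[Rplus/0]_(j < a) F j i.

Lemma vsum_big k a (F : 'I_a -> vec k) : vsum F = \big[@vadd k/@vzero k]_(j < a) F j.
Proof.
apply: functional_extensionality => i; rewrite /vsum.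
by rewrite (big_morph (fun v : vec k => v i) (op1 := Rplus) (id1 := 0)).
Qed.

Lemma vnorm_vsum k a (F : 'I_a -> vec k) : vnorm (vsum F) <= \big[Rplus/0]_(j < a) vnorm (F j).
Proof.
rewrite vsum_big; apply: (big_ind2 (fun (v : vec k) r => vnorm v <= r)) => [|x r y s Hx Hy|i _].
- by rewrite vnorm0; lra.
- by apply: Rle_trans (vnormD _ _) _; lra.
- by lra.
Qed.

Lemma vec_basisE k (x : vec k) : x = vsum (fun j => x j *v ebasis j).
Proof.
apply: functional_extensionality => i; rewrite /vsum.
rewrite (bigD1 i) //= big1 /vscale /ebasis ?eqxx; first by rewrite /=; ring.
by move=> j ij; rewrite eq_sym (negbTE ij); ring.
Qed.

Lemma sumR_const k c : \big[Rplus/0]_(j < k) c = INR k * c.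
Proof.
elim: k => [|k IH]; first by rewrite big_ord0 /=; ring.
by rewrite big_ord_recl IH S_INR; ring.
Qed.

Section Linear.
Variables (a b : nat) (L : vec a -> vec b).
Hypothesis Llin : is_linear L.

Lemma linD x y : L (x +v y) = L x +v L y. Proof. exact: (proj1 Llin). Qed.
Lemma linZ t x : L (t *v x) = t *v L x. Proof. exact: (proj2 Llin). Qed.
Lemma linB x y : L (x -v y) = L x -v L y. Proof. by rewrite !vsubE linD linZ. Qed.
Lemma lin0 : L (@vzero a) = @vzero b.
Proof. by rewrite (vzeroE (@vzero a)) linZ; vext. Qed.
Lemma lin_vsum k (F : 'I_k -> vec a) : L (vsum F) = vsum (fun j => L (F j)).
Proof. by rewrite !vsum_big (big_morph L (op1 := @vadd b) (id1 := @vzero b)) //; [exact: linD|exact: lin0]. Qed.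
Lemma lin_basis x : L x = vsum (fun j => x j *v L (ebasis j)).
Proof. by rewrite {1}(vec_basisE x) lin_vsum; congr vsum; apply: functional_extensionality => j; rewrite linZ. Qed.
End Linear.

Lemma dot_vsum k a (y : vec k) (F : 'I_a -> vec k) :
  dot y (vsum F) = \big[Rplus/0]_(j < a) dot y (F j).
Proof.
by rewrite vsum_big (big_morph (dot y) (op1 := Rplus) (id1 := 0)) //; [move=> *; exact: dotDr|exact: dot0r].
Qed.

Lemma dot_adj a b (L : vec a -> vec b) y x : is_linear L -> dot (adj L y) x = dot y (L x).
Proof.
move=> Ll; rewrite (lin_basis Ll x) dot_vsum; apply: eq_bigr => j _.
by rewrite dotZr /adj; ring.
Qed.

Lemma adj_lin a b (L : vec a -> vec b) : is_linear (adj L).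
Proof. by split=> *; apply: functional_extensionality => j; rewrite /adj /vadd /vscale !dotE. Qed.

Lemma lin_bounded a b (L : vec a -> vec b) : is_linear L ->
  exists M, 0 <= M /\ forall x, vnorm (L x) <= M * vnorm x.
Proof.
move=> Ll; exists (\big[Rplus/0]_(j < a) vnorm (L (ebasis j))); split.
  by apply: sumR_ge0 => j; apply: vnorm_ge0.
move=> x; rewrite {1}(lin_basis Ll x); apply: Rle_trans (vnorm_vsum _) _.
rewrite Rmult_comm sumRZ.
apply: sumR_le => j; rewrite vnormZ.
by apply: Rmult_le_compat_r; [apply: vnorm_ge0|apply: coord_le_vnorm].
Qed.

Section Join.
Variables m n : nat.
Lemma vfst_join (p : vec m) (x : vec n) : vfst (vjoin p x) = p.
Proof. by apply: functional_extensionality => j; rewrite /vfst /vjoin (unsplitK (inl j)). Qed.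
Lemma vsnd_join (p : vec m) (x : vec n) : vsnd (vjoin p x) = x.
Proof. by apply: functional_extensionality => j; rewrite /vsnd /vjoin (unsplitK (inr j)). Qed.
Lemma vjoin_eta (z : vec (m + n)) : vjoin (vfst z) (vsnd z) = z.
Proof.
apply: functional_extensionality => j; rewrite /vjoin.
by case: splitP => i ij; rewrite /vfst /vsnd; congr z; apply: val_inj.
Qed.
Lemma vfstD (z w : vec (m + n)) : vfst (z +v w) = vfst z +v vfst w. Proof. by []. Qed.
Lemma vsndD (z w : vec (m + n)) : vsnd (z +v w) = vsnd z +v vsnd w. Proof. by []. Qed.
Lemma vfstB (z w : vec (m + n)) : vfst (z -v w) = vfst z -v vfst w. Proof. by []. Qed.
Lemma vsndB (z w : vec (m + n)) : vsnd (z -v w) = vsnd z -v vsnd w. Proof. by []. Qed.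
Lemma vfstZ t (z : vec (m + n)) : vfst (t *v z) = t *v vfst z. Proof. by []. Qed.
Lemma vsndZ t (z : vec (m + n)) : vsnd (t *v z) = t *v vsnd z. Proof. by []. Qed.
Lemma vjoin_ext (z w : vec (m + n)) : vfst z = vfst w -> vsnd z = vsnd w -> z = w.
Proof. by move=> e1 e2; rewrite -(vjoin_eta z) -(vjoin_eta w) e1 e2. Qed.
Lemma dot_join (z w : vec (m + n)) : dot z w = dot (vfst z) (vfst w) + dot (vsnd z) (vsnd w).
Proof. by rewrite /dot big_split_ord. Qed.
Lemma vnorm_join_le (z : vec (m + n)) : vnorm z <= vnorm (vfst z) + vnorm (vsnd z).
Proof.
have := vnorm_ge0 (vfst z); have := vnorm_ge0 (vsnd z) => h1 h2.
by apply: le_of_sqr; [lra|rewrite vnorm_sqr dot_join -!vnorm_sqr; nra].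
Qed.
Lemma vnorm_fst_le (z : vec (m + n)) : vnorm (vfst z) <= vnorm z.
Proof. apply: le_of_sqr; [exact: vnorm_ge0|rewrite !vnorm_sqr (dot_join z)]; have := dot_ge0 (vsnd z); lra. Qed.
Lemma vnorm_snd_le (z : vec (m + n)) : vnorm (vsnd z) <= vnorm z.
Proof. apply: le_of_sqr; [exact: vnorm_ge0|rewrite !vnorm_sqr (dot_join z)]; have := dot_ge0 (vfst z); lra. Qed.
End Join.

Definition vjoinE := (vfst_join, vsnd_join, vfstD, vsndD, vfstB, vsndB, vfstZ, vsndZ).

Lemma vsnd_inj_lin m n : is_linear (fun u : vec n => vjoin (@vzero m) u).
Proof. by split=> *; apply: vjoin_ext; rewrite !vjoinE //; vext. Qed.

Lemma lin_comp a b c (L : vec a -> vec b) (M : vec b -> vec c) :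
  is_linear L -> is_linear M -> is_linear (fun x => M (L x)).
Proof. by move=> [l1 l2] [m1 m2]; split=> *; rewrite ?l1 ?l2 ?m1 ?m2. Qed.

(** * Sequences and convex cones *)

Lemma cv_const c : Un_cv (fun=> c) c.
Proof. by move=> e e0; exists 0%N => j _; rewrite /Rdist Rminus_diag Rabs_R0. Qed.

Lemma cv_ext u v a : (forall j, u j = v j) -> Un_cv u a -> Un_cv v a.
Proof. by move=> uv ua; have -> : v = u by apply: functional_extensionality => j. Qed.

Lemma cvP u a : Un_cv u a <->
  forall e, 0 < e -> exists N : nat, forall j, (N <= j)%nat -> Rabs (u j - a) < e.
Proof.
split=> H e e0; have [N HN] := H e e0; exists N => j.
  by move/leP => h; apply: HN.
by move=> /leP h; apply: HN.
Qed.

(** A subsequence is encoded by any index map with [j <= phi j]: this suffices to transport limits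
    and is stable under composition. *)
Lemma cv_sub (phi : nat -> nat) u a : (forall j, (j <= phi j)%nat) -> Un_cv u a -> Un_cv (fun j => u (phi j)) a.
Proof.
move=> hphi /cvP H; apply/cvP => e e0; have [N HN] := H e e0; exists N => j Nj.
by apply: HN; apply: leq_trans Nj _.
Qed.

Lemma cv_squeeze u v a : (forall j, Rabs (u j - a) <= v j) -> Un_cv v 0 -> Un_cv u a.
Proof.
move=> uv /cvP H; apply/cvP => e e0; have [N HN] := H e e0; exists N => j Nj.
apply: Rle_lt_trans (uv j) _; have := HN j Nj; rewrite Rminus_0_r.
by apply: Rle_lt_trans; apply: Rle_abs.
Qed.

Lemma cv_inv : Un_cv (fun j => / (INR j + 1)) 0.
Proof.
apply/cvP => e e0; have [N HN] := INR_unbounded (/ e); exists N => j Nj.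
have hj : / e < INR j + 1 by have := le_INR _ _ (elimT leP Nj); lra.
have ie := Rinv_0_lt_compat _ e0.
rewrite Rminus_0_r Rabs_pos_eq; last by apply/Rlt_le/Rinv_0_lt_compat; lra.
by rewrite -(Rinv_inv e); apply: Rinv_lt_contravar => //; nra.
Qed.

Lemma inv_pos j : 0 < / (INR j + 1).
Proof. by apply: Rinv_0_lt_compat; have := pos_INR j; lra. Qed.

Lemma cv_le u a M : (forall j, u j <= M) -> Un_cv u a -> a <= M.
Proof. by move=> uM ua; apply: (Rle_cv_lim uM ua); apply: cv_const. Qed.
Lemma cv_ge u a M : (forall j, M <= u j) -> Un_cv u a -> M <= a.
Proof. by move=> uM ua; apply: (Rle_cv_lim uM _ ua); apply: cv_const. Qed.

Lemma cv_sum k (F : nat -> 'I_k -> R) G : (forall i, Un_cv (fun j => F j i) (G i)) ->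
  Un_cv (fun j => \big[Rplus/0]_(i < k) F j i) (\big[Rplus/0]_(i < k) G i).
Proof.
elim: k F G => [|k IH] F G H.
  by rewrite big_ord0; apply: cv_ext (cv_const 0) => j; rewrite big_ord0.
rewrite big_ord_recl; apply: cv_ext; first by move=> j; rewrite big_ord_recl.
by apply: CV_plus => //; apply: IH.
Qed.

Section VecSeq.
Variable k : nat.
Implicit Types (w : nat -> vec k) (x : vec k).

Lemma vcvP w x : vseq_cv w x <-> Un_cv (fun j => vnorm (w j -v x)) 0.
Proof.
split=> [H|/cvP H].
  apply/cvP => e e0; have [N HN] := H e e0; exists N => j /HN.
  by rewrite Rminus_0_r Rabs_pos_eq //; apply: vnorm_ge0.
move=> e e0; have [N HN] := H e e0; exists N => j /HN.
by rewrite Rminus_0_r Rabs_pos_eq //; apply: vnorm_ge0.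
Qed.

Lemma vcv_coord w x : vseq_cv w x <-> forall i, Un_cv (fun j => w j i) (x i).
Proof.
split=> [/vcvP H i|H].
  by apply: cv_squeeze H => j; apply: (coord_le_vnorm (w j -v x)).
apply/vcvP.
have H2 : Un_cv (fun j => \big[Rplus/0]_(i < k) Rabs (w j i - x i)) 0.
  suff: Un_cv (fun j => \big[Rplus/0]_(i < k) Rabs (w j i - x i)) (\big[Rplus/0]_(i < k) 0).
    by rewrite sumR_const Rmult_0_r.
  apply: (cv_sum (F := fun j i => Rabs (w j i - x i)) (G := fun=> 0)) => i.
  by move/cvP: (H i) => Hi; apply/cvP => e /Hi [N HN]; exists N => j /HN; rewrite Rminus_0_r Rabs_Rabsolu.
apply: cv_squeeze H2 => j; rewrite Rminus_0_r (Rabs_pos_eq _ (vnorm_ge0 _)).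
rewrite {1}(vec_basisE (w j -v x)); apply: Rle_trans (vnorm_vsum _) _; apply: sumR_le => i.
by rewrite vnormZ vnorm_ebasis Rmult_1_r; apply: Rle_refl.
Qed.

Lemma vcv_const x : vseq_cv (fun=> x) x.
Proof. by apply/vcv_coord => i; apply: cv_const. Qed.

Lemma vcv_sub (phi : nat -> nat) w x : (forall j, (j <= phi j)%nat) ->
  vseq_cv w x -> vseq_cv (fun j => w (phi j)) x.
Proof. by move=> hphi /vcv_coord H; apply/vcv_coord => i; apply: (cv_sub hphi (H i)). Qed.

Lemma vcv_ext w w' x : (forall j, w j = w' j) -> vseq_cv w x -> vseq_cv w' x.
Proof. by move=> ww wx; have -> : w' = w by apply: functional_extensionality => j. Qed.

Lemma vcvD w x w' x' : vseq_cv w x -> vseq_cv w' x' -> vseq_cv (fun j => w j +v w' j) (x +v x').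
Proof. by move=> /vcv_coord H /vcv_coord H'; apply/vcv_coord => i; apply: CV_plus. Qed.
Lemma vcvB w x w' x' : vseq_cv w x -> vseq_cv w' x' -> vseq_cv (fun j => w j -v w' j) (x -v x').
Proof. by move=> /vcv_coord H /vcv_coord H'; apply/vcv_coord => i; apply: CV_minus. Qed.
Lemma vcvZ t a w x : Un_cv t a -> vseq_cv w x -> vseq_cv (fun j => t j *v w j) (a *v x).
Proof. by move=> ta /vcv_coord H; apply/vcv_coord => i; apply: CV_mult. Qed.
Lemma cv_dot w x w' x' : vseq_cv w x -> vseq_cv w' x' -> Un_cv (fun j => dot (w j) (w' j)) (dot x x').
Proof.
move=> /vcv_coord H /vcv_coord H'.
by apply: (cv_sum (F := fun j i => w j i * w' j i) (G := fun i => x i * x' i)) => i; apply: CV_mult.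
Qed.

Lemma vcv_unique w x y : vseq_cv w x -> vseq_cv w y -> x = y.
Proof.
move=> /vcv_coord H /vcv_coord H'; apply: functional_extensionality => i.
exact: UL_sequence (H i) (H' i).
Qed.

Lemma cv_vnorm w x : vseq_cv w x -> Un_cv (fun j => vnorm (w j)) (vnorm x).
Proof.
move/vcvP => H; apply: cv_squeeze H => j; apply: Rabs_le.
by have := vnormDB (w j) x; have := vnormDB x (w j); rewrite (vnormBC x); lra.
Qed.

Lemma vcv_squeeze w x u : (forall j, vnorm (w j -v x) <= u j) -> Un_cv u 0 -> vseq_cv w x.
Proof.
move=> H u0; apply/vcvP; apply: cv_squeeze u0 => j.
by rewrite Rminus_0_r Rabs_pos_eq //; apply: vnorm_ge0.
Qed.

Lemma vcv_bounded w x : vseq_cv w x -> exists M, forall j, vnorm (w j) <= M.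
Proof.
move=> H; have [N HN] := H 1 Rlt_0_1.
exists (vnorm x + 1 + \big[Rplus/0]_(i < N) vnorm (w i)) => j.
have S0 : 0 <= \big[Rplus/0]_(i < N) vnorm (w i) by apply: sumR_ge0 => i; apply: vnorm_ge0.
case: (leqP N j) => [/HN|jN]; first by have := vnormDB (w j) x; lra.
have := vnorm_ge0 x; rewrite (bigD1 (Ordinal jN)) //=.
set S := \big[_/_]_(_ < _ | _) _; suff: 0 <= S by lra.
by apply: (big_ind (fun r => 0 <= r)) => [|*|i _]; [lra|lra|apply: vnorm_ge0].
Qed.
End VecSeq.

Lemma vcv_lin a b (L : vec a -> vec b) w x : is_linear L -> vseq_cv w x -> vseq_cv (fun j => L (w j)) (L x).
Proof.
move=> Ll /vcvP H; have [M [M0 HM]] := lin_bounded Ll.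
apply: vcv_squeeze; first by move=> j; rewrite -linB //; apply: HM.
by rewrite -(Rmult_0_r M); apply: CV_mult H; apply: cv_const.
Qed.

Lemma vcv_snd m n (w : nat -> vec (m + n)) x : vseq_cv w x -> vseq_cv (fun j => vsnd (w j)) (vsnd x).
Proof. by move=> /vcv_coord H; apply/vcv_coord => i; apply: H. Qed.
Lemma vcv_fst m n (w : nat -> vec (m + n)) x : vseq_cv w x -> vseq_cv (fun j => vfst (w j)) (vfst x).
Proof. by move=> /vcv_coord H; apply/vcv_coord => i; apply: H. Qed.
Lemma vcv_join m n (w : nat -> vec m) x (w' : nat -> vec n) x' :
  vseq_cv w x -> vseq_cv w' x' -> vseq_cv (fun j => vjoin (w j) (w' j)) (vjoin x x').
Proof.
move=> /vcv_coord H /vcv_coord H'; apply/vcv_coord => i; rewrite /vjoin.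
by case: (split i).
Qed.

(** * Compactness and attainment of minima *)

Lemma bw_real (u : nat -> R) M : (forall j, Rabs (u j) <= M) ->
  exists (phi : nat -> nat) a, (forall j, (j <= phi j)%nat) /\ Un_cv (fun j => u (phi j)) a.
Proof.
move=> uM.
have [j|a Ha] := Bolzano_Weierstrass u (fun c => - M <= c <= M) (compact_P3 (- M) M).
  by have := uM j; rewrite /Rabs; case: Rcase_abs; lra.
have /functional_choice [phi Hphi] : forall j : nat, exists p : nat, (j <= p)%nat /\ Rabs (u p - a) < / (INR j + 1).
  move=> j; have [|p [/leP jp Hp]] := Ha (disc a (mkposreal _ (inv_pos j))) j.
    by exists (mkposreal _ (inv_pos j)).
  by exists p.
exists phi, a; split=> [j|]; first by case: (Hphi j).
by apply: cv_squeeze cv_inv => j; apply/Rlt_le; case: (Hphi j).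
Qed.

Lemma bw_vec k (w : nat -> vec k) M : (forall j, vnorm (w j) <= M) ->
  exists (phi : nat -> nat) x, (forall j, (j <= phi j)%nat) /\ vseq_cv (fun j => w (phi j)) x.
Proof.
move=> wM.
(* Induction on the number [q] of coordinates that converge along [phi]. The limit is quantified
   before the test [i < q], so that choice returns a vector. *)
suff /(_ k) [phi [hphi Hx]] : forall q : nat, exists phi : nat -> nat, (forall j, (j <= phi j)%nat) /\
    forall i : 'I_k, exists a, (i < q)%nat -> Un_cv (fun j => w (phi j) i) a.
  move/functional_choice: Hx => [x Hx]; exists phi, x; split=> //.
  by apply/vcv_coord => i; apply: Hx.
elim=> [|q [phi [hphi IH]]]; first by exists id; split=> // i; exists 0.
case: (ltnP q k) => qk; last first.
  by exists phi; split=> // i; have [a Ha] := IH i; exists a => _; apply: Ha; apply: leq_trans (ltn_ord i) qk.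
have [|psi [a [hpsi Ha]]] := @bw_real (fun j => w (phi j) (Ordinal qk)) M.
  by move=> j; exact: (Rle_trans _ _ _ (coord_le_vnorm _ _) (wM _)).
exists (fun j => phi (psi j)); split=> [j|i]; first exact: leq_trans (hpsi j) (hphi _).
case: (ltngtP i q) => [iq|iq|iq].
- by have [b Hb] := IH i; exists b => _; exact: (@cv_sub psi (fun j => w (phi j) i) b hpsi (Hb iq)).
- by exists 0; rewrite ltnS leqNgt iq.
- by exists a => _; have -> : i = Ordinal qk by apply: val_inj.
Qed.

Lemma extreme_value k (S : vec k -> Prop) (f : vec k -> R) M :
  (exists x, S x) -> vclosed S -> (forall x, S x -> vnorm x <= M) ->
  (forall w x, (forall j, S (w j)) -> S x -> vseq_cv w x -> Un_cv (fun j => f (w j)) (f x)) ->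
  exists x, S x /\ forall y, S y -> f x <= f y.
Proof.
move=> [s Ss] Scl SM fc.
have [B HB] : exists B, forall y, S y -> B <= f y.
  apply: NNPP => nB.
  have /functional_choice [w Hw] : forall j : nat, exists y, S y /\ f y < - INR j.
    move=> j; apply: NNPP => nj; apply: nB; exists (- INR j) => y Sy.
    by apply: Rnot_lt_le => lt; apply: nj; exists y.
  have [|phi [x [hphi Hx]]] := @bw_vec k w M; first by move=> j; apply: SM; case: (Hw j).
  have Sx : S x by apply: Scl Hx => j; case: (Hw (phi j)).
  have /cvP/(_ 1 Rlt_0_1) [N HN] := fc _ _ (fun j => proj1 (Hw (phi j))) Sx Hx.
  have [N' HN'] := INR_unbounded (1 - f x).
  have := HN (maxn N N') (leq_maxl _ _); have := proj2 (Hw (phi (maxn N N'))).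
  have : INR N' <= INR (phi (maxn N N')).
    by apply/le_INR/leP; apply: leq_trans (leq_maxr _ _) (hphi _).
  by move=> ? ? /Rabs_def2; lra.
(* Completeness is stated for suprema: [i] is the supremum of - f, hence - i the infimum of f. *)
have [||i [i1 i2]] := completeness (fun r => exists y, S y /\ r = - f y).
- by exists (- B) => r [y [Sy ->]]; have := HB y Sy; lra.
- by exists (- f s), s.
have /functional_choice [w Hw] : forall j : nat, exists y, S y /\ f y < - i + / (INR j + 1).
  move=> j; apply: NNPP => nj; have : i <= i - / (INR j + 1); last by have := inv_pos j; lra.
  apply: i2 => r [y [Sy ->]]; apply: Rnot_lt_le => lt; apply: nj; exists y; split=> //.
  by have := inv_pos j; lra.
have [|phi [x [hphi Hx]]] := @bw_vec k w M; first by move=> j; apply: SM; case: (Hw j).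
have Sx : S x by apply: Scl Hx => j; case: (Hw (phi j)).
exists x; split=> // y Sy.
have fx := fc _ _ (fun j => proj1 (Hw (phi j))) Sx Hx.
have : - f y <= i by apply: i1; exists y.
suff : f x <= - i by lra.
have := CV_plus _ _ _ _ (cv_const (- i)) (cv_sub hphi cv_inv); rewrite Rplus_0_r.
by move=> H; apply: (Rle_cv_lim _ fx H) => j; apply/Rlt_le; case: (Hw (phi j)).
Qed.

Lemma closed_dist k (Q : vec k -> Prop) x : vclosed Q -> ~ Q x ->
  exists e, 0 < e /\ forall q, Q q -> e <= vnorm (x -v q).
Proof.
move=> Qcl nQ; apply: NNPP => nE; apply: nQ.
have /functional_choice [w Hw] : forall j : nat, exists y, Q y /\ vnorm (y -v x) <= / (INR j + 1).
  move=> j; apply: NNPP => nj; apply: nE; exists (/ (INR j + 1)); split; first exact: inv_pos.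
  move=> q Qq; apply: Rnot_lt_le => lt; apply: nj; exists q; rewrite vnormBC; split=> //; lra.
apply: (Qcl w); first by move=> j; case: (Hw j).
by apply: vcv_squeeze cv_inv => j; case: (Hw j).
Qed.

(** * Projections, separation and polar cones *)

Definition vconvex k (Q : vec k -> Prop) :=
  forall x y t, 0 <= t <= 1 -> Q x -> Q y -> Q (x +v t *v (y -v x)).

Lemma nearest_point k (Q : vec k -> Prop) x : (exists q, Q q) -> vclosed Q ->
  exists p, Q p /\ forall q, Q q -> vnorm (x -v p) <= vnorm (x -v q).
Proof.
move=> [q0 Qq0] Qcl.
pose S y := Q y /\ vnorm (x -v y) <= vnorm (x -v q0).
have cn w y : vseq_cv w y -> Un_cv (fun j => vnorm (x -v w j)) (vnorm (x -v y)).
  by move=> wy; apply: cv_vnorm; apply: vcvB wy; apply: vcv_const.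
have [||||p [[Qp Hp] Hmin]] := @extreme_value k S (fun y => vnorm (x -v y)) (vnorm x + vnorm (x -v q0)).
- by exists q0; split=> //; apply: Rle_refl.
- move=> w y Sw wy; split; first by apply: Qcl wy => j; case: (Sw j).
  by apply: cv_le (cn _ _ wy) => j; case: (Sw j).
- by move=> y [_ Hy]; have := vnormDB y x; rewrite vnormBC; lra.
- by move=> w y _ _; apply: cn.
exists p; split=> // q Qq; case: (Rle_lt_dec (vnorm (x -v q)) (vnorm (x -v q0))) => [h|]; last lra.
exact: Hmin.
Qed.

(** Stands in for the limit t -> 0 at the end of first-order arguments: a positive [a] is refuted at
    t = min(1, a / (2 b)). *)
Lemma le0_of_small a b : (forall t, 0 < t <= 1 -> a <= t * b) -> a <= 0.
Proof.
move=> H; apply: Rnot_lt_le => a0; have b0 : 0 < b by have := H 1; lra.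
have [t1|t1] := Rle_lt_dec (a / (2 * b)) 1; last first.
  have := H 1; have : a / (2 * b) * (2 * b) = a by field; lra.
  nra.
have := H (a / (2 * b)); have -> : a / (2 * b) * b = a / 2 by field; lra.
have : 0 < a / (2 * b) by apply: Rdiv_lt_0_compat; lra.
lra.
Qed.

Lemma nearest_convex k (Q : vec k -> Prop) x p : vconvex Q -> Q p ->
  (forall q, Q q -> vnorm (x -v p) <= vnorm (x -v q)) ->
  forall q, Q q -> dot (x -v p) (q -v p) <= 0.
Proof.
move=> Qc Qp Hp q Qq; apply: (@le0_of_small _ (dot (q -v p) (q -v p))) => t t01.
have := Hp _ (Qc p q t (conj (Rlt_le _ _ (proj1 t01)) (proj2 t01)) Qp Qq) => H.
have {}H : dot (x -v p) (x -v p) <= dot (x -v (p +v t *v (q -v p))) (x -v (p +v t *v (q -v p))).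
  rewrite -!vnorm_sqr; have := vnorm_ge0 (x -v p); nra.
have E : x -v (p +v t *v (q -v p)) = (x -v p) -v t *v (q -v p) by vext.
move: H; rewrite E; move: (x -v p) (q -v p) => u v.
rewrite !dotE (dotC v u); have := dot_ge0 v => v0 H; have tv : 0 <= t * dot v v by nra.
nra.
Qed.

(** The cones separated below, such as images of polars under adjoints, need not be closed; duality
    gives membership in them only up to an error [e]. *)
Definition vclosure k (Q : vec k -> Prop) x :=
  forall e, 0 < e -> exists q, Q q /\ vnorm (x -v q) <= e.

Lemma vclosure_closed k (Q : vec k -> Prop) : vclosed (vclosure Q).
Proof.
move=> w x Hw wx e e0; have [N /(_ N (leqnn N)) HN] := wx (e / 2) ltac:(lra).
have [q [Qq Hq]] := Hw N (e / 2) ltac:(lra); exists q; split=> //.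
by have := vnorm_tri (w N) x q; rewrite (vnormBC x (w N)); lra.
Qed.

Lemma vclosure_convex k (Q : vec k -> Prop) : vconvex Q -> vconvex (vclosure Q).
Proof.
move=> Qc x y t t01 Hx Hy e e0; have [a [Qa Ha]] := Hx _ e0; have [b [Qb Hb]] := Hy _ e0.
exists (a +v t *v (b -v a)); split; first exact: Qc.
have -> : x +v t *v (y -v x) -v (a +v t *v (b -v a)) = (1 - t) *v (x -v a) +v t *v (y -v b) by vext.
apply: Rle_trans (vnormD _ _) _; rewrite !vnormZ_pos; try lra; nra.
Qed.

(** With p the projection of [x] onto the closure, the functional is x - p and the margin [c] is |x
    - p|^2. *)
Lemma separation k (Q : vec k -> Prop) x : (exists q, Q q) -> vconvex Q -> ~ vclosure Q x ->
  exists u c, 0 < c /\ forall q, Q q -> dot u q + c <= dot u x.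
Proof.
move=> [q0 Q0] Qc nx.
have sub q : Q q -> vclosure Q q by move=> Qq e e0; exists q; rewrite vsub_self vnorm0; split=> //; lra.
have [|p [Cp Hp]] := nearest_point x _ (@vclosure_closed _ Q); first by exists q0; apply: sub.
have H := nearest_convex (vclosure_convex Qc) Cp Hp.
exists (x -v p), (dot (x -v p) (x -v p)); split.
  apply: Rnot_le_lt => /dot_eq0/vsub_eq0 E; by rewrite E in nx.
move=> q /sub/H; rewrite !dotE; lra.
Qed.

Definition convex_cone k (K : vec k -> Prop) := K (@vzero k) /\
  (forall x y, K x -> K y -> K (x +v y)) /\ (forall t x, 0 <= t -> K x -> K (t *v x)).

Lemma ccc_cone k (K : vec k -> Prop) : closed_convex_cone K -> convex_cone K.
Proof. by case=> _. Qed.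

Lemma cone_convex k (K : vec k -> Prop) : convex_cone K -> vconvex K.
Proof.
case=> _ [KD KZ] x y t t01 Kx Ky.
have -> : x +v t *v (y -v x) = (1 - t) *v x +v t *v y by vext.
by apply: KD; apply: KZ => //; lra.
Qed.

Definition polar k (K : vec k -> Prop) (u : vec k) := forall x, K x -> dot u x <= 0.

Lemma cone_bounded_le0 k (K : vec k -> Prop) u c : convex_cone K ->
  (forall x, K x -> dot u x <= c) -> polar K u.
Proof.
move=> [_ [_ KZ]] H x Kx; apply: Rnot_lt_le => d0.
(* This multiple of [x] pairs with [u] to |c| + 1, which exceeds the bound [c]. *)
have := H _ (KZ ((Rabs c + 1) / dot u x) x _ Kx).
have -> : dot u ((Rabs c + 1) / dot u x *v x) = Rabs c + 1 by rewrite dotZr; field; lra.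
move=> H1; have := Rle_abs c; have := Rabs_pos c => c1 c2.
suff /H1 : 0 <= (Rabs c + 1) / dot u x by lra.
by apply/Rlt_le/Rdiv_lt_0_compat; lra.
Qed.

Lemma bipolar k (Q : vec k -> Prop) x : convex_cone Q ->
  (forall u, polar Q u -> dot u x <= 0) -> vclosure Q x.
Proof.
move=> Qc H; apply: NNPP => nx.
have [|u [c [c0 Hu]]] := separation _ (cone_convex Qc) nx; first by exists (@vzero k); case: Qc.
have : dot u x <= 0.
  by apply: H; apply: (@cone_bounded_le0 _ _ _ (dot u x) Qc) => q /Hu; lra.
by have := Hu _ (proj1 Qc); rewrite dot0r; lra.
Qed.

(** Along the segment from [v] to [q] the quotient in the limsup is constant, so the limsup bound
    forces <u, q - v> <= 0; the choices q = 0 and q = 2 v give <u, v> = 0. *)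
Lemma normal_cone_convex k (Q : vec k -> Prop) v u : convex_cone Q ->
  normal_cone Q v u <-> Q v /\ polar Q u /\ dot u v = 0.
Proof.
move=> Qc; split=> [[Qv H]|[Qv [pu uv]]]; last first.
  split=> // e e0; exists 1; split; first lra; move=> z Qz _.
  rewrite dotBr uv; have := pu z Qz; have := vnorm_ge0 (z -v v); nra.
have H1 q : Q q -> dot u (q -v v) <= 0.
  move=> Qq; apply: Rnot_lt_le => lt.
  have nq : 0 < vnorm (q -v v).
    apply: Rnot_le_lt => /vnorm_eq0 E; rewrite E dot0r in lt; lra.
  have [|r [r0 Hr]] := H (dot u (q -v v) / (2 * vnorm (q -v v))).
    by apply: Rdiv_lt_0_compat; lra.
  pose t := Rmin 1 (r / (2 * vnorm (q -v v))).
  have t1 : t <= 1 by apply: Rmin_l.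
  have t2 : t <= r / (2 * vnorm (q -v v)) by apply: Rmin_r.
  have t0 : 0 < t by apply: Rmin_glb_lt; [lra|apply: Rdiv_lt_0_compat; lra].
  have := Hr _ (cone_convex Qc (conj (Rlt_le _ _ t0) t1) Qv Qq).
  have -> : v +v t *v (q -v v) -v v = t *v (q -v v) by vext.
  rewrite vnormZ_pos ?dotZr; last lra.
  have : t * vnorm (q -v v) <= r / (2 * vnorm (q -v v)) * vnorm (q -v v) by nra.
  have -> : r / (2 * vnorm (q -v v)) * vnorm (q -v v) = r / 2 by field; lra.
  have -> : dot u (q -v v) / (2 * vnorm (q -v v)) * (t * vnorm (q -v v)) = t * dot u (q -v v) / 2 by field; lra.
  move=> h1 h2; have := h2 ltac:(lra); nra.
have [Q0 [QD QZ]] := Qc.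
have uv : dot u v = 0.
  have := H1 _ Q0; have := H1 _ (QZ 2 _ ltac:(lra) Qv); rewrite !dotE; lra.
by split=> //; split=> // q /H1; rewrite dotBr uv; lra.
Qed.

(** * Finitely generated cones and Farkas' lemma *)

Fixpoint fgcone k (s : seq (vec k)) (y : vec k) : Prop :=
  match s with
  | [::] => y = @vzero k
  | a :: s' => exists c, 0 <= c /\ fgcone s' (y -v c *v a)
  end.

Lemma fgcone_cone k (s : seq (vec k)) : convex_cone (fgcone s).
Proof.
elim: s => [|a s [I0 [ID IZ]]] /=.
  by split=> //; split=> [x y -> ->|t x _ ->]; vext.
split; [|split].
- by exists 0; split; [lra|]; have -> : @vzero k -v 0 *v a = @vzero k by vext.
- move=> x y [c [c0 Hc]] [d [d0 Hd]]; exists (c + d); split; first lra.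
  have -> : x +v y -v (c + d) *v a = (x -v c *v a) +v (y -v d *v a) by vext.
  by apply: ID.
- move=> t x t0 [c [c0 Hc]]; exists (t * c); split; first nra.
  have -> : t *v x -v (t * c) *v a = t *v (x -v c *v a) by vext.
  by apply: IZ.
Qed.

Lemma fgcone_map a b (L : vec a -> vec b) s y : is_linear L ->
  fgcone (map L s) y <-> exists x, fgcone s x /\ L x = y.
Proof.
move=> Ll; elim: s y => [|v s IH] y /=.
  split=> [->|[x [-> <-]]]; last exact: lin0.
  by exists (@vzero a); rewrite lin0.
split=> [[c [c0 /IH [x [Hx Ex]]]]|[x [[c [c0 Hc]] Ex]]].
  exists (x +v c *v v); split; last by rewrite linD // linZ // Ex; vext.
  by exists c; split=> //; have -> : x +v c *v v -v c *v v = x by vext.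
exists c; split=> //; apply/IH; exists (x -v c *v v); split=> //.
by rewrite linB // linZ // Ex.
Qed.

Lemma fgcone_in k (s : seq (vec k)) a : List.In a s -> fgcone s a.
Proof.
elim: s => [//|b s IH] /= [->|/IH H].
  exists 1; split; first lra; have -> : a -v 1 *v a = @vzero k by vext.
  by case: (fgcone_cone s).
by exists 0; split; [lra|have -> : a -v 0 *v b = a by vext].
Qed.

Lemma fgcone_polar k (s : seq (vec k)) x y : fgcone s y ->
  (forall a, List.In a s -> dot a x <= 0) -> dot y x <= 0.
Proof.
elim: s y => [|b s IH] y /=; first by move=> -> _; rewrite dot0l; lra.
move=> [c [c0 /IH Hc]] H; have := Hc (fun a ha => H a (or_intror ha)).
rewrite !dotE; have := H b (or_introl erefl); nra.
Qed.

Lemma infinite_subseq (P : nat -> Prop) :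
  (exists phi : nat -> nat, (forall j, (j <= phi j)%nat) /\ forall j, P (phi j)) \/
  exists N : nat, forall j, (N <= j)%nat -> ~ P j.
Proof.
case: (classic (exists N : nat, forall j, (N <= j)%nat -> ~ P j)) => [|nN]; first by right.
left; have /functional_choice [phi H] : forall j : nat, exists i : nat, (j <= i)%nat /\ P i.
  move=> j; apply: NNPP => nj; apply: nN; exists j => i ji Pi; apply: nj; by exists i.
by exists phi; split=> j; case: (H j).
Qed.

(* If the coefficients of [a] along a convergent sequence of cone points are
   unbounded, then [- a] lies in the cone of the remaining generators, so the
   cone is the preimage of its image under the projection along [a]. *)
Lemma fgcone_closed k (s : seq (vec k)) : vclosed (fgcone s).
Proof.
(* Induction on the number of generators rather than on the list, because the hypothesis is applied
   to the projected list [map P s] as well as to [s]. *)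
elim: {s}(size s) {-2}s (erefl (size s)) => [|N IH] [|a s] //= => [_|[sN]].
  move=> w x Hw wx /=; apply: vcv_unique wx _.
  by apply: vcv_ext (vcv_const _) => j; rewrite Hw.
move=> w x /functional_choice [c Hc] wx.
have s_cl := IH s sN.
have [_ [sD sZ]] := fgcone_cone s.
case: (classic (exists B, forall M : nat, exists j, (M <= j)%nat /\ c j <= B)) => [[B HB]|nB].
  have [[phi [hphi Hphi]]|[M HM]] := infinite_subseq (fun j => c j <= B); last first.
    by have [j [/HM h1 h2]] := HB M.
  have [|psi [c0 [hpsi cc]]] := @bw_real (fun j => c (phi j)) B.
    by move=> j; rewrite Rabs_pos_eq //; case: (Hc (phi j)).
  have hpp j : (j <= phi (psi j))%nat by apply: leq_trans (hpsi j) (hphi _).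
  exists c0; split; first by apply: cv_ge cc => j; case: (Hc (phi (psi j))).
  apply: (s_cl (fun j => w (phi (psi j)) -v c (phi (psi j)) *v a)) => [j|].
    by case: (Hc (phi (psi j))).
  by apply: vcvB; [apply: (vcv_sub hpp)|apply: vcvZ => //; apply: vcv_const].
have cinf B : exists M : nat, forall j, (M <= j)%nat -> B < c j.
  apply: NNPP => nM; apply: nB; exists B => M; apply: NNPP => nj; apply: nM; exists M => j Mj.
  by apply: Rnot_le_lt => cj; apply: nj; exists j.
(* As c_j tends to infinity, w_j / c_j - a stays in the closed cone of [s] and tends to - a. *)
have na : fgcone s (vopp a).
  have /functional_choice [phi Hphi] : forall j : nat, exists i : nat, (j <= i)%nat /\ INR j + 1 < c i.
    move=> j; have [M HM] := cinf (INR j + 1); exists (maxn j M).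
    by split; [apply: leq_maxl|apply: HM; apply: leq_maxr].
  have cpos j : 0 < c (phi j) by have := pos_INR j; have := proj2 (Hphi j); lra.
  have icv : Un_cv (fun j => / c (phi j)) 0.
    apply: cv_squeeze cv_inv => j; rewrite Rminus_0_r Rabs_pos_eq; last first.
      by apply/Rlt_le/Rinv_0_lt_compat.
    apply: Rinv_le_contravar; [by have := pos_INR j; lra|exact/Rlt_le/(proj2 (Hphi j))].
  apply: (s_cl (fun j => / c (phi j) *v (w (phi j) -v c (phi j) *v a))).
    by move=> j; apply: sZ; [apply/Rlt_le/Rinv_0_lt_compat|case: (Hc (phi j))].
  have -> : vopp a = 0 *v x -v a by vext.
  apply: (@vcv_ext _ (fun j => / c (phi j) *v w (phi j) -v a)).
    by move=> j; vext; field; have := cpos j; lra.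
  apply: vcvB; last exact: vcv_const.
  by apply: vcvZ => //; apply: vcv_sub wx => j; case: (Hphi j).
(* The orthogonal projection along [a]. If a = 0 the quotient multiplies the zero vector, and [P] is
   the identity whatever the value of the division by 0. *)
pose P y := y -v (dot a y / dot a a) *v a.
have Pl : is_linear P.
  by split=> *; rewrite /P !dotE; vext; rewrite /Rdiv; ring.
have Pa : P a = @vzero k.
  case: (Rle_lt_dec (dot a a) 0) => [/dot_eq0 a0|a0].
    by rewrite /P {1 6}a0; vext.
  by rewrite /P; vext; field; lra.
have HP y : fgcone (a :: s) y <-> fgcone (map P s) (P y).
  rewrite (fgcone_map _ _ Pl) /=; split=> [[t [t0 Ht]]|[z [Hz Ez]]].
    exists (y -v t *v a); split=> //; rewrite linB // linZ // Pa; vext.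
  have Ey : y = z +v (dot a y / dot a a - dot a z / dot a a) *v a.
    have E i := f_equal (fun v => v i) Ez; apply: functional_extensionality => i.
    by have := E i; rewrite /P /vadd /vsub /vscale; lra.
  move: Ey; set t := _ - _ => ->; case: (Rle_lt_dec 0 t) => t0.
    by exists t; split=> //; have -> : z +v t *v a -v t *v a = z by vext.
  exists 0; split; first lra.
  have -> : z +v t *v a -v 0 *v a = z +v (- t) *v vopp a by vext.
  by apply: sD => //; apply: sZ => //; lra.
apply/HP; apply: (IH (map P s) _ (fun j => P (w j))); rewrite ?size_map //.
  by move=> j; apply/HP; exists (c j); apply: Hc.
exact: vcv_lin.
Qed.

Lemma farkas k (s : seq (vec k)) y :
  (forall x, (forall a, List.In a s -> dot a x <= 0) -> dot y x <= 0) -> fgcone s y.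
Proof.
move=> H; apply: NNPP => ny.
have [e [e0 He]] := closed_dist (@fgcone_closed _ s) ny.
suff /(_ (e / 2) ltac:(lra)) [q [/He]] : vclosure (fgcone s) y by lra.
apply: bipolar (fgcone_cone s) _ => u Hu; rewrite dotC; apply: H => a /fgcone_in/Hu.
by rewrite dotC.
Qed.

(** * Twice differentiable maps *)

Definition rem a b (f : vec a -> vec b) (L : vec a -> vec b) (x hv : vec a) : vec b :=
  f (x +v hv) -v f x -v L hv.

(** Lets a differentiability proof end with a sum of error terms, each a constant times [e]; the
    restriction e <= 1 serves to absorb higher powers of [e]. *)
Lemma has_derivI a b (f : vec a -> vec b) L x : is_linear L ->
  (exists C, forall e, 0 < e <= 1 -> exists d, 0 < d /\
    forall hv, vnorm hv < d -> vnorm (rem f L x hv) <= C * e * vnorm hv) -> has_deriv f L x.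
Proof.
move=> Ll [C H]; split=> // e e0.
have C1 : 0 < Rabs C + 1 by have := Rabs_pos C; lra.
have [e' Ee] : exists e', e = (Rabs C + 1) * e' by exists (e / (Rabs C + 1)); field; lra.
have e'0 : 0 < e' by nra.
have [q [q01 qe]] : exists q, 0 < q <= 1 /\ q <= e'.
  by exists (Rmin 1 e'); do !split; [apply: Rmin_glb_lt; lra|apply: Rmin_l|apply: Rmin_r].
have [d [d0 Hd]] := H q q01.
exists d; split=> // hv /Hd h1; apply: (Rle_trans _ _ _ h1); apply: Rmult_le_compat_r; first exact: vnorm_ge0.
by have := Rle_abs C; nra.
Qed.

Lemma deriv_lip a b (f : vec a -> vec b) L x : has_deriv f L x ->
  exists M d, 0 <= M /\ 0 < d /\ forall hv, vnorm hv < d ->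
    vnorm (f (x +v hv) -v f x) <= M * vnorm hv.
Proof.
move=> [Ll H]; have [M [M0 HM]] := lin_bounded Ll; have [d [d0 Hd]] := H 1 Rlt_0_1.
exists (M + 1), d; do !split=> //; first lra; move=> hv /Hd h1.
by have := vnormDB (f (x +v hv) -v f x) (L hv); have := HM hv; lra.
Qed.

Lemma deriv_comp a b c (f : vec a -> vec b) (g : vec b -> vec c) L M x :
  has_deriv f L x -> has_deriv g M (f x) -> has_deriv (fun z => g (f z)) (fun v => M (L v)) x.
Proof.
move=> df dg; have [Cf [d1 [Cf0 [d10 Hf]]]] := deriv_lip df.
case: df => Ll df; case: dg => Ml dg.
have [CM [CM0 HM]] := lin_bounded Ml.
apply: has_derivI; first exact: lin_comp Ll Ml.
exists (Cf + CM) => e [e0 e1].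
have [d2 [d20 H2]] := df e e0; have [d3 [d30 H3]] := dg e e0.
have d4 : 0 < d3 / (Cf + 1) by apply: Rdiv_lt_0_compat; lra.
exists (Rmin d1 (Rmin d2 (d3 / (Cf + 1)))); split; first by do !apply: Rmin_glb_lt.
move=> hv /Rmin_Rgt_l [h1 /Rmin_Rgt_l [h2 h3]].
have k1 := Hf _ h1; set k := f (x +v hv) -v f x in k1.
have nh := vnorm_ge0 hv.
have k3 : vnorm k < d3.
  apply: Rle_lt_trans k1 _; have : (Cf + 1) * (d3 / (Cf + 1)) = d3 by field; lra.
  nra.
have -> : rem (fun z => g (f z)) (fun v => M (L v)) x hv = rem g M (f x) k +v M (rem f L x hv).
  have -> : M (rem f L x hv) = M k -v M (L hv) by rewrite -(linB Ml).
  rewrite /rem; have -> : f x +v k = f (x +v hv) by rewrite /k; vext.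
  by vext.
apply: Rle_trans (vnormD _ _) _.
have := H3 _ k3; have := HM (rem f L x hv); have := H2 _ h2; rewrite -/(rem f L x hv) -/(rem g M (f x) k).
move=> a1 a2 a3; have : e * vnorm k <= e * (Cf * vnorm hv) by nra.
have : CM * vnorm (rem f L x hv) <= CM * (e * vnorm hv) by nra.
nra.
Qed.

Lemma deriv_seq a b (f : vec a -> vec b) L x (t : nat -> R) v v0 : has_deriv f L x ->
  (forall j, 0 < t j) -> Un_cv t 0 -> vseq_cv v v0 ->
  vseq_cv (fun j => / t j *v (f (x +v t j *v v j) -v f x)) (L v0).
Proof.
move=> [Ll H] tp t0 vv0; have [B HB] := vcv_bounded vv0.
have B0 : 0 <= B by have := HB 0%N; have := vnorm_ge0 (v 0%N); lra.
have Hl := vcv_lin Ll vv0.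
have -> : L v0 = @vzero b +v L v0 by vext.
apply: (@vcv_ext _ (fun j => / t j *v rem f L x (t j *v v j) +v L (v j))) => [j|].
  by rewrite /rem (linZ Ll); vext; field; have := tp j; lra.
apply: vcvD => // e e0.
have e1 : 0 < e / (2 * (B + 1)) by apply: Rdiv_lt_0_compat; lra.
have [d [d0 Hd]] := H _ e1.
have dB : 0 < d / (B + 1) by apply: Rdiv_lt_0_compat; lra.
have [N HN] := proj1 (cvP _ _) t0 _ dB.
exists N => j /HN; rewrite Rminus_0_r Rabs_pos_eq => [tj|]; last exact/Rlt_le.
have tpj := tp j; have nv := vnorm_ge0 (v j); have HBj := HB j.
have small : vnorm (t j *v v j) < d.
  rewrite vnormZ_pos; last lra.
  have : (B + 1) * (d / (B + 1)) = d by field; lra.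
  nra.
have := Hd _ small; rewrite -/(rem f L x (t j *v v j)) vnormZ_pos ?[vnorm (t j *v _)]vnormZ_pos; try lra.
have -> : / t j *v rem f L x (t j *v v j) -v @vzero b = / t j *v rem f L x (t j *v v j) by vext.
have it : 0 < / t j by apply: Rinv_0_lt_compat.
rewrite vnormZ_pos; last lra.
move=> h1; have : / t j * vnorm (rem f L x (t j *v v j)) <= e / (2 * (B + 1)) * vnorm (v j).
  have -> : e / (2 * (B + 1)) * vnorm (v j) = / t j * (e / (2 * (B + 1)) * (t j * vnorm (v j))) by field; lra.
  by apply: Rmult_le_compat_l; lra.
have : e / (2 * (B + 1)) * (B + 1) = e / 2 by field; lra.
nra.
Qed.

Lemma deriv_pt_dot a b (f : vec a -> vec b) L x hv e s : has_deriv f L (x +v s *v hv) ->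
  derivable_pt_lim (fun s => dot e (f (x +v s *v hv))) s (dot e (L hv)).
Proof.
move=> [Ll H] eps eps0; have nh := vnorm_ge0 hv; have ne := vnorm_ge0 e.
have c0 : 0 < eps / (2 * (vnorm hv + 1) * (vnorm e + 1)) by apply: Rdiv_lt_0_compat => //; nra.
have [d [d0 Hd]] := H _ c0.
have d1 : 0 < d / (vnorm hv + 1) by apply: Rdiv_lt_0_compat; lra.
exists (mkposreal _ d1) => r r0 /= rd.
have rp := Rabs_pos_lt _ r0.
have small : vnorm (r *v hv) < d.
  rewrite vnormZ; have : (vnorm hv + 1) * (d / (vnorm hv + 1)) = d by field; lra.
  nra.
have := Hd _ small; set R0 := _ -v _ => h1.
have E : (dot e (f (x +v (s + r) *v hv)) - dot e (f (x +v s *v hv))) / r - dot e (L hv) = dot e R0 / r.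
  rewrite /R0 (linZ Ll) !dotE.
  have -> : x +v s *v hv +v r *v hv = x +v (s + r) *v hv by vext.
  by field.
rewrite E /Rdiv Rabs_mult Rabs_inv; move: h1; rewrite vnormZ => h1.
have h2 := cauchy_schwarz_abs e R0.
have nR := vnorm_ge0 R0.
have h3 : vnorm e * vnorm R0 <= vnorm e * (eps / (2 * (vnorm hv + 1) * (vnorm e + 1)) * (Rabs r * vnorm hv)) by nra.
have h4 : vnorm e * (eps / (2 * (vnorm hv + 1) * (vnorm e + 1)) * (Rabs r * vnorm hv)) = (Rabs r * (eps / 2)) * (vnorm e / (vnorm e + 1)) * (vnorm hv / (vnorm hv + 1)) by field; lra.
have q x0 : 0 <= x0 -> 0 <= x0 / (x0 + 1) <= 1.
  move=> x00; have i0 : 0 < / (x0 + 1) by apply: Rinv_0_lt_compat; lra.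
  have : (x0 + 1) * / (x0 + 1) = 1 by field; lra.
  rewrite /Rdiv; nra.
have := q _ ne; have := q _ nh; move: h4; set u := vnorm e / _; set w := vnorm hv / _ => h4 q1 q2.
have uw : 0 <= u * w <= 1 by nra.
have re : 0 < Rabs r * (eps / 2) by apply: Rmult_lt_0_compat; lra.
have : Rabs (dot e R0) <= Rabs r * (eps / 2) by nra.
move=> h5; apply: (Rle_lt_trans _ (eps / 2)); last lra.
by apply: (Rmult_le_reg_r (Rabs r)) => //; rewrite /Rdiv Rmult_assoc Rinv_l; lra.
Qed.

(** Pairing with the error vector e itself reduces the claim to the scalar mean value theorem: |e|^2
    = <e, D s hv - w - s q> <= |e| c for some s. The term s^2 q / 2 makes the estimate sharp to
    second order. *)
Lemma mean_value2 a b (f : vec a -> vec b) (D : R -> vec a -> vec b) x hv w q c :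
  (forall s, 0 <= s <= 1 -> has_deriv f (D s) (x +v s *v hv)) ->
  (forall s, 0 <= s <= 1 -> vnorm (D s hv -v w -v s *v q) <= c) ->
  vnorm (f (x +v hv) -v f x -v w -v (1 / 2) *v q) <= c.
Proof.
move=> dD Hc; set e := _ -v (1 / 2) *v q.
pose F s := dot e (f (x +v s *v hv)) - (s * dot e w + s * s * (/ 2 * dot e q)).
have dF s : 0 <= s <= 1 -> derivable_pt_lim F s (dot e (D s hv -v w -v s *v q)).
  move=> s01; have -> : dot e (D s hv -v w -v s *v q) =
      dot e (D s hv) - ((1 * dot e w + s * 0) + ((1 * s + s * 1) * (/ 2 * dot e q) + s * s * 0)).
    by rewrite !dotE; field.
  apply: derivable_pt_lim_minus; first exact: deriv_pt_dot (dD s s01).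
  have di := derivable_pt_lim_id s.
  apply: derivable_pt_lim_plus.
    exact: (derivable_pt_lim_mult id (fct_cte (dot e w)) _ _ _ di (derivable_pt_lim_const _ _)).
  apply: (derivable_pt_lim_mult (mult_fct id id) (fct_cte (/ 2 * dot e q))).
    exact: derivable_pt_lim_mult.
  exact: derivable_pt_lim_const.
have [s [E s01]] := MVT_cor2 F (fun s => dot e (D s hv -v w -v s *v q)) _ _ Rlt_0_1 dF.
have {}s01 : 0 <= s <= 1 by lra.
have := cauchy_schwarz e (D s hv -v w -v s *v q); have := Hc s s01.
have E2 : F 1 - F 0 = dot e e.
  have -> : dot e e = dot e (f (x +v hv) -v f x -v w -v (1 / 2) *v q) by [].
  rewrite /F; have -> : x +v 1 *v hv = x +v hv by vext.
  have -> : x +v 0 *v hv = x by vext.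
  by rewrite !(dotBr, dotZr); field.
rewrite E2 -vnorm_sqr in E; have := vnorm_ge0 e; have := vnorm_ge0 (D s hv -v w -v s *v q).
move: (dot _ _) (vnorm _) (vnorm _) E => A B B' E B0 B'0 Bc AB.
apply: Rnot_lt_le => lt; nra.
Qed.

Lemma mean_value a b (f : vec a -> vec b) (D : R -> vec a -> vec b) x hv w c :
  (forall s, 0 <= s <= 1 -> has_deriv f (D s) (x +v s *v hv)) ->
  (forall s, 0 <= s <= 1 -> vnorm (D s hv -v w) <= c) ->
  vnorm (f (x +v hv) -v f x -v w) <= c.
Proof.
move=> dD Hc; have -> : f (x +v hv) -v f x -v w = f (x +v hv) -v f x -v w -v (1 / 2) *v @vzero b by vext.
apply: (mean_value2 dD) => s s01.
have -> : D s hv -v w -v s *v @vzero b = D s hv -v w by vext.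
by exact: Hc.
Qed.

(* [D2 v] is the derivative at [z] of [w |-> Df w v]. *)
Definition twice_diff a b (f : vec a -> vec b) (Df : vec a -> vec a -> vec b)
    (D2 : vec a -> vec a -> vec b) (z : vec a) :=
  (exists r, 0 < r /\ forall w, vnorm (w -v z) < r -> has_deriv f (Df w) w) /\
  forall v, has_deriv (fun w => Df w v) (D2 v) z.

Lemma C2_twice_diff a b (f : vec a -> vec b) Df D2f z r : 0 < r ->
  C2_on_ball f Df D2f z r -> twice_diff f Df (D2f z) z.
Proof.
move=> r0 H; split; first by exists r; split=> // w /H [].
by move=> v; have [|_ [Hv _]] := H z; [rewrite vsub_self vnorm0|apply: Hv].
Qed.

Section TwiceDiff.
Variables (a b : nat) (f : vec a -> vec b) (Df : vec a -> vec a -> vec b).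
Variables (D2 : vec a -> vec a -> vec b) (z : vec a).
Hypothesis f2 : twice_diff f Df D2 z.

Lemma td_lin : is_linear (Df z).
Proof. by have [[r [r0 H]] _] := f2; have := H z; rewrite vsub_self vnorm0 => /(_ r0) []. Qed.

Lemma td_lin2 v : is_linear (D2 v).
Proof. by case: f2 => _ /(_ v) []. Qed.

(** Linearity of [D2] in its first argument is not part of [twice_diff], where each [v] has its own
    derivative. It passes to the limit from the linear maps [Df (z + t hv)]; the constant [c] keeps
    these points in the ball where f is differentiable. *)
Lemma td_basis v hv : D2 v hv = vsum (fun j => v j *v D2 (ebasis j) hv).
Proof.
have [[r [r0 Hr]] Hd] := f2.
pose c := r / (vnorm hv + 1); have nh := vnorm_ge0 hv.
have c0 : 0 < c by apply: Rdiv_lt_0_compat; lra.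
pose t j := c * / (INR j + 1).
have tp j : 0 < t j by apply: Rmult_lt_0_compat => //; apply: inv_pos.
have tcv : Un_cv t 0 by rewrite -(Rmult_0_r c); apply: CV_mult cv_inv; apply: cv_const.
have lin j : is_linear (Df (z +v t j *v hv)).
  have [|//] := Hr (z +v t j *v hv).
  have -> : z +v t j *v hv -v z = t j *v hv by vext.
  rewrite vnormZ_pos; last exact/Rlt_le.
  have i1 : / (INR j + 1) <= 1.
    by rewrite -[X in _ <= X]Rinv_1; apply: Rinv_le_contravar; have := pos_INR j; lra.
  have : (vnorm hv + 1) * c = r by rewrite /c; field; lra.
  have := inv_pos j; rewrite /t; nra.
apply: vcv_unique (deriv_seq (Hd v) tp tcv (vcv_const hv)) _.
apply/vcv_coord => i; rewrite /vsum /vscale.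
pose F j q := v q * (/ t j * (Df (z +v t j *v hv) (ebasis q) i - Df z (ebasis q) i)).
apply: (@cv_ext (fun j => \big[Rplus/0]_(q < a) F j q)) => [j|].
  rewrite (lin_basis (lin j)) (lin_basis td_lin) /vsub /vsum /vscale.
  rewrite sumRB sumRZ; apply: eq_bigr => q _; rewrite /F /vscale; ring.
apply: (cv_sum (F := F) (G := fun q => v q * D2 (ebasis q) hv i)) => q.
apply: CV_mult; first exact: cv_const.
by have /vcv_coord := deriv_seq (Hd (ebasis q)) tp tcv (vcv_const hv); apply.
Qed.

Lemma td_add v v' hv : D2 (v +v v') hv = D2 v hv +v D2 v' hv.
Proof.
rewrite (td_basis (v +v v')) (td_basis v) (td_basis v'); apply: functional_extensionality => i.
by rewrite /vsum /vadd /vscale -big_split; apply: eq_bigr => j _ /=; ring.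
Qed.

Lemma td_bounded : exists M, 0 <= M /\ forall v hv, vnorm (D2 v hv) <= M * vnorm v * vnorm hv.
Proof.
have /functional_choice [M HM] := fun j : 'I_a => lin_bounded (td_lin2 (ebasis j)).
have M0 : 0 <= \big[Rplus/0]_(j < a) M j by apply: sumR_ge0 => j; case: (HM j).
exists (\big[Rplus/0]_(j < a) M j); split=> // v hv.
rewrite td_basis; apply: Rle_trans (vnorm_vsum _) _.
rewrite Rmult_assoc Rmult_comm sumRZ; apply: sumR_le => j; rewrite vnormZ.
have [Mj0 /(_ hv) Hj] := HM j; have := coord_le_vnorm v j; have := Rabs_pos (v j).
have := vnorm_ge0 hv; have := vnorm_ge0 v; have := vnorm_ge0 (D2 (ebasis j) hv) => p1 p2 p3 p4 p5.
apply: (Rle_trans _ (vnorm v * (M j * vnorm hv))); last by apply: Req_le; ring.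
by apply: Rmult_le_compat.
Qed.

(** Uniformity in [v] comes from the finitely many basis directions, each allotted the share e / (a
    + 1); the 1 covers dimension 0. *)
Lemma td_unif e : 0 < e -> exists d, 0 < d /\ forall hv, vnorm hv < d ->
  has_deriv f (Df (z +v hv)) (z +v hv) /\
  forall v, vnorm (Df (z +v hv) v -v Df z v -v D2 v hv) <= e * vnorm hv * vnorm v.
Proof.
move=> e0; have [[r [r0 Hr]] Hd] := f2.
have ea : 0 < e / (INR a + 1) by apply: Rdiv_lt_0_compat => //; have := pos_INR a; lra.
have /functional_choice [d Hdd] := fun j : 'I_a => proj2 (Hd (ebasis j)) _ ea.
have [d0 [d00 Hd0]] : exists d0, 0 < d0 /\ forall j, d0 <= d j.
  suff [d0 [d00 Hd0]] : exists d0, 0 < d0 /\ forall j, j \in index_enum 'I_a -> d0 <= d j.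
    by exists d0; split=> // j; apply: Hd0; rewrite mem_index_enum.
  elim: (index_enum _) => [|j s [c [c0 Hc]]]; first by exists 1; split; [lra|].
  exists (Rmin c (d j)); split; first by apply: Rmin_glb_lt => //; case: (Hdd j).
  move=> i; rewrite inE => /orP [/eqP ->|/Hc h]; first exact: Rmin_r.
  exact: Rle_trans (Rmin_l _ _) h.
exists (Rmin r d0); split; first exact: Rmin_glb_lt.
move=> hv /Rmin_Rgt_l [h1 h2].
have dz : has_deriv f (Df (z +v hv)) (z +v hv).
  by apply: Hr; have -> : z +v hv -v z = hv by vext.
split=> // v; have [Dl _] := dz.
have -> : Df (z +v hv) v -v Df z v -v D2 v hv =
    vsum (fun j => v j *v (Df (z +v hv) (ebasis j) -v Df z (ebasis j) -v D2 (ebasis j) hv)).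
  rewrite (lin_basis Dl v) (lin_basis td_lin v) td_basis; apply: functional_extensionality => i.
  by rewrite /vsub /vsum !sumRB; apply: eq_bigr => j _; rewrite /vscale; ring.
apply: Rle_trans (vnorm_vsum _) _.
have E : e * vnorm hv * vnorm v = INR a * (e / (INR a + 1) * vnorm hv * vnorm v) + e / (INR a + 1) * vnorm hv * vnorm v.
  by field; have := pos_INR a; lra.
have nv := vnorm_ge0 v; have nh := vnorm_ge0 hv.
apply: (Rle_trans _ (INR a * (e / (INR a + 1) * vnorm hv * vnorm v))); last first.
  rewrite E; have q0 : 0 <= e / (INR a + 1) * vnorm hv by nra.
  have := Rmult_le_pos _ _ q0 nv; lra.
rewrite -sumR_const; apply: sumR_le => j; rewrite vnormZ Rmult_comm.
apply: Rmult_le_compat; [exact: vnorm_ge0|exact: Rabs_pos| |exact: coord_le_vnorm].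
have [_ Hj] := Hdd j; apply: Hj; have := Hd0 j; lra.
Qed.

Lemma td_cont e : 0 < e -> exists d, 0 < d /\ forall hv, vnorm hv < d ->
  forall v, vnorm (Df (z +v hv) v -v Df z v) <= e * vnorm v.
Proof.
move=> e0; have [d [d0 Hd]] := td_unif Rlt_0_1; have [M [M0 HM]] := td_bounded.
have q0 : 0 < e / (M + 1) by apply: Rdiv_lt_0_compat; lra.
exists (Rmin d (e / (M + 1))); split; first exact: Rmin_glb_lt.
move=> hv /Rmin_Rgt_l [h1 h2] v; have [_ /(_ v) H1] := Hd _ h1; have H2 := HM v hv.
have := vnormDB (Df (z +v hv) v -v Df z v) (D2 v hv).
have E : (M + 1) * (e / (M + 1)) = e by field; lra.
have nv := vnorm_ge0 v; have nh := vnorm_ge0 hv.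
have : (M + 1) * vnorm hv <= e by nra.
nra.
Qed.

Lemma td_near : exists M r, 0 <= M /\ 0 < r /\ forall hv, vnorm hv < r ->
  has_deriv f (Df (z +v hv)) (z +v hv) /\ forall v, vnorm (Df (z +v hv) v) <= M * vnorm v.
Proof.
have [d1 [d10 H1]] := td_unif Rlt_0_1; have [d2 [d20 H2]] := td_cont Rlt_0_1.
have [M [M0 HM]] := lin_bounded td_lin.
exists (M + 1), (Rmin d1 d2); split; [lra|split; first exact: Rmin_glb_lt].
move=> hv /Rmin_Rgt_l [h1 h2]; split; first by case: (H1 _ h1).
move=> v; have := H2 _ h2 v; have := HM v; have := vnormDB (Df (z +v hv) v) (Df z v); lra.
Qed.

Lemma td_lipschitz : exists M r, 0 <= M /\ 0 < r /\ forall w w',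
  vnorm (w -v z) < r -> vnorm (w' -v z) < r -> vnorm (f w -v f w') <= M * vnorm (w -v w').
Proof.
have [M [r [M0 [r0 H]]]] := td_near; exists M, r; do 2!split=> //; move=> w w' hw hw'.
have in_ball s : 0 <= s <= 1 -> vnorm (w' +v s *v (w -v w') -v z) < r.
  move=> s01; have -> : w' +v s *v (w -v w') -v z = (1 - s) *v (w' -v z) +v s *v (w -v z) by vext.
  apply: Rle_lt_trans (vnormD _ _) _; rewrite !vnormZ_pos; try lra.
  have q1 := Rmax_l (vnorm (w' -v z)) (vnorm (w -v z)); have q2 := Rmax_r (vnorm (w' -v z)) (vnorm (w -v z)).
  apply: Rle_lt_trans (Rmax_lub_lt _ _ _ hw' hw); nra.
have zE u : z +v (u -v z) = u by vext.
have := @mean_value _ _ f (fun s => Df (w' +v s *v (w -v w'))) w' (w -v w') (@vzero b) (M * vnorm (w -v w')).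
have -> : w' +v (w -v w') = w by vext.
have -> : f w -v f w' -v @vzero b = f w -v f w' by vext.
apply=> s /in_ball/H []; rewrite zE // => _ Hs.
have -> : Df (w' +v s *v (w -v w')) (w -v w') -v @vzero b = Df (w' +v s *v (w -v w')) (w -v w') by vext.
exact: Hs.
Qed.

(** [mean_value2] with w = Df z hv and q = D2 hv hv; [td_unif] bounds the error uniformly in s. *)
Lemma td_taylor e : 0 < e -> exists d, 0 < d /\ forall hv, vnorm hv < d ->
  vnorm (f (z +v hv) -v f z -v Df z hv -v (1 / 2) *v D2 hv hv) <= e * (vnorm hv * vnorm hv).
Proof.
move=> e0; have [d [d0 Hd]] := td_unif e0; exists d; split=> // hv hd.
have nh := vnorm_ge0 hv.
have small s : 0 <= s <= 1 -> vnorm (s *v hv) <= vnorm hv.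
  by move=> s01; rewrite vnormZ_pos; [nra|lra].
apply: (mean_value2 (D := fun s => Df (z +v s *v hv))) => s s01.
  by case: (Hd (s *v hv)) => //; have := small s s01; lra.
have [|_ /(_ hv)] := Hd (s *v hv); first by have := small s s01; lra.
rewrite (linZ (td_lin2 hv)) => h1; apply: Rle_trans h1 _.
rewrite Rmult_assoc; apply: Rmult_le_compat_l; first lra.
by apply: Rmult_le_compat_r => //; apply: small.
Qed.

(* Both orders compute the second difference of [f] along [t v] and [t w] up to o(t^2). *)
Lemma td_sym v w : D2 v w = D2 w v.
Proof.
have nv := vnorm_ge0 v; have nw := vnorm_ge0 w.
pose F t v w := f (z +v t *v v +v t *v w) -v f (z +v t *v v) -v f (z +v t *v w) +v f z.
have key : forall v w, forall e, 0 < e -> exists d, 0 < d /\ forall t, 0 < t < d ->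
    vnorm (F t v w -v t * t *v D2 v w) <= e * (vnorm v * (2 * vnorm v + vnorm w)) * (t * t).
  move=> {nv nw v w} v w e e0; have [d [d0 Hd]] := td_unif e0.
  have nv := vnorm_ge0 v; have nw := vnorm_ge0 w.
  exists (d / (vnorm v + vnorm w + 1)); split; first by apply: Rdiv_lt_0_compat; lra.
  move=> t [t0 td].
  have td' : t * (vnorm v + vnorm w + 1) < d.
    have : d / (vnorm v + vnorm w + 1) * (vnorm v + vnorm w + 1) = d by field; lra.
    nra.
  have n1 s : 0 <= s <= 1 -> vnorm (s *v (t *v v)) <= t * vnorm v.
    move=> s01; rewrite !vnormZ_pos; try lra; have tv : 0 <= t * vnorm v by nra.
    nra.
  have n2 s : 0 <= s <= 1 -> vnorm (s *v (t *v v) +v t *v w) <= t * vnorm v + t * vnorm w.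
    move=> s01; apply: Rle_trans (vnormD _ _) _; have := n1 s s01.
    by rewrite [vnorm (t *v w)]vnormZ_pos; lra.
  have m1 s : 0 <= s <= 1 -> vnorm (s *v (t *v v)) < d by move=> /n1; nra.
  have m2 s : 0 <= s <= 1 -> vnorm (s *v (t *v v) +v t *v w) < d by move=> /n2; nra.
  (* The first difference in direction t w; [F] is its increment along t v, so the mean value
     estimate compares it with the increment of [Df] applied to t v. *)
  pose P x := f (x +v t *v w) -v f x.
  pose DP s u := Df (z +v (s *v (t *v v) +v t *v w)) u -v Df (z +v s *v (t *v v)) u.
  have := @mean_value _ _ P DP z (t *v v) (t * t *v D2 v w) (e * (vnorm v * (2 * vnorm v + vnorm w)) * (t * t)).
  have -> : P (z +v t *v v) -v P z -v t * t *v D2 v w = F t v w -v t * t *v D2 v w by rewrite /P /F; vext.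
  apply=> s s01.
    have [[l1 H1] _] := Hd _ (m1 s s01); have [[l2 H2] _] := Hd _ (m2 s s01).
    split.
      by split=> *; rewrite /DP ?(linD l1) ?(linD l2) ?(linZ l1) ?(linZ l2); vext.
    move=> e' e'0; have [d1 [d10 H1']] := H1 (e' / 2) ltac:(lra).
    have [d2 [d20 H2']] := H2 (e' / 2) ltac:(lra).
    exists (Rmin d1 d2); split; first exact: Rmin_glb_lt.
    move=> k /Rmin_Rgt_l [/H1' k1 /H2' k2]; rewrite /P /DP.
    have -> : f (z +v s *v (t *v v) +v k +v t *v w) -v f (z +v s *v (t *v v) +v k) -v
       (f (z +v s *v (t *v v) +v t *v w) -v f (z +v s *v (t *v v))) -v
       (Df (z +v (s *v (t *v v) +v t *v w)) k -v Df (z +v s *v (t *v v)) k) =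
       rem f (Df (z +v (s *v (t *v v) +v t *v w))) (z +v (s *v (t *v v) +v t *v w)) k -v
       rem f (Df (z +v s *v (t *v v))) (z +v s *v (t *v v)) k.
      rewrite /rem.
      have -> : z +v s *v (t *v v) +v k +v t *v w = z +v (s *v (t *v v) +v t *v w) +v k by vext.
      have -> : z +v s *v (t *v v) +v t *v w = z +v (s *v (t *v v) +v t *v w) by vext.
      by vext.
    apply: Rle_trans (vnormB _ _) _; rewrite /rem; lra.
  have [l1 H1] := Hd _ (m1 s s01); have [l2 H2] := Hd _ (m2 s s01).
  have {}H1 := H1 v; have {}H2 := H2 v.
  have -> : DP s (t *v v) -v t * t *v D2 v w =
     t *v ((Df (z +v (s *v (t *v v) +v t *v w)) v -v Df z v -v D2 v (s *v (t *v v) +v t *v w)) -v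
           (Df (z +v s *v (t *v v)) v -v Df z v -v D2 v (s *v (t *v v)))).
    rewrite /DP (linZ (proj1 l1)) (linZ (proj1 l2)) (linD (td_lin2 v)) (linZ (td_lin2 v) t w).
    by vext.
  rewrite vnormZ_pos; last lra.
  apply: (Rle_trans _ (t * (e * (t * vnorm v + t * vnorm w) * vnorm v + e * (t * vnorm v) * vnorm v))); last by apply: Req_le; ring.
  apply: Rmult_le_compat_l; first lra.
  apply: Rle_trans (vnormB _ _) _; apply: Rplus_le_compat.
    apply: Rle_trans H2 _; apply: Rmult_le_compat_r => //; apply: Rmult_le_compat_l; [lra|exact: n2].
  apply: Rle_trans H1 _; apply: Rmult_le_compat_r => //; apply: Rmult_le_compat_l; [lra|exact: n1].
apply: vsub_eq0; apply: vnorm_eq0; apply: Rnot_lt_le => pos.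
set X := vnorm v * (2 * vnorm v + vnorm w) + vnorm w * (2 * vnorm w + vnorm v).
have X0 : 0 <= X by rewrite /X; nra.
have e0 : 0 < vnorm (D2 v w -v D2 w v) / (2 * (X + 1)) by apply: Rdiv_lt_0_compat; lra.
have [d1 [d10 H1]] := key v w _ e0; have [d2 [d20 H2]] := key w v _ e0.
have [t [[t0 t1] t2]] : exists t, 0 < t < d1 /\ t < d2.
  exists (Rmin d1 d2 / 2); have := Rmin_l d1 d2; have := Rmin_r d1 d2.
  have := Rmin_glb_lt _ _ _ d10 d20; lra.
have {}H1 := H1 t (conj t0 t1); have {}H2 := H2 t (conj t0 t2).
have FE : F t w v = F t v w.
  rewrite /F; have -> : z +v t *v w +v t *v v = z +v t *v v +v t *v w by vext.
  by vext.
have t20 : 0 < t * t by nra.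
have E : t * t *v (D2 v w -v D2 w v) = (F t w v -v t * t *v D2 w v) -v (F t v w -v t * t *v D2 v w).
  by rewrite FE; vext.
have := vnormB (F t w v -v t * t *v D2 w v) (F t v w -v t * t *v D2 v w).
rewrite -E vnormZ_pos; last lra.
move: H1 H2; set N := vnorm (D2 v w -v D2 w v) in e0 pos *.
set q := N / _ in e0 * => H1 H2 H3.
have Eq : N = 2 * (X + 1) * q by rewrite /q; field; lra.
have : t * t * N <= q * X * (t * t) by rewrite /X; lra.
rewrite {1}Eq; nra.
Qed.
End TwiceDiff.

Lemma td_comp a b c (g : vec a -> vec b) Dg D2g (h : vec b -> vec c) Dh D2h z :
  twice_diff g Dg D2g z -> twice_diff h Dh D2h (g z) ->
  twice_diff (fun w => h (g w)) (fun w v => Dh (g w) (Dg w v))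
    (fun v hv => Dh (g z) (D2g v hv) +v D2h (Dg z v) (Dg z hv)) z.
Proof.
move=> g2 h2.
have [Lg [rg [Lg0 [rg0 Hg]]]] := td_lipschitz g2.
have glin := td_lin g2; have hlin := td_lin h2.
split.
  have [[r1 [r10 H1]] _] := g2; have [[r2 [r20 H2]] _] := h2.
  have r3 : 0 < r2 / (Lg + 1) by apply: Rdiv_lt_0_compat; lra.
  exists (Rmin r1 (Rmin rg (r2 / (Lg + 1)))); split; first by do !apply: Rmin_glb_lt.
  move=> w /Rmin_Rgt_l [w1 /Rmin_Rgt_l [w2 w3]].
  apply: deriv_comp; first exact: H1.
  apply: H2; apply: Rle_lt_trans (Hg w z w2 _) _; first by rewrite vsub_self vnorm0.
  have : (Lg + 1) * (r2 / (Lg + 1)) = r2 by field; lra.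
  have := vnorm_ge0 (w -v z); nra.
move=> v; have [M [M0 HM]] := lin_bounded hlin.
have [N [N0 HN]] := td_bounded h2.
have dgv := proj2 g2 v; have [Cv [dv [Cv0 [dv0 Hv]]]] := deriv_lip dgv.
have dg : has_deriv g (Dg z) z by case: g2 => [[r [r0 H]] _]; apply: H; rewrite vsub_self vnorm0.
apply: has_derivI.
  split=> *; rewrite ?(linD glin) ?(linZ glin) ?(linD (td_lin2 g2 v)) ?(linZ (td_lin2 g2 v)).
    by rewrite (linD hlin) (linD (td_lin2 h2 _)); vext.
  by rewrite (linZ hlin) (linZ (td_lin2 h2 _)); vext.
exists (Lg * (vnorm (Dg z v) + Cv) + N * Cv * Lg + N * vnorm (Dg z v) + M) => e [e0 e1].
have [d1 [d10 H1]] := td_unif h2 e0.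
have [d2 [d20 H2]] := proj2 dg e e0; have [d3 [d30 H3]] := proj2 dgv e e0.
have d4 : 0 < d1 / (Lg + 1) by apply: Rdiv_lt_0_compat; lra.
exists (Rmin (Rmin (Rmin rg e) (d1 / (Lg + 1))) (Rmin dv (Rmin d2 d3))).
split; first by do !apply: Rmin_glb_lt.
move=> k /Rmin_Rgt_l [/Rmin_Rgt_l [/Rmin_Rgt_l [k1 k2] k3] /Rmin_Rgt_l [k4 /Rmin_Rgt_l [k5 k6]]].
have {}H2 := H2 _ k5; have {}H3 := H3 _ k6; have {}Hv := Hv _ k4.
have nk := vnorm_ge0 k.
have kE : z +v k -v z = k by vext.
have HL : vnorm (g (z +v k) -v g z) <= Lg * vnorm k.
  by have := Hg (z +v k) z; rewrite kE vsub_self vnorm0; apply.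
set y := g (z +v k) -v g z in HL *.
have yd : vnorm y < d1.
  have : (Lg + 1) * (d1 / (Lg + 1)) = d1 by field; lra.
  nra.
have [_ {}H1] := H1 _ yd.
have gE : g z +v y = g (z +v k) by rewrite /y; vext.
rewrite gE in H1; set w := Dg (z +v k) v; set w0 := Dg z v.
(* Four errors: the remainder of [Dh] along the increment y of g, the product of the increments of
   [Dg] and g, the remainder of g, and the remainder of [Dg] in direction [v]. *)
have -> : rem (fun w => Dh (g w) (Dg w v)) (fun hv => Dh (g z) (D2g v hv) +v D2h (Dg z v) (Dg z hv)) z k =
   (Dh (g (z +v k)) w -v Dh (g z) w -v D2h w y) +v (D2h (w -v w0) y) +v
   D2h w0 (y -v Dg z k) +v Dh (g z) (w -v w0 -v D2g v k).
  rewrite /rem -/w -/w0 !(linB hlin) (linB (td_lin2 h2 w0)).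
  have -> : D2h (w -v w0) y = D2h w y -v D2h w0 y; last by vext.
  have -> : D2h w y = D2h (w -v w0) y +v D2h w0 y; last by vext.
  by rewrite -(td_add h2); congr D2h; vext.
have a1 := H1 w; have a2 := HN (w -v w0) y; have a3 := HN w0 (y -v Dg z k); have a4 := HM (w -v w0 -v D2g v k).
have ww0 : vnorm (w -v w0) <= Cv * vnorm k := Hv.
have nw0 := vnorm_ge0 w0.
have nw : vnorm w <= vnorm w0 + Cv.
  have := vnormDB w w0; have : Cv * vnorm k <= Cv * 1 by apply: Rmult_le_compat_l; lra.
  lra.
have b1 : e * vnorm y * vnorm w <= e * (Lg * vnorm k) * (vnorm w0 + Cv).
  apply: Rmult_le_compat; try exact: vnorm_ge0; try lra.
    by have := vnorm_ge0 y; nra.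
  by apply: Rmult_le_compat_l; lra.
have b2 : N * vnorm (w -v w0) * vnorm y <= N * (Cv * e) * (Lg * vnorm k).
  apply: Rmult_le_compat => //; try exact: vnorm_ge0.
    by have := vnorm_ge0 (w -v w0); nra.
  apply: Rmult_le_compat_l => //; apply: Rle_trans ww0 _; apply: Rmult_le_compat_l; lra.
have b3 : N * vnorm w0 * vnorm (y -v Dg z k) <= N * vnorm w0 * (e * vnorm k).
  by apply: Rmult_le_compat_l; [nra|exact: H2].
have b4 : M * vnorm (w -v w0 -v D2g v k) <= M * (e * vnorm k).
  by apply: Rmult_le_compat_l; [lra|exact: H3].
apply: Rle_trans (vnormD _ _) _.
have c1 := vnormD (Dh (g (z +v k)) w -v Dh (g z) w -v D2h w y +v D2h (w -v w0) y) (D2h w0 (y -v Dg z k)).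
have c2 := vnormD (Dh (g (z +v k)) w -v Dh (g z) w -v D2h w y) (D2h (w -v w0) y).
lra.
Qed.

(** * Metric regularity and normal multipliers *)

(* Lyusternik-Graves, by minimising [|f w - e| + s |w - y|]: where [f w <> e]
   the right inverse of [Df z] supplies a descent direction. *)
Lemma metric_regularity a b (f : vec a -> vec b) Df D2 z : twice_diff f Df D2 z ->
  (forall e, exists y, Df z y = e) ->
  exists c r, 0 < c /\ 0 < r /\ forall y e, vnorm (y -v z) < r -> vnorm (e -v f z) < r ->
    exists y', f y' = e /\ vnorm (y' -v y) <= c * vnorm (f y -v e).
Proof.
move=> f2 /functional_choice [Y0 HY0].
have flin := td_lin f2.
(* The chosen preimages [Y0] need not depend linearly on the target; keeping only those of the basis
   vectors yields a linear right inverse of [Df z]. *)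
pose B (w : vec b) := vsum (fun j => w j *v Y0 (ebasis j)).
have DB w : Df z (B w) = w.
  rewrite /B (lin_vsum flin) [RHS]vec_basisE; congr vsum; apply: functional_extensionality => j.
  by rewrite (linZ flin) HY0.
have Bl : is_linear B.
  split=> *; apply: functional_extensionality => i; rewrite /B /vsum /vadd /vscale.
    by rewrite -big_split; apply: eq_bigr => j _ /=; ring.
  by rewrite sumRZ; apply: eq_bigr => j _; ring.
have [be [be0 HB]] := lin_bounded Bl.
have [|d1 [d10 H1]] := @td_cont _ _ _ _ _ _ f2 (/ (2 * (be + 1))); first by apply: Rinv_0_lt_compat; lra.
have [M [d2 [_ [d20 H2]]]] := td_near f2.
have [L [d3 [L0 [d30 H3]]]] := td_lipschitz f2.
have [R0 [R00 [R01 [R02 R03]]]] : exists R0, 0 < R0 /\ R0 <= d1 /\ R0 <= d2 /\ R0 <= d3.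
  exists (Rmin d1 (Rmin d2 d3)); do !split; first by do !apply: Rmin_glb_lt.
  - exact: Rmin_l.
  - by apply: Rle_trans (Rmin_r _ _) (Rmin_l _ _).
  - by apply: Rle_trans (Rmin_r _ _) (Rmin_r _ _).
(* Relative to t |u|, the descent loses 1/2 to the variation of [Df], 1/8 to the remainder and 1/4
   to the distance term with s = 1 / c, so 1/8 remains. The factor [q] gives r + c (L + 1) r = R0 /
   4, which keeps the minimiser interior to the ball of radius R0 / 2. *)
pose c := 4 * (be + 1); pose q := 1 + (L + 1) * c.
have c0 : 0 < c by rewrite /c; lra.
have q1 : 1 <= q by rewrite /q; nra.
pose r := R0 / (4 * q).
have r0 : 0 < r by apply: Rdiv_lt_0_compat; lra.
have rq : r * q = R0 / 4 by rewrite /r; field; lra.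
have rR : r <= R0 / 4 by nra.
exists c, r; do 2!split=> //; move=> y e yr er.
have zE u : z +v (u -v z) = u by vext.
have fye : vnorm (f y -v e) <= (L + 1) * r.
  have := vnorm_tri (f z) (f y) e; rewrite (vnormBC (f z) e).
  have := H3 y z ltac:(lra); rewrite vsub_self vnorm0 => /(_ ltac:(lra)).
  have := vnorm_ge0 (y -v z); nra.
pose S w := vnorm (w -v z) <= R0 / 2.
pose s := / c; have s0 : 0 < s by apply: Rinv_0_lt_compat.
have sc : s * c = 1 by rewrite /s; field; lra.
pose psi w := vnorm (f w -v e) + s * vnorm (w -v y).
have Sy : S y by rewrite /S; lra.
have [||||y' [Sy' Hmin]] := @extreme_value _ S psi (vnorm z + R0 / 2).
- by exists y.
- move=> w x Sw wx; apply: cv_le (cv_vnorm (vcvB wx (vcv_const z))) => j; exact: Sw.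
- by move=> x; rewrite /S; have := vnormDB x z; lra.
- move=> w x Sw Sx wx; rewrite /psi; apply: CV_plus; last first.
    by apply: CV_mult; [exact: cv_const|apply: cv_vnorm; apply: vcvB (vcv_const y)].
  apply: cv_vnorm; apply: vcvB; last exact: vcv_const.
  apply: (@vcv_squeeze _ _ _ (fun j => L * vnorm (w j -v x))) => [j|].
    by rewrite /S in Sw Sx; have := Sw j => Swj; apply: H3; lra.
  by rewrite -(Rmult_0_r L); apply: CV_mult; [exact: cv_const|apply/vcvP].
have bnd : s * vnorm (y' -v y) <= vnorm (f y -v e) - vnorm (f y' -v e).
  by have := Hmin y Sy; rewrite /psi vsub_self vnorm0; lra.
have y'y : vnorm (y' -v y) <= c * vnorm (f y -v e).
  have := vnorm_ge0 (f y' -v e); have -> : vnorm (y' -v y) = c * (s * vnorm (y' -v y)) by rewrite -Rmult_assoc (Rmult_comm c) sc; ring.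
  by move=> ?; apply: Rmult_le_compat_l; lra.
exists y'; split=> //.
apply: vsub_eq0; apply: vnorm_eq0; apply: Rnot_lt_le => pos.
set u := f y' -v e in pos.
have inS : vnorm (y' -v z) < R0 / 2.
  have := vnorm_tri y y' z; have : c * vnorm (f y -v e) <= c * ((L + 1) * r) by nra.
  have : c * ((L + 1) * r) = R0 / 4 - r by rewrite -rq /q; ring.
  lra.
have [[_ Hder] _] := H2 (y' -v z) ltac:(lra); rewrite zE in Hder.
have e0 : 0 < / (8 * (be + 1)) by apply: Rinv_0_lt_compat; lra.
have [d [d0 Hd]] := Hder _ e0.
have nB : vnorm (B u) <= be * vnorm u := HB u.
have [t [t01 [td tR]]] : exists t, 0 < t <= 1 /\ t * vnorm (B u) < d /\ t * vnorm (B u) <= R0 / 2 - vnorm (y' -v z).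
  have nb0 := vnorm_ge0 (B u).
  pose x := Rmin d (R0 / 2 - vnorm (y' -v z)) / (vnorm (B u) + 1).
  have m0 : 0 < Rmin d (R0 / 2 - vnorm (y' -v z)) by apply: Rmin_glb_lt; lra.
  have x0 : 0 < x by apply: Rdiv_lt_0_compat; lra.
  have xE : x * (vnorm (B u) + 1) = Rmin d (R0 / 2 - vnorm (y' -v z)) by rewrite /x; field; lra.
  exists (Rmin 1 x).
  have h1 := Rmin_l 1 x; have h2 := Rmin_r 1 x.
  have h3 : 0 < Rmin 1 x by apply: Rmin_glb_lt; lra.
  have h4 := Rmin_l d (R0 / 2 - vnorm (y' -v z)); have h5 := Rmin_r d (R0 / 2 - vnorm (y' -v z)).
  have h6 : Rmin 1 x * vnorm (B u) <= x * vnorm (B u) by apply: Rmult_le_compat_r.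
  by do !split; lra.
pose k := (- t) *v B u.
have nk : vnorm k = t * vnorm (B u) by rewrite /k vnormZ Rabs_Ropp Rabs_pos_eq; lra.
have Sk : S (y' +v k).
  rewrite /S; have -> : y' +v k -v z = (y' -v z) +v k by vext.
  by have := vnormD (y' -v z) k; lra.
have := Hmin _ Sk; rewrite /psi -/u.
have h1 := Hd k ltac:(lra).
have h2 : vnorm (Df y' (B u) -v u) <= / 2 * vnorm u.
  have := H1 (y' -v z) ltac:(lra) (B u); rewrite zE DB => h; apply: Rle_trans h _.
  apply: (Rle_trans _ (/ (2 * (be + 1)) * ((be + 1) * vnorm u))); last by apply: Req_le; field; lra.
  by apply: Rmult_le_compat_l; [apply/Rlt_le/Rinv_0_lt_compat; lra|lra].
have Dlin : is_linear (Df y') by have [[l _] _] := H2 (y' -v z) ltac:(lra); rewrite zE in l.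
have E : f (y' +v k) -v e = (1 - t) *v u -v t *v (Df y' (B u) -v u) +v (f (y' +v k) -v f y' -v Df y' k).
  by rewrite /k (linZ Dlin) /u; vext.
have h3 : vnorm (f (y' +v k) -v e) <= (1 - t) * vnorm u + t * (/ 2 * vnorm u) + t * (vnorm u / 8).
  rewrite E; apply: Rle_trans (vnormD _ _) _; apply: Rplus_le_compat.
    apply: Rle_trans (vnormB _ _) _; rewrite !vnormZ_pos; try lra.
    by apply: Rplus_le_compat_l; apply: Rmult_le_compat_l; lra.
  apply: Rle_trans h1 _; rewrite nk.
  apply: (Rle_trans _ (/ (8 * (be + 1)) * (t * ((be + 1) * vnorm u)))); last by apply: Req_le; field; lra.
  by apply: Rmult_le_compat_l; [lra|apply: Rmult_le_compat_l; lra].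
have h4 : s * vnorm (y' +v k -v y) <= s * vnorm (y' -v y) + t * (vnorm u / 4).
  apply: (Rle_trans _ (s * (vnorm (y' -v y) + vnorm k))).
    apply: Rmult_le_compat_l; first lra.
    have -> : y' +v k -v y = (y' -v y) +v k by vext.
    exact: vnormD.
  rewrite nk; have -> : t * (vnorm u / 4) = s * (t * ((be + 1) * vnorm u)) by rewrite /s /c; field; lra.
  rewrite Rmult_plus_distr_l; apply: Rplus_le_compat_l; apply: Rmult_le_compat_l; first lra.
  by apply: Rmult_le_compat_l; lra.
have : 0 < t * (vnorm u / 8) by apply: Rmult_lt_0_compat; lra.
lra.
Qed.

(** M times the distance from L u to T is the supremum of <mu, L u> over the mu in the polar of T
    with |mu| <= M. The hypothesis thus bounds <xs, .> by the support function of the compact convex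
    set of all [adj L mu], which must therefore contain [xs]. *)
Lemma normal_multiplier a b (L : vec a -> vec b) (T : vec b -> Prop) xs M :
  is_linear L -> convex_cone T -> 0 <= M ->
  (forall u w, T w -> dot xs u <= M * vnorm (L u -v w)) ->
  exists mu, polar T mu /\ vnorm mu <= M /\ adj L mu = xs.
Proof.
move=> Ll Tc M0 H.
pose D mu := polar T mu /\ vnorm mu <= M.
have Dcl : vclosed D.
  move=> w x Dw wx; split; last by apply: cv_le (cv_vnorm wx) => j; case: (Dw j).
  move=> y Ty; apply: cv_le (cv_dot wx (vcv_const y)) => j.
  by case: (Dw j) => p _; apply: p.
have D0 : D (@vzero b) by split; [move=> x _; rewrite dot0l; lra|rewrite vnorm0].
have al := adj_lin L.
have [||||mu0 [Dmu0 Hmin]] := @extreme_value _ D (fun mu => vnorm (xs -v adj L mu)) M.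
- by exists (@vzero b).
- exact: Dcl.
- by move=> x [].
- move=> w x _ _ wx; apply: cv_vnorm; apply: vcvB; first exact: vcv_const.
  exact: vcv_lin.
exists mu0; case: (Dmu0) => p0 n0; do 2!split=> //.
pose u := xs -v adj L mu0.
have var mu : D mu -> dot u (adj L mu -v adj L mu0) <= 0.
  pose Q x := exists nu, D nu /\ x = adj L nu.
  move=> Dmu; apply: (@nearest_convex _ Q); [|by exists mu0| |by exists mu].
    move=> x y t t01 [nu [[pn nn] ->]] [nu' [[pn' nn'] ->]].
    exists (nu +v t *v (nu' -v nu)); split; last by rewrite (linD al) (linZ al) (linB al).
    have -> : nu +v t *v (nu' -v nu) = (1 - t) *v nu +v t *v nu' by vext.
    split; last first.
      by apply: Rle_trans (vnormD _ _) _; rewrite !vnormZ_pos; try lra; nra.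
    move=> w Tw; rewrite !dotE; have := pn w Tw; have := pn' w Tw; nra.
  by move=> q [nu [Dnu ->]]; apply: Hmin.
(* For the residual u of the best approximation, such a mu and the variational inequality give |u|^2
   <= 0. *)
suff [mu [Dmu Hmu]] : exists mu, D mu /\ dot xs u <= dot mu (L u).
  have := var mu Dmu; rewrite dotBr !(dotC u) !dot_adj // => h.
  apply/esym/vsub_eq0/dot_eq0; rewrite -/u {1}/u dotBl dot_adj //; lra.
have [_ [TD TZ]] := Tc.
have [|p [Cp Hp]] := nearest_point (L u) _ (@vclosure_closed _ T).
  by exists (@vzero b) => e e0; exists (@vzero b); rewrite vsub_self vnorm0; split; [case: Tc|lra].
have Tvar := nearest_convex (vclosure_convex (cone_convex Tc)) Cp Hp.
(* Moreau decomposition of L u: the residual r is polar to T and orthogonal to p. The required mu is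
   r rescaled to norm M, or 0 if r = 0. *)
set r := L u -v p in Tvar.
have CZ t : 0 <= t -> vclosure T (t *v p).
  move=> t0 e e0; have [q [Tq Hq]] := Cp (e / (t + 1)) ltac:(apply: Rdiv_lt_0_compat; lra).
  exists (t *v q); split; first exact: TZ.
  have -> : t *v p -v t *v q = t *v (p -v q) by vext.
  rewrite vnormZ_pos //; have E : e / (t + 1) * (t + 1) = e by field; lra.
  have := vnorm_ge0 (p -v q); nra.
have rp : dot r p = 0.
  have := Tvar _ (CZ 0 ltac:(lra)); have := Tvar _ (CZ 2 ltac:(lra)); rewrite !dotBr !dotZr; lra.
have rT : polar T r.
  move=> w Tw; have : dot r (w -v p) <= 0.
    by apply: Tvar => e e0; exists w; rewrite vsub_self vnorm0; split=> //; lra.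
  by rewrite dotBr rp; lra.
have xr : dot xs u <= M * vnorm r.
  suff : dot xs u - M * vnorm r <= 0 by lra.
  apply: (@le0_of_small _ M) => e [e0 _]; have [q [Tq Hq]] := Cp e e0.
  have := H u q Tq; have := vnorm_tri p (L u) q; rewrite -/r => h1 h2.
  have : M * vnorm (L u -v q) <= M * (vnorm r + e) by apply: Rmult_le_compat_l; lra.
  lra.
have Lu : L u = r +v p by rewrite /r; vext.
have [r0|r0] := Rle_lt_dec (vnorm r) 0.
  exists (@vzero b); split=> //; rewrite dot0l; have := vnorm_ge0 r; nra.
exists ((M / vnorm r) *v r).
have Mr : 0 <= M / vnorm r by apply: Rmult_le_pos => //; apply/Rlt_le/Rinv_0_lt_compat.
split; first split.
- by move=> w /rT; rewrite dotZl; nra.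
- by rewrite vnormZ_pos //; apply: Req_le; field; lra.
- rewrite dotZl Lu dotDr rp -vnorm_sqr; apply: Rle_trans xr _; apply: Req_le; field; lra.
Qed.

Lemma tangent_eps k (Om : vec k -> Prop) z w : Om z ->
  (forall e, 0 < e -> exists t w', 0 < t < e /\ vnorm (w' -v w) <= e /\ Om (z +v t *v w')) ->
  tangent_cone Om z w.
Proof.
move=> Oz H; split=> //.
have /functional_choice [t /functional_choice [w' Hw]] := fun j : nat => H _ (inv_pos j).
exists t, w'; split; [|split; [|split]] => [j|||j]; try by case: (Hw j) => [[? ?] [? ?]].
  apply: cv_squeeze cv_inv => j; case: (Hw j) => [[? ?] _].
  by rewrite Rminus_0_r Rabs_pos_eq; lra.
by apply: vcv_squeeze cv_inv => j; case: (Hw j) => [_ []].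
Qed.

Lemma ray_cv k (z : vec k) t w w0 : Un_cv t 0 -> vseq_cv w w0 -> vseq_cv (fun j => z +v t j *v w j) z.
Proof.
move=> t0 ww; have {2}-> : z = z +v 0 *v w0 by vext.
by apply: vcvD; [exact: vcv_const|exact: vcvZ].
Qed.

Lemma vsnd_adj m n b (L : vec (m + n) -> vec b) mu : is_linear L ->
  vsnd (adj L mu) = adj (fun u => L (vjoin (@vzero m) u)) mu.
Proof.
move=> Ll; apply: dot_ext => u.
rewrite dot_adj; last exact: lin_comp (@vsnd_inj_lin m n) Ll.
by rewrite -dot_adj // dot_join !vjoinE dot0r; lra.
Qed.

(** * The reduced system G(z) in K *)

Section Reduced.
Variables (m n d : nat) (G : vec (m + n) -> vec d) (DG : vec (m + n) -> vec (m + n) -> vec d).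
Variables (D2 : vec (m + n) -> vec (m + n) -> vec d) (K : vec d -> Prop) (Om : vec (m + n) -> Prop).
Variable zb : vec (m + n).
Hypothesis G2 : twice_diff G DG D2 zb.
Hypothesis Kccc : closed_convex_cone K.
Hypothesis G0 : G zb = @vzero d.
Variable r0 : R.
Hypothesis r0_gt0 : 0 < r0.
Hypothesis OmK : forall z, vnorm (z -v zb) < r0 -> (Om z <-> K (G z)).
Variable kap : R.
Hypothesis kap_ge0 : 0 <= kap.
(** The distance to K is replaced by the distance to an arbitrary k in K, which is how stability
    gets used. Only x is corrected and p stays fixed, as befits normals to the sections. *)
Hypothesis robinson : forall z k, vnorm (z -v zb) < r0 -> vnorm k < r0 -> K k ->
  exists x, Om (vjoin (vfst z) x) /\ vnorm (x -v vsnd z) <= kap * vnorm (G z -v k).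

Let A := DG zb.
Let Alin : is_linear A. Proof. exact: td_lin G2. Qed.
Let Kcl : vclosed K. Proof. by case: Kccc. Qed.
Let Kcone : convex_cone K. Proof. exact: ccc_cone Kccc. Qed.
Let K0 : K (@vzero d). Proof. by case: Kcone. Qed.
Let KD x y : K x -> K y -> K (x +v y). Proof. by case: Kcone => _ [H _]; apply: H. Qed.
Let KZ t x : 0 <= t -> K x -> K (t *v x). Proof. by case: Kcone => _ [_ H]; apply: H. Qed.

Lemma Om_base : Om zb.
Proof. by apply/OmK; rewrite ?vsub_self ?vnorm0 ?G0. Qed.

Lemma robinson_join z k : vnorm (z -v zb) < r0 -> vnorm k < r0 -> K k ->
  exists z', Om z' /\ vfst z' = vfst z /\ vnorm (z' -v z) <= kap * vnorm (G z -v k).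
Proof.
move=> zr kr Kk; have [x [Ox Hx]] := robinson zr kr Kk.
exists (vjoin (vfst z) x); rewrite vfst_join; do 2!split=> //.
apply: Rle_trans (vnorm_join_le _) _; rewrite !vjoinE vsub_self vnorm0; lra.
Qed.

Lemma G_ray_cv t v v0 : (forall j, 0 < t j) -> Un_cv t 0 -> vseq_cv v v0 ->
  vseq_cv (fun j => / t j *v G (zb +v t j *v v j)) (A v0).
Proof.
move=> tp t0 vv; have dG : has_deriv G (DG zb) zb.
  by case: G2 => [[r [rp H]] _]; apply: H; rewrite vsub_self vnorm0.
apply: vcv_ext (deriv_seq dG tp t0 vv) => j.
by rewrite G0; vext.
Qed.

Lemma tangent_K v : tangent_cone Om zb v -> K (A v).
Proof.
move=> [_ [t [w [tp [t0 [wv Hw]]]]]].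
have [N HN] := ray_cv zb t0 wv r0_gt0.
have hN j : (j <= j + N)%nat := leq_addr N j.
apply: (Kcl _ (G_ray_cv (fun j => tp (j + N)%nat) (cv_sub hN t0) (vcv_sub hN wv))) => j.
apply: KZ; first by apply/Rlt_le/Rinv_0_lt_compat.
by apply/OmK => //; apply: HN; apply: leq_addl.
Qed.

(** The point zb + t v misses the graph by o(t): stability with target t A v in K corrects it at the
    cost kap |G (zb + t v) - t A v|. *)
Lemma K_tangent v : K (A v) -> tangent_cone Om zb v.
Proof.
move=> Kv; apply: tangent_eps Om_base _ => e e0.
have dG : has_deriv G A zb.
  by case: G2 => [[r [rp H]] _]; apply: H; rewrite vsub_self vnorm0.
have nv := vnorm_ge0 v.
have c0 : 0 < kap * vnorm v + 1 by nra.
have [d1 [d10 H1]] := proj2 dG _ (Rdiv_lt_0_compat _ _ e0 c0).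
have nA := vnorm_ge0 (A v).
have [t [t0 [te [t1 [t2 t3]]]]] : exists t, 0 < t /\ t < e /\ t * vnorm v < d1 /\ t * vnorm v < r0 /\ t * vnorm (A v) < r0.
  pose B := vnorm v + vnorm (A v) + 1.
  pose q := Rmin e (Rmin d1 r0).
  have q0 : 0 < q by do !apply: Rmin_glb_lt.
  have qe : q <= e := Rmin_l _ _.
  have qd : q <= d1 := Rle_trans _ _ _ (Rmin_r _ _) (Rmin_l _ _).
  have qr : q <= r0 := Rle_trans _ _ _ (Rmin_r _ _) (Rmin_r _ _).
  have x0 : 0 < q / (B + 1) by apply: Rdiv_lt_0_compat => //; rewrite /B; lra.
  have xE : q / (B + 1) * (B + 1) = q by field; rewrite /B; lra.
  exists (q / (B + 1)); rewrite /B in xE x0 *; do !split; nra.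
have nt : vnorm (t *v v) = t * vnorm v by rewrite vnormZ_pos; lra.
have [||z' [Oz' [_ Hz']]] := @robinson_join (zb +v t *v v) (t *v A v) _ _ (KZ (Rlt_le _ _ t0) Kv).
- have -> : zb +v t *v v -v zb = t *v v by vext.
 by lra.
- by rewrite vnormZ_pos; lra.
exists t, (/ t *v (z' -v zb)); split=> //; split; last first.
  have -> : zb +v t *v (/ t *v (z' -v zb)) = z' by vext; field; lra.
  exact: Oz'.
have it : 0 < / t by apply: Rinv_0_lt_compat.
have -> : / t *v (z' -v zb) -v v = / t *v (z' -v (zb +v t *v v)) by vext; field; lra.
rewrite vnormZ_pos; last lra.
have := H1 (t *v v) ltac:(lra); rewrite G0 nt (linZ Alin).
have -> : G (zb +v t *v v) -v @vzero d -v t *v A v = G (zb +v t *v v) -v t *v A v by vext.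
move=> h1.
apply: (Rle_trans _ (/ t * (kap * (e / (kap * vnorm v + 1) * (t * vnorm v))))).
  apply: Rmult_le_compat_l; first lra.
  by apply: Rle_trans Hz' _; apply: Rmult_le_compat_l.
have -> : / t * (kap * (e / (kap * vnorm v + 1) * (t * vnorm v))) = e - e / (kap * vnorm v + 1) by field; lra.
have := Rdiv_lt_0_compat _ _ e0 c0; lra.
Qed.

Lemma tangent_iff v : tangent_cone Om zb v <-> K (A v).
Proof. by split; [exact: tangent_K|exact: K_tangent]. Qed.

Lemma tangent_Om_cone : convex_cone (tangent_cone Om zb).
Proof.
split; first by apply/tangent_iff; rewrite (lin0 Alin).
split=> [x y|t x tp]; rewrite !tangent_iff ?(linD Alin) ?(linZ Alin); [exact: KD|exact: KZ].
Qed.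

Lemma crit_Om_cone zs : convex_cone (crit_cone Om zb zs).
Proof.
have [T0 [TD TZ]] := tangent_Om_cone.
split; first by split=> //; rewrite dot0r.
split=> [x y [Tx x0] [Ty y0]|t x tp [Tx x0]]; split; try by [apply: TD|apply: TZ].
  by rewrite dotDr x0 y0; lra.
by rewrite dotZr x0; lra.
Qed.

(** * Normals to the sections and their multipliers *)

Definition section_normal (z : vec (m + n)) (us : vec n) : Prop :=
  normal_cone (fun x => Om (vjoin (vfst z) x)) (vsnd z) us.

Lemma small_factor e c : 0 < e -> 0 <= c -> exists t, 0 < t /\ forall s, 0 < s <= t -> s * c < e.
Proof.
move=> e0 c0; exists (e / (c + 1)); split; first by apply: Rdiv_lt_0_compat; lra.
have E : e / (c + 1) * (c + 1) = e by field; lra.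
by move=> s [s0 st]; nra.
Qed.

(* Exact penalisation: by stability the normal [us] satisfies
   [<us, u> <= kap |us| |DxG u - w|] for all [w] in the tangent cone of [K] at [G z]. *)
Lemma section_multiplier : exists r, 0 < r /\ forall z us, vnorm (z -v zb) < r -> section_normal z us ->
  exists mu, polar K mu /\ dot mu (G z) = 0 /\ vnorm mu <= kap * vnorm us /\ vsnd (adj (DG z) mu) = us.
Proof.
have [[rd [rd0 Hd]] _] := G2; have [L [rl [L0 [rl0 HL]]]] := td_lipschitz G2.
pose r := Rmin (r0 / 2) (Rmin rd (Rmin rl (r0 / (2 * (L + 1))))).
have rr0 : r <= r0 / 2 := Rmin_l _ _.
have rrd : r <= rd := Rle_trans _ _ _ (Rmin_r _ _) (Rmin_l _ _).
have rrl : r <= rl := Rle_trans _ _ _ (Rmin_r _ _) (Rle_trans _ _ _ (Rmin_r _ _) (Rmin_l _ _)).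
have rrL : r <= r0 / (2 * (L + 1)) := Rle_trans _ _ _ (Rmin_r _ _) (Rle_trans _ _ _ (Rmin_r _ _) (Rmin_r _ _)).
have rp : 0 < r.
  by do !apply: Rmin_glb_lt => //; [lra|apply: Rdiv_lt_0_compat; lra].
exists r; split=> // z us zr [Oz Hus].
have dz : has_deriv G (DG z) z by apply: Hd; lra.
have Gz : vnorm (G z) < r0 / 2.
  have := HL z zb ltac:(lra); rewrite vsub_self vnorm0 G0 => /(_ ltac:(lra)).
  have -> : G z -v @vzero d = G z by vext.
  have : (L + 1) * (r0 / (2 * (L + 1))) = r0 / 2 by field; lra.
  have := vnorm_ge0 (z -v zb); nra.
rewrite vjoin_eta in Oz.
have KGz : K (G z) by apply/OmK => //; lra.
(* The radial cone of K at G z. Its polar consists of the vectors of the polar of K that are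
   orthogonal to G z, which is where complementarity comes from. *)
pose T w := exists k s, K k /\ 0 <= s /\ w = k -v s *v G z.
have Tc : convex_cone T.
  split; first by exists (@vzero d), 0; split; [exact: K0|split; [lra|vext]].
  split=> [x y [k [s [Kk [s0 ->]]]] [k' [s' [Kk' [s'0 ->]]]]|t x t0 [k [s [Kk [s0 ->]]]]].
    by exists (k +v k'), (s + s'); split; [exact: KD|split; [lra|vext]].
  by exists (t *v k), (t * s); split; [exact: KZ|split; [nra|vext]].
have nus := vnorm_ge0 us.
have Llin := lin_comp (@vsnd_inj_lin m n) (proj1 dz).
have [|u w [k [s [Kk [s0 Ew]]]]|mu [pmu [nmu Emu]]] :=
  @normal_multiplier _ _ (fun u => DG z (vjoin (@vzero m) u)) T us (kap * vnorm us) Llin Tc; first nra; last first.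
  have muG : dot mu (G z) <= 0 by apply: pmu; exists (G z), 0; split=> //; split; [lra|vext].
  exists mu; split; [|split; [|split=> //]].
  - by move=> k Kk; apply: pmu; exists k, 0; split=> //; split; [lra|vext].
  - have : dot mu (@vzero d -v 1 *v G z) <= 0 by apply: pmu; exists (@vzero d), 1; split=> //; split=> //; lra.
    by rewrite !dotE; lra.
  - by rewrite vsnd_adj //; case: dz.
set uu := vjoin (@vzero m) u; set q := vnorm (DG z uu -v w).
have q0 : 0 <= q := vnorm_ge0 _.
have nu : vnorm uu <= vnorm u.
  by apply: Rle_trans (vnorm_join_le _) _; rewrite !vjoinE vnorm0; lra.
have nu0 := vnorm_ge0 u; have nuu0 := vnorm_ge0 uu.
pose B := vnorm u + kap * (q + vnorm u).
have B0 : 0 <= B by rewrite /B; nra.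
suff : dot us u - kap * vnorm us * q <= 0 by lra.
apply: (@le0_of_small _ (B + kap * vnorm us * vnorm u)) => e [e0 e1].
have [d1 [d10 H1]] := proj2 dz e e0.
have [d2 [d20 H2]] := Hus e e0.
have nw0 := vnorm_ge0 w.
have [t1 [t10 Ht1]] := small_factor d10 nuu0.
have [t2 [t20 Ht2]] := small_factor (ltac:(lra) : 0 < r0 / 2) nuu0.
have [t3 [t30 Ht3]] := small_factor (ltac:(lra) : 0 < r0 / 2) nw0.
have [t4 [t40 Ht4]] := small_factor Rlt_0_1 s0.
have [t5 [t50 Ht5]] := small_factor d20 B0.
have [t [t0 [l1 [l2 [l3 [l4 l5]]]]]] : exists t, 0 < t /\ t <= t1 /\ t <= t2 /\ t <= t3 /\ t <= t4 /\ t <= t5.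
  exists (Rmin (Rmin t1 t2) (Rmin t3 (Rmin t4 t5))).
  have a1 := Rmin_l (Rmin t1 t2) (Rmin t3 (Rmin t4 t5)).
  have a2 := Rmin_r (Rmin t1 t2) (Rmin t3 (Rmin t4 t5)).
  have a3 := Rmin_l t1 t2; have a4 := Rmin_r t1 t2.
  have a5 := Rmin_l t3 (Rmin t4 t5); have a6 := Rmin_r t3 (Rmin t4 t5).
  have a7 := Rmin_l t4 t5; have a8 := Rmin_r t4 t5.
  by split; [do !apply: Rmin_glb_lt|lra].
have {}Ht1 := Ht1 t (conj t0 l1); have {}Ht2 := Ht2 t (conj t0 l2); have {}Ht3 := Ht3 t (conj t0 l3).
have {}Ht4 := Ht4 t (conj t0 l4); have {}Ht5 := Ht5 t (conj t0 l5).
have ntu : vnorm (t *v uu) = t * vnorm uu by rewrite vnormZ_pos; lra.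
have h1 := H1 (t *v uu) ltac:(lra); rewrite ntu in h1.
(* Since t s < 1, this is a nonnegative combination of G z and k; it serves as the target of the
   correction. *)
have Kt : K (G z +v t *v w).
  have -> : G z +v t *v w = (1 - t * s) *v G z +v t *v k by rewrite Ew; vext.
  by apply: KD; apply: KZ => //; lra.
have [||x' [Ox' Hx']] := @robinson (z +v t *v uu) (G z +v t *v w) _ _ Kt.
- have -> : z +v t *v uu -v zb = (z -v zb) +v t *v uu by vext.
  by have := vnormD (z -v zb) (t *v uu); lra.
- by have := vnormD (G z) (t *v w); rewrite [vnorm (t *v w)]vnormZ_pos; lra.
have fE : vfst (z +v t *v uu) = vfst z by rewrite !vjoinE; vext.
have sE : vsnd (z +v t *v uu) = vsnd z +v t *v u by rewrite !vjoinE.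
rewrite fE in Ox'; rewrite sE in Hx'.
have hx : vnorm (x' -v (vsnd z +v t *v u)) <= kap * (t * (q + e * vnorm u)).
  apply: Rle_trans Hx' _; apply: Rmult_le_compat_l => //.
  have -> : G (z +v t *v uu) -v (G z +v t *v w) = (G (z +v t *v uu) -v G z -v DG z (t *v uu)) +v t *v (DG z uu -v w).
    by rewrite (linZ (proj1 dz)); vext.
  apply: Rle_trans (vnormD _ _) _; rewrite [vnorm (t *v _)]vnormZ_pos -/q; last lra.
  have : e * (t * vnorm uu) <= e * (t * vnorm u) by apply: Rmult_le_compat_l; [lra|apply: Rmult_le_compat_l; lra].
  lra.
have eu : e * vnorm u <= vnorm u by nra.
have ntu' : vnorm (t *v u) = t * vnorm u by rewrite vnormZ_pos; lra.
have xB : vnorm (x' -v vsnd z) <= t * B.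
  have -> : x' -v vsnd z = (x' -v (vsnd z +v t *v u)) +v t *v u by vext.
  have := vnormD (x' -v (vsnd z +v t *v u)) (t *v u).
  have : kap * (t * (q + e * vnorm u)) <= kap * (t * (q + vnorm u)).
    by apply: Rmult_le_compat_l => //; apply: Rmult_le_compat_l; lra.
  rewrite /B; lra.
have h2 := H2 x' Ox' ltac:(lra).
have h3 := cauchy_schwarz_abs us (x' -v (vsnd z +v t *v u)).
have {}h3 : - dot us (x' -v (vsnd z +v t *v u)) <= vnorm us * (kap * (t * (q + e * vnorm u))).
  have := Rle_abs (- dot us (x' -v (vsnd z +v t *v u))); rewrite Rabs_Ropp.
  have : vnorm us * vnorm (x' -v (vsnd z +v t *v u)) <= vnorm us * (kap * (t * (q + e * vnorm u))) by apply: Rmult_le_compat_l.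
  lra.
have E : dot us (x' -v vsnd z) = dot us (x' -v (vsnd z +v t *v u)) + t * dot us u by rewrite !dotE; ring.
have h4 : e * vnorm (x' -v vsnd z) <= e * (t * B) by apply: Rmult_le_compat_l; lra.
apply: (Rmult_le_reg_l t) => //; rewrite E in h2; lra.
Qed.

(** * Tangent directions to the graph of the section normals *)

Variable xs : vec n.

Definition gph_section_normal (w : vec ((m + n) + n)) : Prop := section_normal (vfst w) (vsnd w).

(* The derivative at [zb] of [z |-> DxG(z)^* mu], applied to [v]. *)
Definition dxx (mu : vec d) (v : vec (m + n)) : vec n :=
  fun j => dot mu (D2 (vjoin (@vzero m) (ebasis j)) v).

(** The right-hand side with z^* = A^* mu eliminated: that z^* is normal to the tangent cone at [v]
    becomes A v in K and <mu, A v> = 0. The curvature of h is contained in [D2], hence in both the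
    maximised form and [dxx]. *)
Definition rhs_reduced (v : vec (m + n)) (us : vec n) : Prop :=
  exists mu, polar K mu /\ K (A v) /\ dot mu (A v) = 0 /\ vsnd (adj A mu) = xs /\
    (forall mu', polar K mu' -> adj A mu' = adj A mu -> dot mu' (D2 v v) <= dot mu (D2 v v)) /\
    exists w, normal_cone (crit_cone Om zb (adj A mu)) v w /\ us = dxx mu v +v vsnd w.

(** A record, so that all data pass to a subsequence together. The multipliers converge, but no rate
    relative to [t] is recorded. *)
Record multiplier_seq (v : vec (m + n)) (us : vec n) (t : nat -> R) (vs : nat -> vec (m + n))
    (uss : nat -> vec n) (mus : nat -> vec d) (mu : vec d) : Prop := MultiplierSeq {
  ms_pos : forall j, 0 < t j;
  ms_t : Un_cv t 0;
  ms_v : vseq_cv vs v;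
  ms_u : vseq_cv uss us;
  ms_mu : vseq_cv mus mu;
  ms_K : forall j, K (G (zb +v t j *v vs j));
  ms_polar : forall j, polar K (mus j);
  ms_compl : forall j, dot (mus j) (G (zb +v t j *v vs j)) = 0;
  ms_normal : forall j, vsnd (adj (DG (zb +v t j *v vs j)) (mus j)) = xs +v t j *v uss j }.

Lemma multiplier_seq_sub phi v us t vs uss mus mu : (forall j, (j <= phi j)%nat) ->
  multiplier_seq v us t vs uss mus mu ->
  multiplier_seq v us (fun j => t (phi j)) (fun j => vs (phi j)) (fun j => uss (phi j)) (fun j => mus (phi j)) mu.
Proof.
move=> hphi [H1 H2 H3 H4 H5 H6 H7 H8 H9]; split=> //; try exact: (vcv_sub hphi).
exact: (cv_sub hphi).
Qed.

Lemma multiplier_seq_exists v us : tangent_cone gph_section_normal (vjoin zb xs) (vjoin v us) ->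
  exists t vs uss mus mu, multiplier_seq v us t vs uss mus mu.
Proof.
move=> [_ [t [ws [tp [t0 [wv Hw]]]]]].
have vv := vcv_fst wv; have uu := vcv_snd wv; rewrite vfst_join in vv; rewrite vsnd_join in uu.
have {}Hw j : section_normal (zb +v t j *v vfst (ws j)) (xs +v t j *v vsnd (ws j)).
  by have := Hw j; rewrite /gph_section_normal !vjoinE.
have [r [rp Hr]] := section_multiplier.
have rm : 0 < Rmin r r0 by apply: Rmin_glb_lt.
have [N HN] := ray_cv zb t0 vv rm.
have hN j : (j <= j + N)%nat := leq_addr N j.
have Hmu j : exists mu, polar K mu /\ dot mu (G (zb +v t (j + N)%nat *v vfst (ws (j + N)%nat))) = 0 /\
    vnorm mu <= kap * vnorm (xs +v t (j + N)%nat *v vsnd (ws (j + N)%nat)) /\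
    vsnd (adj (DG (zb +v t (j + N)%nat *v vfst (ws (j + N)%nat))) mu) = xs +v t (j + N)%nat *v vsnd (ws (j + N)%nat).
  apply: Hr (Hw _); apply: Rlt_le_trans (HN _ (leq_addl _ _)) (Rmin_l _ _).
have [mus Hmus] := functional_choice _ Hmu.
have [B HB] := vcv_bounded (ray_cv xs t0 uu).
have [j|phi [mu [hphi cmu]]] := @bw_vec _ mus (kap * B).
  case: (Hmus j) => _ [_ [h _]]; apply: Rle_trans h _; exact: Rmult_le_compat_l.
have hp j : (j <= phi j + N)%nat by apply: leq_trans (hphi j) (leq_addr _ _).
exists (fun j => t (phi j + N)%nat), (fun j => vfst (ws (phi j + N)%nat)), (fun j => vsnd (ws (phi j + N)%nat)), (fun j => mus (phi j)), mu.
split=> //; try by move=> j; case: (Hmus (phi j)) => [h1 [h2 [h3 h4]]].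
- exact: (cv_sub hp t0).
- exact: (vcv_sub hp vv).
- exact: (vcv_sub hp uu).
- move=> j; have [Oz _] := Hw (phi j + N)%nat; rewrite vjoin_eta in Oz.
  apply/OmK => //; apply: Rlt_le_trans (HN _ (leq_addl _ _)) (Rmin_r _ _).
Qed.

(** The linear term is subtracted at [vs j] and not at [v]: the convergence of [vs] has no rate, so
    A (vs j - v) / t j may diverge. In later uses the linear term cancels or is paired with a
    convergent covector. *)
Lemma taylor_seq t vs v : (forall j, 0 < t j) -> Un_cv t 0 -> vseq_cv vs v ->
  vseq_cv (fun j => / (t j * t j) *v (G (zb +v t j *v vs j) -v t j *v A (vs j))) ((1 / 2) *v D2 v v).
Proof.
move=> tp t0 vv.
have [B HB] := vcv_bounded vv; have B0 : 0 <= B by have := HB 0%N; have := vnorm_ge0 (vs 0%N); lra.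
have D2cv : vseq_cv (fun j => D2 (vs j) (vs j)) (D2 v v).
  have [M [M0 HM]] := td_bounded G2.
  apply: (@vcv_squeeze _ _ _ (fun j => (M * B + M * vnorm v) * vnorm (vs j -v v))); last first.
    by rewrite -(Rmult_0_r (M * B + M * vnorm v)); apply: CV_mult; [exact: cv_const|apply/vcvP].
  move=> j; have -> : D2 (vs j) (vs j) -v D2 v v = D2 (vs j -v v) (vs j) +v D2 v (vs j -v v).
    have E : D2 (vs j) (vs j) = D2 (vs j -v v) (vs j) +v D2 v (vs j).
      by rewrite -(td_add G2); congr D2; vext.
    by rewrite E (linB (td_lin2 G2 v)); vext.
  apply: Rle_trans (vnormD _ _) _.
  have := HM (vs j -v v) (vs j); have := HM v (vs j -v v).
  have nd := vnorm_ge0 (vs j -v v).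
  have : M * vnorm (vs j -v v) * vnorm (vs j) <= M * vnorm (vs j -v v) * B.
    by apply: Rmult_le_compat_l; [nra|exact: HB].
  lra.
have -> : (1 / 2) *v D2 v v = @vzero d +v (1 / 2) *v D2 v v by vext.
pose rm j := G (zb +v t j *v vs j) -v G zb -v DG zb (t j *v vs j) -v (1 / 2) *v D2 (t j *v vs j) (t j *v vs j).
apply: (@vcv_ext _ (fun j => / (t j * t j) *v rm j +v (1 / 2) *v D2 (vs j) (vs j))) => [j|].
  have DZ : D2 (t j *v vs j) (t j *v vs j) = (t j * t j) *v D2 (vs j) (vs j).
    rewrite (linZ (td_lin2 G2 _)) (td_sym G2) (linZ (td_lin2 G2 _)); vext.
  rewrite /rm G0 -/A (linZ Alin) DZ; vext; field; have := tp j; lra.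
apply: vcvD; last by apply: vcvZ; [exact: cv_const|].
move=> e e0.
have BB : 0 < B * B + 1 by nra.
have [dl [dl0 Hdl]] := td_taylor G2 (Rdiv_lt_0_compat _ _ e0 BB).
have [N HN] := ray_cv (@vzero _) t0 vv dl0.
exists N => j /HN; have -> : @vzero (m + n) +v t j *v vs j -v @vzero (m + n) = t j *v vs j by vext.
move/Hdl; rewrite -/(rm j); have tj := tp j; have tj2 : 0 < t j * t j by nra.
have it : 0 < / (t j * t j) by apply: Rinv_0_lt_compat.
have -> : / (t j * t j) *v rm j -v @vzero d = / (t j * t j) *v rm j by vext.
rewrite !vnormZ_pos; try lra; move=> h1.
apply: (Rle_lt_trans _ (e / (B * B + 1) * (B * B))).
  apply: (Rle_trans _ (/ (t j * t j) * (e / (B * B + 1) * (t j * vnorm (vs j) * (t j * vnorm (vs j)))))).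
    by apply: Rmult_le_compat_l; lra.
  have -> : / (t j * t j) * (e / (B * B + 1) * (t j * vnorm (vs j) * (t j * vnorm (vs j)))) =
     e / (B * B + 1) * (vnorm (vs j) * vnorm (vs j)) by field; lra.
  apply: Rmult_le_compat_l; first exact/Rlt_le/Rdiv_lt_0_compat.
  by apply: Rmult_le_compat => //; apply: vnorm_ge0.
have := Rdiv_lt_0_compat _ _ e0 BB; have : e / (B * B + 1) * (B * B) = e - e / (B * B + 1) by field; lra.
lra.
Qed.

Section Forward.
Variables (v : vec (m + n)) (us : vec n) (t : nat -> R) (vs : nat -> vec (m + n)).
Variables (uss : nat -> vec n) (mus : nat -> vec d) (mu : vec d).
Hypothesis MS : multiplier_seq v us t vs uss mus mu.

Let tp := ms_pos MS.
Let it j : 0 < / t j. Proof. by apply: Rinv_0_lt_compat; apply: tp. Qed.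

Lemma limit_tangent : K (A v).
Proof.
apply: (Kcl _ (G_ray_cv tp (ms_t MS) (ms_v MS))) => j.
by apply: KZ; [exact/Rlt_le|exact: (ms_K MS)].
Qed.

Lemma limit_polar : polar K mu.
Proof.
move=> y Ky; apply: cv_le (cv_dot (ms_mu MS) (vcv_const y)) => j.
exact: (ms_polar MS).
Qed.

Lemma limit_complementary : dot mu (A v) = 0.
Proof.
apply: UL_sequence (cv_dot (ms_mu MS) (G_ray_cv tp (ms_t MS) (ms_v MS))) _.
by apply: cv_ext (cv_const 0) => j; rewrite dotZr (ms_compl MS); ring.
Qed.

(** The normal equation at z_j divided by t_j: moving [DG] back from z_j to zb costs the derivative
    of [DG] paired with the limit mu, which is [dxx mu v]. The equation speaks of x-derivatives
    only, so nothing is obtained for the p-part. *)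
Lemma multiplier_quotient_cv : vseq_cv (fun j => / t j *v (vsnd (adj A (mus j)) -v xs)) (us -v dxx mu v).
Proof.
apply/vcv_coord => i; set e := vjoin (@vzero m) (ebasis i).
have Ee : ebasis (rshift m i) = e.
  apply: dot_ext => x; rewrite dotC dot_ebasis dotC dot_join !vjoinE dot0r dot_ebasis /vsnd; lra.
have Esnd (L : vec (m + n) -> vec d) nu : vsnd (adj L nu) i = dot nu (L e) by rewrite /vsnd /adj Ee.
have dDG := proj2 G2 e.
apply: (@cv_ext (fun j => uss j i - dot (mus j) (/ t j *v (DG (zb +v t j *v vs j) e -v DG zb e)))).
  move=> j; have tj := tp j; have E := f_equal (fun w => w i) (ms_normal MS j).
  change (vsnd (adj (DG (zb +v t j *v vs j)) (mus j)) i = xs i + t j * uss j i) in E.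
  change (uss j i - dot (mus j) (/ t j *v (DG (zb +v t j *v vs j) e -v DG zb e)) =
    / t j * (vsnd (adj A (mus j)) i - xs i)).
  rewrite !Esnd in E *; rewrite dotZr dotBr E /A; field; lra.
apply: CV_minus; first exact: (proj1 (vcv_coord _ _) (ms_u MS)).
exact: cv_dot (ms_mu MS) (deriv_seq dDG tp (ms_t MS) (ms_v MS)).
Qed.

Lemma limit_normal : vsnd (adj A mu) = xs.
Proof.
have H := vcvZ (ms_t MS) multiplier_quotient_cv.
have H2 := vcv_snd (vcv_lin (adj_lin A) (ms_mu MS)).
apply: vcv_unique H2 _.
have E : xs = 0 *v (us -v dxx mu v) +v xs by vext.
rewrite {1}E; apply: vcv_ext (vcvD H (vcv_const xs)) => j.
by vext; field; have := tp j; lra.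
Qed.

(** As A^* mu' = A^* mu, the linear terms cancel in <mu' - mu, G z_j>; divided by t_j^2 this tends
    to half the difference of the values. The bound is <mu', G z_j> <= 0, and <mu, G z_j> is
    negligible by hypothesis. *)
Lemma limit_maximal mu' : Un_cv (fun j => / (t j * t j) * dot mu (G (zb +v t j *v vs j))) 0 ->
  polar K mu' -> adj A mu' = adj A mu -> dot mu' (D2 v v) <= dot mu (D2 v v).
Proof.
move=> c0 pmu' E.
have H := cv_dot (vcv_const (mu' -v mu)) (taylor_seq tp (ms_t MS) (ms_v MS)).
have := CV_plus _ _ _ _ H c0; rewrite dotZr dotBl Rplus_0_r => H2.
suff : 1 / 2 * (dot mu' (D2 v v) - dot mu (D2 v v)) <= 0 by lra.
apply: cv_le H2 => j; have tj := tp j.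
have tj2 : 0 < / (t j * t j) by apply: Rinv_0_lt_compat; nra.
have := pmu' _ (ms_K MS j); rewrite !dotE -!(dot_adj _ (vs j) Alin) E; nra.
Qed.

Lemma rhs_reduced_of_full : (forall q : vec m, exists (u : vec n) y, lin_space K y /\
    A (vjoin q (@vzero n)) = A (vjoin (@vzero m) u) +v y) -> rhs_reduced v us.
Proof.
move=> Hfull; exists mu.
have pmu := limit_polar; have Kv := limit_tangent; have cmu := limit_complementary.
have xmu := limit_normal.
do 4!split=> //.
have lin0' nu y : polar K nu -> lin_space K y -> dot nu y = 0.
  by move=> pn [Ky Ky']; have := pn _ Ky; have := pn _ Ky'; rewrite dotNr; lra.
(* Polar vectors vanish on lin K, so each of them pairs equally with A (e_i, 0) and A (0, U i). The
   p-coordinates of [wj] are thus read off from its x-part, and [w] is defined by the same rule. *)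
have [U HU] := functional_choice _ (fun i : 'I_m => Hfull (ebasis i)).
pose eta := us -v dxx mu v.
pose w := vjoin (fun i => dot eta (U i)) eta.
pose wj j := / t j *v (adj A (mus j) -v adj A mu).
have wjE j x : dot (wj j) x = / t j * (dot (mus j) (A x) - dot mu (A x)).
  by rewrite /wj dotZl dotBl !dot_adj.
have cw : vseq_cv wj w.
  apply: (@vcv_ext _ (fun j => vjoin (vfst (wj j)) (vsnd (wj j)))); first by move=> j; apply: vjoin_eta.
  have ceta : vseq_cv (fun j => vsnd (wj j)) eta.
    by apply: vcv_ext multiplier_quotient_cv => j; rewrite -[in LHS]xmu.
  apply: vcv_join => //; apply/vcv_coord => i.
  apply: cv_ext (cv_dot ceta (vcv_const (U i))) => j.
  have [y [ly Ey]] := HU i.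
  have El : lshift n i = lshift n i by [].
  have -> : vfst (wj j) i = dot (wj j) (vjoin (ebasis i) (@vzero n)).
    by rewrite dot_join !vjoinE dot0r dot_ebasis; lra.
  have -> : dot (vsnd (wj j)) (U i) = dot (wj j) (vjoin (@vzero m) (U i)).
    by rewrite dot_join !vjoinE dot0r; lra.
  rewrite !wjE Ey !dotDr (lin0' _ _ pmu ly) (lin0' _ _ (ms_polar MS j) ly); ring.
have pw : polar (crit_cone Om zb (adj A mu)) w.
  move=> x [/tangent_K Kx x0]; rewrite dot_adj // in x0.
  apply: cv_le (cv_dot cw (vcv_const x)) => j; rewrite wjE x0.
  have := ms_polar MS j Kx; have := it j; nra.
have cv_v : crit_cone Om zb (adj A mu) v.
  by split; [exact/K_tangent|rewrite dot_adj].
have c1 := cv_dot cw (ms_v MS).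
(* The sum of (1/t) <mu_j - mu, A v_j> and (1/t^2) <mu_j - mu, G z_j - t A v_j> is - (1/t^2) <mu, G
   z_j>, because <mu_j, G z_j> = 0; the second summand tends to 0. *)
have c2 : Un_cv (fun j => / (t j * t j) * - dot mu (G (zb +v t j *v vs j))) (dot w v).
  have dm := vcvB (ms_mu MS) (vcv_const mu).
  have := CV_plus _ _ _ _ c1 (cv_dot dm (taylor_seq tp (ms_t MS) (ms_v MS))).
  rewrite dotBl Rminus_diag Rplus_0_r; apply: cv_ext => j.
  by rewrite wjE !dotE (ms_compl MS); field; have := tp j; lra.
have wv : dot w v = 0.
  have : dot w v <= 0 by apply: pw.
  suff : 0 <= dot w v by lra.
  apply: cv_ge c2 => j; have := pmu _ (ms_K MS j).
  have : 0 < / (t j * t j) by apply: Rinv_0_lt_compat; have := tp j; nra.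
  nra.
split.
  move=> mu'; apply: limit_maximal; rewrite wv in c2.
  by rewrite -Ropp_0; apply: cv_ext (CV_opp _ _ c2) => j; rewrite /opp_seq; ring.
exists w; split; last by rewrite /w vsnd_join /eta; vext.
by apply/normal_cone_convex; [exact: crit_Om_cone|].
Qed.
End Forward.

(** Complementarity splits into nonpositive summands, so a generator with positive coefficient
    vanishes at that point. Each generator in turn either vanishes infinitely often, and is kept
    along that subsequence, or has coefficient 0 from some index on, and is dropped. *)
Lemma active_subseq (s : seq (vec d)) (nus Gs : nat -> vec d) :
  (forall j, fgcone s (nus j)) -> (forall j a, List.In a s -> dot a (Gs j) <= 0) ->
  (forall j, dot (nus j) (Gs j) = 0) ->
  exists (phi : nat -> nat) sI, (forall j, (j <= phi j)%nat) /\
    (forall a, List.In a sI -> List.In a s /\ forall j, dot a (Gs (phi j)) = 0) /\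
    forall j, fgcone sI (nus (phi j)).
Proof.
elim: s nus Gs => [|a s IH] nus Gs Hn HG H0.
  by exists id, [::]; split=> //; split.
have [c Hc] := functional_choice _ Hn.
have Hs j : dot (nus j -v c j *v a) (Gs j) <= 0.
  by apply: fgcone_polar (proj2 (Hc j)) _ => b hb; apply: HG; right.
have Ha j : dot a (Gs j) <= 0 by apply: HG; left.
have Hca j : c j * dot a (Gs j) = 0 /\ dot (nus j -v c j *v a) (Gs j) = 0.
  have := Hs j; rewrite dotBl dotZl H0; have := Ha j; have := proj1 (Hc j); nra.
have [[phi [hphi Hphi]]|[N HN]] := infinite_subseq (fun j => dot a (Gs j) = 0).
  have [||| psi [sI [hpsi [HI Hf]]]] := IH (fun j => nus (phi j) -v c (phi j) *v a) (fun j => Gs (phi j)).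
  - by move=> j; case: (Hc (phi j)).
  - by move=> j b hb; apply: HG; right.
  - by move=> j; case: (Hca (phi j)).
  exists (fun j => phi (psi j)), (a :: sI); split; [|split].
  - by move=> j; apply: leq_trans (hpsi j) (hphi _).
  - by move=> b [<-|/HI [h1 h2]]; split; [left|move=> j; apply: Hphi|right|].
  - by move=> j; exists (c (phi (psi j))); split; [case: (Hc (phi (psi j)))|apply: Hf].
have [||| psi [sI [hpsi [HI Hf]]]] := IH (fun j => nus (j + N)%nat) (fun j => Gs (j + N)%nat).
- move=> j; case: (Hc (j + N)%nat) => _; have c0 : c (j + N)%nat = 0.
    by have [/Rmult_integral [//|h] _] := Hca (j + N)%nat; case: (HN _ (leq_addl j N)).
  by rewrite c0; have -> : nus (j + N)%nat -v 0 *v a = nus (j + N)%nat by vext.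
- by move=> j b hb; apply: HG; right.
- by move=> j; apply: H0.
exists (fun j => (psi j + N)%nat), sI; split; [|split] => //.
- by move=> j; apply: leq_trans (hpsi j) (leq_addr _ _).
- by move=> b /HI [h1 h2]; split; [right|].
Qed.

Lemma rhs_reduced_of_polyhedral v us t vs uss mus mu : multiplier_seq v us t vs uss mus mu ->
  polyhedral_cone K -> rhs_reduced v us.
Proof.
move=> MS0 [N [a0 Ha0]].
pose s := [seq a0 i | i <- enum 'I_N].
have Ks y : K y <-> forall a, List.In a s -> dot a y <= 0.
  rewrite Ha0 /s; split=> H.
    by elim: (enum _) => [//|i e IH] a /= [<-|/IH].
  move=> i; apply: H; have : i \in enum 'I_N by rewrite mem_enum.
  elim: (enum _) => [//|i' e IH] /=; rewrite inE => /orP [/eqP ->|/IH]; [by left|by right].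
have sK a : List.In a s -> polar K a by move=> h y /Ks; apply.
have [|||phi [sI [hphi [HI Hf]]]] := @active_subseq s mus (fun j => G (zb +v t j *v vs j)).
- move=> j; apply: farkas => x /Ks; exact: (ms_polar MS0).
- by move=> j a h; apply: sK => //; apply: (ms_K MS0).
- exact: (ms_compl MS0).
have MS := multiplier_seq_sub hphi MS0.
have fmu : fgcone sI mu by apply: fgcone_closed (ms_mu MS).
have pmu := limit_polar MS; have Kv := limit_tangent MS; have cmu := limit_complementary MS.
have tp := ms_pos MS.
have Iv a : List.In a sI -> dot a (A v) = 0.
  move=> /HI [_ h]; apply: UL_sequence (cv_dot (vcv_const a) (G_ray_cv tp (ms_t MS) (ms_v MS))) _.
  by apply: cv_ext (cv_const 0) => j; rewrite dotZr h; ring.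
have fmuG j : dot mu (G (zb +v t (phi j) *v vs (phi j))) = 0.
  have := pmu _ (ms_K MS j).
  have : dot mu (vopp (G (zb +v t (phi j) *v vs (phi j)))) <= 0.
    by apply: fgcone_polar fmu _ => a /HI [_ h]; rewrite dotNr h; lra.
  by rewrite dotNr; lra.
exists mu; do 4!split=> //; first exact: (limit_normal MS).
split.
  move=> mu'; apply: (limit_maximal MS).
  by apply: cv_ext (cv_const 0) => j; rewrite fmuG; ring.
pose L nu := vsnd (adj A nu).
have Ll : is_linear L by have [l1 l2] := adj_lin A; split=> *; rewrite /L ?l1 ?l2.
(* The quotients (mu_j - mu) / t_j lie in the cone of [sI] and - mu but may diverge. Their images
   under [L] converge inside a finitely generated, hence closed, cone, so the limit still has a
   preimage [nu] of that form. *)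
have /(fgcone_map _ _ Ll) [nu [[c [c0 Hc]] Enu]] : fgcone (map L (vopp mu :: sI)) (us -v dxx mu v).
  apply: fgcone_closed (multiplier_quotient_cv MS) => j.
  apply/(fgcone_map _ _ Ll); exists (/ t (phi j) *v (mus (phi j) -v mu)).
  split; last by rewrite (linZ Ll) (linB Ll) /L (limit_normal MS).
  exists (/ t (phi j)); split; first exact/Rlt_le/Rinv_0_lt_compat.
  have -> : / t (phi j) *v (mus (phi j) -v mu) -v / t (phi j) *v vopp mu = / t (phi j) *v mus (phi j) by vext.
  by have [_ [_ IZ]] := fgcone_cone sI; apply: IZ => //; exact/Rlt_le/Rinv_0_lt_compat.
exists (adj A nu); split; last by rewrite -/(L nu) Enu; vext.
have nuE x : dot nu (A x) = dot (nu -v c *v vopp mu) (A x) - c * dot mu (A x) by rewrite !dotE; ring.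
apply/normal_cone_convex; first exact: crit_Om_cone.
split; first by split; [exact/K_tangent|rewrite dot_adj].
split.
  move=> x [/tangent_K Kx x0]; rewrite dot_adj // in x0; rewrite dot_adj // nuE x0.
  have : dot (nu -v c *v vopp mu) (A x) <= 0.
    by apply: fgcone_polar Hc _ => a /HI [h _]; apply: sK.
  lra.
rewrite dot_adj // nuE cmu.
have : dot (nu -v c *v vopp mu) (A v) <= 0.
  by apply: fgcone_polar Hc _ => a /Iv ->; lra.
have : dot (nu -v c *v vopp mu) (vopp (A v)) <= 0.
  by apply: fgcone_polar Hc _ => a /Iv h; rewrite dotNr h; lra.
by rewrite dotNr; lra.
Qed.

(* Strong duality up to an arbitrarily small error for the conic programme
   defining the directional multipliers; no constraint qualification is needed,
   since a separating functional always yields a better multiplier. *)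
Lemma dual_approx b mu : polar K mu ->
  (forall mu', polar K mu' -> adj A mu' = adj A mu -> dot mu' b <= dot mu b) ->
  forall e, 0 < e -> exists s k, K k /\ vnorm (b +v A s -v k) <= e /\
    - e <= dot mu b + dot (adj A mu) s.
Proof.
move=> pmu Hmax e e0.
pose val s rho : vec 1 := fun _ => dot mu b + dot (adj A mu) s - rho.
(* Residuals of the constraint in the first d coordinates, attainable lower bounds of the objective
   in the last. An approximate solution exists when 0 is in the closure. *)
pose Q (p : vec (d + 1)) := exists s k rho, K k /\ 0 <= rho /\ p = vjoin (b +v A s -v k) (val s rho).
suff /(_ e e0) [q [[s [k [rho [Kk [rho0 ->]]]]] Hq]] : vclosure Q (@vzero (d + 1)).
  exists s, k; split=> //.
  have := vnorm_fst_le (@vzero (d + 1) -v vjoin (b +v A s -v k) (val s rho)).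
  have := vnorm_snd_le (@vzero (d + 1) -v vjoin (b +v A s -v k) (val s rho)).
  rewrite !vjoinE => h1 h2.
  have h3 : Rabs (0 - (dot mu b + dot (adj A mu) s - rho)) <= vnorm (vsnd (@vzero (d + 1)) -v val s rho).
    exact: (coord_le_vnorm (vsnd (@vzero (d + 1)) -v val s rho) ord0).
  split.
    have <- : vnorm (vfst (@vzero (d + 1)) -v (b +v A s -v k)) = vnorm (b +v A s -v k).
      by rewrite -[RHS]vnormN; congr vnorm; rewrite /vfst; vext.
    lra.
  have := Rle_abs (0 - (dot mu b + dot (adj A mu) s - rho)). lra.
apply: NNPP => /separation [||u [c [c0 Hu]]].
- by exists (vjoin (b +v A (@vzero _) -v @vzero d) (val (@vzero _) 0)), (@vzero _), (@vzero d), 0; do !split=> //; lra.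
- move=> x y t t01 [s [k [rho [Kk [rho0 ->]]]]] [s' [k' [rho' [Kk' [rho'0 ->]]]]].
  exists (s +v t *v (s' -v s)), (k +v t *v (k' -v k)), (rho + t * (rho' - rho)).
  split; first exact: (cone_convex Kcone).
  split; first nra.
  apply: vjoin_ext; rewrite !vjoinE.
    by rewrite (linD Alin) (linZ Alin) (linB Alin); vext.
  by rewrite /val !dotE; vext.
pose nu := vopp (vfst u); pose al := - vsnd u ord0.
have H s k rho : K k -> 0 <= rho ->
    c <= dot nu b + dot (adj A nu +v al *v adj A mu) s - dot nu k + al * dot mu b - al * rho.
  move=> Kk rho0; have := Hu (vjoin (b +v A s -v k) (val s rho)).
  rewrite dot0r dot_join !vjoinE {2}/dot big_ord_recl big_ord0 => h.
  have {}h := h (ex_intro _ s (ex_intro _ k (ex_intro _ rho (conj Kk (conj rho0 erefl))))).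
  have E : dot (adj A nu) s = - dot (vfst u) (A s) by rewrite dot_adj // dotNl.
  move: h; rewrite /val dotDl dotZl E /nu /al !dotE; lra.
have base := H (@vzero _) (@vzero d) 0 K0 (Rle_refl 0).
rewrite !dot0r Rmult_0_r in base.
have pnu : polar K nu.
  apply: (@cone_bounded_le0 _ _ _ (dot nu b + al * dot mu b - c) Kcone) => k Kk.
  by have := H (@vzero _) k 0 Kk (Rle_refl 0); rewrite dot0r; lra.
(* A linear form bounded below on the whole space vanishes; the whole space is taken as the cone
   [fun=> True]. *)
have z0 : adj A nu +v al *v adj A mu = @vzero _.
  apply: dot_eq0.
  have -> : dot (adj A nu +v al *v adj A mu) (adj A nu +v al *v adj A mu) = dot (vopp (adj A nu +v al *v adj A mu)) (vopp (adj A nu +v al *v adj A mu)) by rewrite dotNl dotNr; ring.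
  apply: (@cone_bounded_le0 _ (fun=> True) _ (dot nu b + al * dot mu b - c)) => // s _.
  by have := H s (@vzero d) 0 K0 (Rle_refl 0); rewrite dot0r dotNl; lra.
have al0 : al <= 0.
  apply: Rnot_lt_le => al0.
  pose B := dot nu b + al * dot mu b.
  have B0 : 0 < B by rewrite /B; lra.
  have := H (@vzero _) (@vzero d) (B / al) K0 ltac:(apply/Rlt_le/Rdiv_lt_0_compat; lra).
  have -> : al * (B / al) = B by field; lra.
  by rewrite !dot0r /B; lra.
have Enu : adj A nu = (- al) *v adj A mu.
  apply: vsub_eq0; rewrite -z0; vext.
(* If al < 0, normalising nu by - al gives a feasible multiplier of larger value than mu; if al = 0,
   then A^* nu = 0 and mu + nu is one. Both contradict maximality. *)
case: al0 => al0.
  have ia : 0 < / - al by apply: Rinv_0_lt_compat; lra.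
  have := Hmax (/ - al *v nu).
  rewrite (linZ (adj_lin A)) Enu dotZl => h.
  have {}h : / - al * dot nu b <= dot mu b.
    apply: h; last by vext; field; lra.
    by move=> k Kk; rewrite dotZl; have := pnu k Kk; nra.
  have : - al * (/ - al * dot nu b) <= - al * dot mu b by apply: Rmult_le_compat_l; lra.
  have -> : - al * (/ - al * dot nu b) = dot nu b by field; lra.
  lra.
have := Hmax (mu +v nu); rewrite (linD (adj_lin A)) Enu al0 dotDl => h.
have : dot mu b + dot nu b <= dot mu b.
  apply: h; last by vext.
  by move=> k Kk; rewrite dotDl; have := pmu k Kk; have := pnu k Kk; lra.
rewrite al0 in base; lra.
Qed.

(** * Construction of nearby points and normals *)

Lemma almost_maximal_point v mu : K (A v) -> polar K mu -> dot mu (A v) = 0 ->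
  (forall mu', polar K mu' -> adj A mu' = adj A mu -> dot mu' (D2 v v) <= dot mu (D2 v v)) ->
  forall e dl, 0 < e -> 0 < dl -> exists t z, 0 < t < dl /\ Om z /\
    vnorm (z -v (zb +v t *v v)) <= e * t /\ - (e * (t * t)) <= dot mu (G z).
Proof.
move=> Kv pmu cmu Hmax e dl e0 dl0.
have [L [rl [L0 [rl0 HL]]]] := td_lipschitz G2.
have nmu := vnorm_ge0 mu; have nv := vnorm_ge0 v.
(* The coefficients of e1 t^2 in the loss of <mu, G>: the duality error is covered by 1, the Taylor
   error gives |mu|, and the correction by stability gives 2 |mu| L kap. *)
pose c := 1 + vnorm mu + 2 * (vnorm mu * L * kap).
have ml : 0 <= vnorm mu * L by nra.
have c1 : 1 <= c by rewrite /c; nra.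
pose e1 := e / c.
have e10 : 0 < e1 by apply: Rdiv_lt_0_compat; lra.
have e1c : e1 * c = e by rewrite /e1; field; lra.
have [s [k [Kk [Hk Hval]]]] := dual_approx pmu Hmax e10.
have ns := vnorm_ge0 s; have nk := vnorm_ge0 k; have nA := vnorm_ge0 (A v).
pose t j := / (INR j + 1).
have tp j : 0 < t j := inv_pos j.
have t0 : Un_cv t 0 := cv_inv.
(* Then zb + t vs is the parabola zb + t v + (t^2 / 2) s. *)
pose vs j := v +v (t j / 2) *v s.
have vv : vseq_cv vs v.
  have E : v = v +v (0 * / 2) *v s by vext.
  rewrite {1}E; apply: vcvD; first exact: vcv_const.
  by apply: vcvZ; [apply: CV_mult => //; exact: cv_const|exact: vcv_const].
have [N1 HN1] := taylor_seq tp t0 vv e10.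
have rm : 0 < Rmin r0 rl by apply: Rmin_glb_lt.
have [N2 HN2] := ray_cv zb t0 vv (ltac:(lra) : 0 < Rmin r0 rl / 2).
pose B := vnorm s + 4 * kap * e1 + vnorm (A v) + vnorm k + 1.
have B1 : 1 <= B by rewrite /B; have : 0 <= kap * e1; [nra|lra].
pose q := Rmin (Rmin e dl) (Rmin (Rmin r0 rl / 2) 1).
have q0 : 0 < q by do !apply: Rmin_glb_lt; lra.
have qB : 0 < q / B by apply: Rdiv_lt_0_compat; lra.
have [N3 HN3] := proj1 (cvP _ _) t0 _ qB.
pose j := maxn N1 (maxn N2 N3).
have {}HN1 := HN1 j (leq_maxl _ _).
have {}HN2 := HN2 j (leq_trans (leq_maxl _ _) (leq_maxr _ _)).
have {HN3} := HN3 j (leq_trans (leq_maxr _ _) (leq_maxr _ _)).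
rewrite Rminus_0_r Rabs_pos_eq; last exact/Rlt_le/tp.
move: HN1 HN2 (tp j); rewrite /vs; set tj := t j => HN1 HN2 tj0 tjq.
have tB : tj * B < q.
  have : q / B * B = q by field; lra.
  nra.
have qe : q <= e := Rle_trans _ _ _ (Rmin_l _ _) (Rmin_l _ _).
have qd : q <= dl := Rle_trans _ _ _ (Rmin_l _ _) (Rmin_r _ _).
have qr : q <= Rmin r0 rl / 2 := Rle_trans _ _ _ (Rmin_r _ _) (Rmin_l _ _).
have q1 : q <= 1 := Rle_trans _ _ _ (Rmin_r _ _) (Rmin_r _ _).
have rmr0 := Rmin_l r0 rl; have rmrl := Rmin_r r0 rl.
have tj1 : tj < 1 by nra.
set z := zb +v tj *v (v +v (tj / 2) *v s) in HN2 *.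
have tt : 0 < tj * tj by nra.
have approx : vnorm (G z -v (tj *v A v +v (tj * tj / 2) *v (D2 v v +v A s))) <= e1 * (tj * tj).
  have -> : G z -v (tj *v A v +v (tj * tj / 2) *v (D2 v v +v A s)) =
     (tj * tj) *v (/ (tj * tj) *v (G z -v tj *v A (v +v (tj / 2) *v s)) -v (1 / 2) *v D2 v v).
    by rewrite (linD Alin) (linZ Alin); vext; field; lra.
  rewrite vnormZ_pos; last lra.
  by rewrite (Rmult_comm e1); apply: Rmult_le_compat_l; [lra|exact/Rlt_le/HN1].
(* Target of the correction: along the parabola G equals t A v + (t^2 / 2) (D2 v v + A s) up to e1
   t^2, and k approximates D2 v v + A s. *)
have Kj : K (tj *v A v +v (tj * tj / 2) *v k) by apply: KD; apply: KZ => //; lra.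
have e1kap : 0 <= kap * e1 by nra.
have [||z' [Oz' [fz' Hz']]] := robinson_join _ _ Kj (z := z).
- by lra.
- apply: Rle_lt_trans (vnormD _ _) _; rewrite !vnormZ_pos; try lra.
  have : tj * tj / 2 * vnorm k <= tj * vnorm k by apply: Rmult_le_compat_r => //; nra.
  have : tj * (vnorm (A v) + vnorm k) <= tj * B by apply: Rmult_le_compat_l; rewrite /B; lra.
  lra.
have Gk : vnorm (G z -v (tj *v A v +v (tj * tj / 2) *v k)) <= 2 * e1 * (tj * tj).
  have -> : G z -v (tj *v A v +v (tj * tj / 2) *v k) =
     (G z -v (tj *v A v +v (tj * tj / 2) *v (D2 v v +v A s))) +v (tj * tj / 2) *v (D2 v v +v A s -v k) by vext.
  apply: Rle_trans (vnormD _ _) _; rewrite [vnorm (_ *v _)]vnormZ_pos; last lra.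
  have : tj * tj / 2 * vnorm (D2 v v +v A s -v k) <= tj * tj / 2 * e1 by apply: Rmult_le_compat_l; lra.
  have : 0 <= tj * tj * e1 by nra.
  lra.
have zz : vnorm (z' -v z) <= kap * (2 * e1 * (tj * tj)).
  by apply: Rle_trans Hz' _; apply: Rmult_le_compat_l.
have ts : tj * (vnorm s + 4 * kap * e1) <= tj * B by apply: Rmult_le_compat_l; rewrite /B; lra.
exists tj, z'; split; first by split=> //; nra.
split=> //; split.
  have -> : z' -v (zb +v tj *v v) = (z' -v z) +v (tj * tj / 2) *v s by rewrite /z; vext; field.
  apply: Rle_trans (vnormD _ _) _; rewrite [vnorm (_ *v s)]vnormZ_pos; last lra.
  have : tj * (tj * (vnorm s + 4 * kap * e1)) <= tj * e by apply: Rmult_le_compat_l; lra.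
  nra.
have muz : - (e1 * (tj * tj)) * (1 + vnorm mu) <= dot mu (G z).
  have := cauchy_schwarz_abs mu (G z -v (tj *v A v +v (tj * tj / 2) *v (D2 v v +v A s))).
  have := Rle_abs (- dot mu (G z -v (tj *v A v +v (tj * tj / 2) *v (D2 v v +v A s)))).
  rewrite Rabs_Ropp [X in - X <= _]dotBr dotDr !dotZr cmu dotDr -(dot_adj mu s Alin) => h1 h2.
  have h3 : vnorm mu * vnorm (G z -v (tj *v A v +v (tj * tj / 2) *v (D2 v v +v A s))) <= vnorm mu * (e1 * (tj * tj)) by apply: Rmult_le_compat_l.
  have h4 : tj * tj / 2 * - e1 <= tj * tj / 2 * (dot mu (D2 v v) + dot (adj A mu) s) by apply: Rmult_le_compat_l; lra.
  have : 0 <= e1 * (tj * tj) by nra.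
  lra.
have muzz : - (vnorm mu * (L * (kap * (2 * e1 * (tj * tj))))) <= dot mu (G z' -v G z).
  have z'b : vnorm (z' -v zb) < rl.
    have := vnorm_tri z z' zb.
    have : kap * (2 * e1 * (tj * tj)) <= tj * B by nra.
    lra.
  have h1 := HL z' z z'b ltac:(lra).
  have h2 := cauchy_schwarz_abs mu (G z' -v G z); have := Rle_abs (- dot mu (G z' -v G z)); rewrite Rabs_Ropp.
  have : vnorm mu * vnorm (G z' -v G z) <= vnorm mu * (L * (kap * (2 * e1 * (tj * tj)))).
    apply: Rmult_le_compat_l => //; apply: Rle_trans h1 _; exact: Rmult_le_compat_l.
  lra.
rewrite dotBr in muzz; rewrite -e1c /c; lra.
Qed.

Lemma K_bipolar y : (forall nu, polar K nu -> dot nu y <= 0) -> K y.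
Proof.
move=> /(bipolar Kcone) cy; apply: NNPP => nK.
have [e [e0 He]] := closed_dist Kcl nK.
have [q [/He h]] := cy (e / 2) ltac:(lra); lra.
Qed.

(** The critical cone is the polar of A^* (polar of K) - R_+ A^* mu: a vector u of that polar has A
    u in K and <A^* mu, u> >= 0, and the opposite sign follows from mu being polar. The bipolar
    theorem returns only the closure. *)
Lemma polar_crit_approx mu w : polar K mu -> polar (crit_cone Om zb (adj A mu)) w ->
  forall e, 0 < e -> exists nu c, polar K nu /\ 0 <= c /\ vnorm (adj A nu -v c *v adj A mu -v w) <= e.
Proof.
move=> pmu pw e e0.
pose Q x := exists nu c, polar K nu /\ 0 <= c /\ x = adj A nu -v c *v adj A mu.
have al := adj_lin A.
have p0 : polar K (@vzero d) by move=> x _; rewrite dot0l; lra.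
have Qc : convex_cone Q.
  split; first by exists (@vzero d), 0; split=> //; split; [lra|rewrite (lin0 al); vext].
  split=> [x y [nu [c [pn [c0 ->]]]] [nu' [c' [pn' [c'0 ->]]]]|t x t0 [nu [c [pn [c0 ->]]]]].
    exists (nu +v nu'), (c + c'); split; [|split; [lra|by rewrite (linD al); vext]].
    by move=> x' Kx; rewrite dotDl; have := pn x' Kx; have := pn' x' Kx; lra.
  exists (t *v nu), (t * c); split; [|split; [nra|by rewrite (linZ al); vext]].
  by move=> x' Kx; rewrite dotZl; have := pn x' Kx; nra.
have [|q [[nu [c [pn [c0 ->]]]] Hq]] := bipolar (x := w) Qc _ e0; last first.
  by exists nu, c; do 2!split=> //; rewrite vnormBC.
move=> u pu; rewrite dotC; apply: pw.
have KAu : K (A u).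
  apply: K_bipolar => nu pn; rewrite -dot_adj // dotC; apply: pu.
  by exists nu, 0; split=> //; split; [lra|vext].
split; first exact: K_tangent.
have : dot u (@vzero _ -v 1 *v adj A mu) <= 0.
  by apply: pu; exists (@vzero d), 1; split=> //; split; [lra|rewrite (lin0 al)].
have := pmu _ KAu; rewrite -dot_adj // !dotE (dotC u); lra.
Qed.

(** Fermat's rule: the gradient at a local maximiser over a set is a regular normal. The radius e /
    2 absorbs the quadratic term |x - vsnd z|^2 into e |x - vsnd z|. *)
Lemma maximiser_normal z la (y : vec n) r : has_deriv G (DG z) z -> Om z -> 0 < r ->
  (forall x, Om (vjoin (vfst z) x) -> vnorm (x -v vsnd z) < r ->
    dot la (G (vjoin (vfst z) x)) - dot (x -v y) (x -v y) <=
    dot la (G z) - dot (vsnd z -v y) (vsnd z -v y)) ->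
  section_normal z (vsnd (adj (DG z) la) -v 2 *v (vsnd z -v y)).
Proof.
move=> [Dl dz] Oz rp Hmax; split; first by rewrite vjoin_eta.
move=> e e0; have nl := vnorm_ge0 la.
have [d1 [d10 H1]] := dz (e / (2 * (vnorm la + 1))) ltac:(apply: Rdiv_lt_0_compat; lra).
exists (Rmin (Rmin r d1) (e / 2)); split; first by do !apply: Rmin_glb_lt; lra.
move=> x Ox /Rmin_Rgt_l [/Rmin_Rgt_l [x1 x2] x3].
pose k := vjoin (@vzero m) (x -v vsnd z).
have nk : vnorm k <= vnorm (x -v vsnd z).
  by apply: Rle_trans (vnorm_join_le _) _; rewrite !vjoinE vnorm0; lra.
have zk : z +v k = vjoin (vfst z) x.
  by apply: vjoin_ext; rewrite !vjoinE; vext.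
have h1 := H1 k ltac:(lra); rewrite zk in h1.
have h2 := Hmax x Ox x1.
set N := vnorm (x -v vsnd z) in x1 x2 x3 nk *.
have N0 : 0 <= N := vnorm_ge0 _.
have h3 : - (e / 2 * N) <= dot la (G (vjoin (vfst z) x) -v G z -v DG z k).
  have := cauchy_schwarz_abs la (G (vjoin (vfst z) x) -v G z -v DG z k).
  have := Rle_abs (- dot la (G (vjoin (vfst z) x) -v G z -v DG z k)); rewrite Rabs_Ropp.
  have c0 : 0 < e / (2 * (vnorm la + 1)) by apply: Rdiv_lt_0_compat; lra.
  have : vnorm la * vnorm (G (vjoin (vfst z) x) -v G z -v DG z k) <= (vnorm la + 1) * (e / (2 * (vnorm la + 1)) * N).
    apply: Rmult_le_compat => //; [exact: vnorm_ge0|lra|].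
    by apply: Rle_trans h1 _; apply: Rmult_le_compat_l; lra.
  have -> : (vnorm la + 1) * (e / (2 * (vnorm la + 1)) * N) = e / 2 * N by field; lra.
  lra.
have E : dot (x -v y) (x -v y) = dot (vsnd z -v y) (vsnd z -v y) + 2 * dot (vsnd z -v y) (x -v vsnd z) + N * N.
  rewrite /N vnorm_sqr.
  have -> : x -v y = (vsnd z -v y) +v (x -v vsnd z) by vext.
  move: (vsnd z -v y) (x -v vsnd z) => a b; rewrite !dotDl !dotDr (dotC b a); ring.
have Ek : dot (vsnd (adj (DG z) la)) (x -v vsnd z) = dot la (DG z k).
  by rewrite -(dot_adj la k Dl) dot_join /k !vjoinE dot0r; lra.
rewrite dotBl dotZl Ek.
rewrite 2!dotBr in h3.
have : N * N <= e / 2 * N by nra.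
lra.
Qed.

(** Inside the ball the section is the preimage of the closed cone K under a continuous map, so its
    part within distance rho is compact. *)
Lemma section_maximiser z la rho R1 : Om z -> 0 < rho -> R1 <= r0 ->
  (exists L, 0 <= L /\ forall w w', vnorm (w -v zb) < R1 -> vnorm (w' -v zb) < R1 ->
    vnorm (G w -v G w') <= L * vnorm (w -v w')) ->
  vnorm (z -v zb) + rho < R1 ->
  exists x, Om (vjoin (vfst z) x) /\ vnorm (x -v vsnd z) <= rho /\
    forall y, Om (vjoin (vfst z) y) -> vnorm (y -v vsnd z) <= rho ->
    dot la (G (vjoin (vfst z) y)) - dot (y -v vsnd z) (y -v vsnd z) <=
    dot la (G (vjoin (vfst z) x)) - dot (x -v vsnd z) (x -v vsnd z).
Proof.
move=> Oz rho0 R1r [L [L0 HL]] zR.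
pose S x := Om (vjoin (vfst z) x) /\ vnorm (x -v vsnd z) <= rho.
have jn (x y : vec n) : vnorm (vjoin (vfst z) x -v vjoin (vfst z) y) <= vnorm (x -v y).
  apply: Rle_trans (vnorm_join_le _) _; rewrite !vjoinE vsub_self vnorm0; lra.
have near x : vnorm (x -v vsnd z) <= rho -> vnorm (vjoin (vfst z) x -v zb) < R1.
  move=> h; have := vnorm_tri z (vjoin (vfst z) x) zb.
  by have := jn x (vsnd z); rewrite vjoin_eta; lra.
have Gc w x : (forall j, vnorm (w j -v vsnd z) <= rho) -> vnorm (x -v vsnd z) <= rho -> vseq_cv w x ->
    vseq_cv (fun j => G (vjoin (vfst z) (w j))) (G (vjoin (vfst z) x)).
  move=> hw hx wx; apply: (@vcv_squeeze _ _ _ (fun j => L * vnorm (w j -v x))) => [j|].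
    apply: Rle_trans (HL _ _ (near _ (hw j)) (near _ hx)) _; apply: Rmult_le_compat_l => //.
  by rewrite -(Rmult_0_r L); apply: CV_mult; [exact: cv_const|apply/vcvP].
pose f x := dot (x -v vsnd z) (x -v vsnd z) - dot la (G (vjoin (vfst z) x)).
have [||||x [[Ox xr] Hmin]] := @extreme_value _ S f (vnorm (vsnd z) + rho).
- by exists (vsnd z); split; [rewrite vjoin_eta|rewrite vsub_self vnorm0; lra].
- move=> w x Sw wx.
  have hw j : vnorm (w j -v vsnd z) <= rho by case: (Sw j).
  have hx : vnorm (x -v vsnd z) <= rho.
    by apply: cv_le (cv_vnorm (vcvB wx (vcv_const (vsnd z)))) => j; apply: hw.
  split=> //; apply/OmK; first by have := near x hx; lra.
  apply: (Kcl _ (Gc _ _ hw hx wx)) => j; apply/OmK; first by have := near _ (hw j); lra.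
  by case: (Sw j).
- by move=> x [_ hx]; have := vnormDB x (vsnd z); lra.
- move=> w x Sw [_ hx] wx; rewrite /f; apply: CV_minus.
    by apply: cv_dot; apply: vcvB wx (vcv_const _).
  by apply: cv_dot (vcv_const la) (Gc _ _ (fun j => proj2 (Sw j)) hx wx).
exists x; do 2!split=> //; move=> y Oy yr; have := Hmin y (conj Oy yr); rewrite /f; lra.
Qed.

Lemma vnorm_le_dual k (y : vec k) B : 0 <= B -> (forall x, dot y x <= B * vnorm x) -> vnorm y <= B.
Proof.
move=> B0 H; have := H y; rewrite -vnorm_sqr; have := vnorm_ge0 y.
move: (vnorm y) => N N0 h; apply: Rnot_lt_le => lt; nra.
Qed.

Lemma dxx_dot mu v x : dot (dxx mu v) x = dot mu (D2 (vjoin (@vzero m) x) v).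
Proof.
have l : is_linear (fun u : vec n => D2 (vjoin (@vzero m) u) v).
  apply: (lin_comp (@vsnd_inj_lin m n) (M := fun w => D2 w v)); split=> *.
    exact: td_add G2 _ _ _.
  by rewrite !(td_sym G2 _ v) (linZ (td_lin2 G2 v)).
exact: (dot_adj mu x l).
Qed.

Lemma pick_small C e : 0 <= C -> 0 < e -> exists s, 0 < s <= 1 /\ C * s <= e.
Proof.
move=> C0 e0; have [t [t0 H]] := small_factor e0 C0.
exists (Rmin 1 t); have h1 := Rmin_l 1 t; have h2 := Rmin_r 1 t.
have h3 : 0 < Rmin 1 t by apply: Rmin_glb_lt; lra.
by split; [lra|rewrite Rmult_comm; apply/Rlt_le/H].
Qed.

Lemma dot_ge k (x y : vec k) B C : vnorm x <= B -> vnorm y <= C -> - (B * C) <= dot x y.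
Proof.
move=> xB yC; have := cauchy_schwarz_abs x y; have := Rle_abs (- dot x y); rewrite Rabs_Ropp.
have : vnorm x * vnorm y <= B * C by apply: Rmult_le_compat => //; exact: vnorm_ge0.
lra.
Qed.

Lemma dot_le k (x y : vec k) B C : vnorm x <= B -> vnorm y <= C -> dot x y <= B * C.
Proof.
move=> xB yC; apply: Rle_trans (cauchy_schwarz x y) _.
by apply: Rmult_le_compat => //; exact: vnorm_ge0.
Qed.

Lemma tangent_of_rhs_reduced v us : section_normal zb xs -> rhs_reduced v us ->
  tangent_cone gph_section_normal (vjoin zb xs) (vjoin v us).
Proof.
move=> base [mu [pmu [Kv [cmu [xmu [Hmax [w [nw Eus]]]]]]]].
have [_ [pw wv]] := proj1 (normal_cone_convex _ _ (crit_Om_cone _)) nw.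
apply: tangent_eps; first by rewrite /gph_section_normal !vjoinE.
move=> e e0.
have [M [M0 HM]] := td_bounded G2; have [MA [MA0 HMA]] := lin_bounded Alin.
have nv := vnorm_ge0 v; have nmu := vnorm_ge0 mu.
have mM : 0 <= vnorm mu * M by nra.
have mv : 0 <= vnorm mu * vnorm v by nra.
(* Bounds the sum of the five errors in [E] below per unit of s t |u|, with an extra |mu|. Adding
   the 2 s from the direction error requires (Cst + 2) s <= e. *)
pose Cst := vnorm mu * (vnorm v + 3) + 2 * (vnorm mu * M) + 4.
have Cst0 : 0 <= Cst by rewrite /Cst; lra.
have [s [[s0 s1] Hs]] := pick_small (ltac:(lra) : 0 <= Cst + 2) e0.
(* Four errors enter [laz]: the deficit of <mu, G z> and three from <nu, G z>. Each gets (s t)^2 /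
   4, so that the total deficit is (s t)^2. *)
have ss : 0 < s * s / 4 by nra.
have sss : s * s <= s by nra.
have [eta [[eta0 eta1] Heta]] := pick_small (ltac:(lra) : 0 <= vnorm v + 1) ss.
have etav : 0 <= vnorm v * eta by nra.
have [nu [c [pnu [c0 Hnu]]]] := polar_crit_approx pmu pw eta0.
have nnu := vnorm_ge0 nu.
pose la0 := nu -v c *v mu.
have nla := vnorm_ge0 la0.
have nuv0 : 0 <= (vnorm nu + 1) * (vnorm v + 1) by nra.
have nuA0 : 0 <= (vnorm nu + 1) * (MA + 1) by nra.
have [e2 [[e20 e21] He2]] := pick_small nuv0 ss.
have [e1 [[e10 e11] He1]] := pick_small nuA0 ss.
have [e4 [[e40 e41] He4]] := pick_small (ltac:(lra) : 0 <= vnorm la0 + 1) s0.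
have e1s : e1 <= s * s / 4.
  have : 1 * e1 <= (vnorm nu + 1) * (MA + 1) * e1 by apply: Rmult_le_compat_r; nra.
  lra.
have [L [rl [L0 [rl0 HL]]]] := td_lipschitz G2.
have [d3 [d30 H3]] := td_unif G2 s0.
have [d4 [d40 H4]] := td_cont G2 e40.
have dG : has_deriv G A zb.
  by case: G2 => [[r [rp H]] _]; apply: H; rewrite vsub_self vnorm0.
have [d5 [d50 H5]] := proj2 dG _ e20.
have [R1 [R10 [Rr0 [Rrl [Rd3 [Rd4 Rd5]]]]]] : exists R1, 0 < R1 /\ R1 <= r0 /\ R1 <= rl /\ R1 <= d3 /\ R1 <= d4 /\ R1 <= d5.
  exists (Rmin r0 (Rmin (Rmin rl d3) (Rmin d4 d5))).
  have a1 := Rmin_l r0 (Rmin (Rmin rl d3) (Rmin d4 d5)).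
  have a2 := Rmin_r r0 (Rmin (Rmin rl d3) (Rmin d4 d5)).
  have a3 := Rmin_l (Rmin rl d3) (Rmin d4 d5); have a4 := Rmin_r (Rmin rl d3) (Rmin d4 d5).
  have a5 := Rmin_l rl d3; have a6 := Rmin_r rl d3; have a7 := Rmin_l d4 d5; have a8 := Rmin_r d4 d5.
  by split; [do !apply: Rmin_glb_lt|lra].
have v3 : 0 <= vnorm v + 3 by lra.
have [t1 [t10 Ht1]] := small_factor (ltac:(lra) : 0 < R1 / 2) v3.
have [t2 [t20 Ht2]] := small_factor Rlt_0_1 c0.
have tm0 : 0 < Rmin e (Rmin t1 t2) by do !apply: Rmin_glb_lt.
have [t [z [[t0 tt] [Oz [Hz Gz]]]]] := almost_maximal_point Kv pmu cmu Hmax e10 tm0.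
have te : t < e := Rlt_le_trans _ _ _ tt (Rmin_l _ _).
have tt1 : t <= t1 := Rle_trans _ _ _ (Rlt_le _ _ tt) (Rle_trans _ _ _ (Rmin_r _ _) (Rmin_l _ _)).
have tt2 : t <= t2 := Rle_trans _ _ _ (Rlt_le _ _ tt) (Rle_trans _ _ _ (Rmin_r _ _) (Rmin_r _ _)).
have {}Ht1 := Ht1 t (conj t0 tt1); have {}Ht2 := Ht2 t (conj t0 tt2).
have tp2 : 0 < t * t by nra.
have tv : 0 <= t * vnorm v by nra.
pose k := z -v zb.
have kE : zb +v k = z by rewrite /k; vext.
have kv : vnorm (k -v t *v v) <= e1 * t.
  by have -> : k -v t *v v = z -v (zb +v t *v v) by rewrite /k; vext.
have nk : vnorm k <= t * (vnorm v + 1).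
  have := vnormDB k (t *v v); rewrite [vnorm (t *v v)]vnormZ_pos; last lra.
  have : e1 * t <= 1 * t by apply: Rmult_le_compat_r; lra.
  lra.
(* The first-order change [la0] of the multiplier contributes A^* la0, close to w, after division by
   t; t c < 1 keeps [la] in the polar of K. *)
pose la := mu +v t *v la0.
have pla : polar K la.
  have -> : la = (1 - t * c) *v mu +v t *v nu by rewrite /la /la0; vext.
  by move=> y Ky; rewrite dotDl !dotZl; have := pmu y Ky; have := pnu y Ky; nra.
have KGz : K (G z) by apply/OmK => //; rewrite -/k; lra.
have laz : - (s * t * (s * t)) <= dot la (G z).
  have -> : dot la (G z) = (1 - t * c) * dot mu (G z) + t * dot nu (G z) by rewrite /la /la0 !dotE; ring.
  have a1 : - (e1 * (t * t)) <= (1 - t * c) * dot mu (G z).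
    have := pmu _ KGz => h; apply: Rle_trans Gz _.
    have : 0 <= t * c by nra.
    nra.
  have a2 : dot nu (G z) = dot nu (G z -v A k) + dot nu (A (k -v t *v v)) + t * dot nu (A v).
    by rewrite (linB Alin) (linZ Alin) !dotE; ring.
  have a3 : - (t * (s * s / 4)) <= dot nu (G z -v A k).
    have h : vnorm (G z -v A k) <= e2 * (t * (vnorm v + 1)).
      have := H5 k ltac:(lra); rewrite kE G0.
      have -> : G z -v @vzero d -v A k = G z -v A k by vext.
      move=> h; apply: Rle_trans h _; apply: Rmult_le_compat_l; lra.
    have := dot_ge (ltac:(lra) : vnorm nu <= vnorm nu + 1) h.
    have : t * ((vnorm nu + 1) * (vnorm v + 1) * e2) <= t * (s * s / 4) by apply: Rmult_le_compat_l; lra.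
    lra.
  have a4 : - (t * (s * s / 4)) <= dot nu (A (k -v t *v v)).
    have h : vnorm (A (k -v t *v v)) <= (MA + 1) * (e1 * t).
      apply: Rle_trans (HMA _) _; apply: Rmult_le_compat => //; [exact: vnorm_ge0|lra].
    have := dot_ge (ltac:(lra) : vnorm nu <= vnorm nu + 1) h.
    have : t * ((vnorm nu + 1) * (MA + 1) * e1) <= t * (s * s / 4) by apply: Rmult_le_compat_l; lra.
    lra.
  have a5 : - (s * s / 4) <= dot nu (A v).
    have -> : dot nu (A v) = dot (adj A nu -v c *v adj A mu -v w) v.
      by rewrite !dotBl dotZl wv !dot_adj // cmu; ring.
    have := dot_ge Hnu (Rle_refl (vnorm v)); lra.
  have a6 : t * (- (t * (s * s / 4)) - t * (s * s / 4) + t * - (s * s / 4)) <= t * dot nu (G z).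
    apply: Rmult_le_compat_l; first lra.
    have : t * - (s * s / 4) <= t * dot nu (A v) by apply: Rmult_le_compat_l; lra.
    rewrite a2; lra.
  have : e1 * (t * t) <= s * s / 4 * (t * t) by apply: Rmult_le_compat_r; lra.
  lra.
have R12 : 0 < R1 / 2 by lra.
have [||x [Ox [xr Hx]]] := @section_maximiser z la (R1 / 2) R1 Oz R12 Rr0.
- by exists L; split=> // a b ha hb; apply: HL; lra.
- by rewrite -/k; lra.
pose z' := vjoin (vfst z) x.
have st1 : s * t <= 1 * t by apply: Rmult_le_compat_r; lra.
have zz : vnorm (z' -v z) <= vnorm (x -v vsnd z).
  by apply: Rle_trans (vnorm_join_le _) _; rewrite !vjoinE vsub_self vnorm0; lra.
pose k' := z' -v zb.
have k'E : zb +v k' = z' by rewrite /k'; vext.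
have k'k : k' = k +v (z' -v z) by rewrite /k' /k; vext.
have z'R : vnorm k' < R1.
  by rewrite k'k; have := vnormD k (z' -v z); lra.
(* Comparing the maximiser with the centre gives |x - vsnd z|^2 <= <la, G z'> - <la, G z>, where
   <la, G z'> <= 0 and <la, G z> >= - (s t)^2. *)
have xst : vnorm (x -v vsnd z) <= s * t.
  apply: le_of_sqr; first nra.
  have := Hx (vsnd z); rewrite vjoin_eta vsub_self vnorm0 dot0l vnorm_sqr => /(_ Oz ltac:(lra)).
  have : dot la (G z') <= 0 by apply: pla; apply/OmK => //; rewrite -/k'; lra.
  rewrite /z'; lra.
have k'v : vnorm (k' -v t *v v) <= 2 * s * t.
  have -> : k' -v t *v v = (k -v t *v v) +v (z' -v z) by rewrite k'k; vext.
  have := vnormD (k -v t *v v) (z' -v z).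
  have : e1 * t <= s * t by apply: Rmult_le_compat_r; lra.
  lra.
have nk' : vnorm k' <= t * (vnorm v + 2).
  have := vnormD k (z' -v z); rewrite -k'k; lra.
have [dz' Hu] := H3 k' ltac:(lra).
have {}H4 := H4 k' ltac:(lra).
rewrite k'E in dz' Hu H4.
have Ox' : Om z' := Ox.
have rpos : 0 < R1 / 2 - s * t by nra.
have sE : vsnd z' = x by rewrite /z' vsnd_join.
have fE : vfst z' = vfst z by rewrite /z' vfst_join.
have := @maximiser_normal z' la (vsnd z) _ dz' Ox' rpos.
rewrite sE fE => nrm.
pose xi := vsnd (adj (DG z') la) -v 2 *v (x -v vsnd z).
have {}nrm : section_normal z' xi.
  apply: nrm => y Oy yx; apply: Hx => //.
  by have := vnorm_tri x y (vsnd z); lra.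
have it : 0 < / t by apply: Rinv_0_lt_compat.
exists t, (vjoin (/ t *v k') (/ t *v (xi -v xs))); split=> //; split; last first.
  rewrite /gph_section_normal !vjoinE.
  have -> : zb +v t *v (/ t *v k') = z' by rewrite -k'E; vext; field; lra.
  have -> : xs +v t *v (/ t *v (xi -v xs)) = xi by vext; field; lra.
  exact: nrm.
apply: Rle_trans (vnorm_join_le _) _; rewrite !vjoinE.
have b1 : vnorm (/ t *v k' -v v) <= 2 * s.
  have -> : / t *v k' -v v = / t *v (k' -v t *v v) by vext; field; lra.
  rewrite vnormZ_pos; last lra.
  apply: (Rle_trans _ (/ t * (2 * s * t))); last by apply: Req_le; field; lra.
  by apply: Rmult_le_compat_l; lra.
suff b2 : vnorm (/ t *v (xi -v xs) -v us) <= Cst * s by lra.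
apply: vnorm_le_dual; first nra.
move=> u; apply: (Rmult_le_reg_l t) => //.
pose X := vjoin (@vzero m) u.
have nX : vnorm X <= vnorm u.
  by apply: Rle_trans (vnorm_join_le _) _; rewrite !vjoinE vnorm0; lra.
have nu0 := vnorm_ge0 u; have nX0 := vnorm_ge0 X.
have sndX (y : vec (m + n)) : dot (vsnd y) u = dot y X by rewrite dot_join /X !vjoinE dot0r; lra.
(* In order: variation of [DG] beyond its linear part, deviation of z' from zb + t v, variation of
   [DG] against la0, approximation error for w, gradient of the penalty. *)
have E : t * dot (/ t *v (xi -v xs) -v us) u =
    dot mu (DG z' X -v A X -v D2 X k') + dot mu (D2 X (k' -v t *v v)) +
    t * dot la0 (DG z' X -v A X) + t * dot (adj A nu -v c *v adj A mu -v w) X - 2 * dot (x -v vsnd z) u.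
  have -> : t * dot (/ t *v (xi -v xs) -v us) u = dot xi u - dot xs u - t * dot us u.
    by rewrite !dotE; field; lra.
  rewrite Eus dotDl dxx_dot -/X sndX /xi dotBl sndX dotZl -xmu sndX !dot_adj //; last by case: dz'.
  rewrite (linB (td_lin2 G2 X)) (linZ (td_lin2 G2 X)) !dotBl dotZl !dot_adj // /la /la0 !dotE (dot_adj mu X Alin); ring.
have c1 : dot mu (DG z' X -v A X -v D2 X k') <= vnorm mu * (s * (t * (vnorm v + 2)) * vnorm u).
  apply: dot_le; first lra.
  apply: Rle_trans (Hu X) _; apply: Rmult_le_compat => //; last by apply: Rmult_le_compat_l; lra.
  by have := vnorm_ge0 k'; nra.
have c2 : dot mu (D2 X (k' -v t *v v)) <= vnorm mu * (M * vnorm u * (2 * s * t)).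
  apply: dot_le; first lra.
  apply: Rle_trans (HM _ _) _; apply: Rmult_le_compat => //; [nra|exact: vnorm_ge0|].
  exact: Rmult_le_compat_l.
have c3 : t * dot la0 (DG z' X -v A X) <= t * (s * vnorm u).
  apply: Rmult_le_compat_l; first lra.
  have h : vnorm (DG z' X -v A X) <= e4 * vnorm u.
    by apply: Rle_trans (H4 X) _; apply: Rmult_le_compat_l; lra.
  have := dot_le (ltac:(lra) : vnorm la0 <= vnorm la0 + 1) h.
  have : (vnorm la0 + 1) * e4 * vnorm u <= s * vnorm u by apply: Rmult_le_compat_r.
  lra.
have c4 : t * dot (adj A nu -v c *v adj A mu -v w) X <= t * (s * vnorm u).
  apply: Rmult_le_compat_l; first lra.
  apply: dot_le nX; lra.
have c5 : - (s * t * vnorm u) <= dot (x -v vsnd z) u by apply: dot_ge xst _; lra.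
have st0 : 0 <= s * t by apply: Rmult_le_pos; lra.
have sttu : 0 <= vnorm mu * (s * t * vnorm u) by do 2!apply: Rmult_le_pos => //.
rewrite E /Cst.
have -> : t * ((vnorm mu * (vnorm v + 3) + 2 * (vnorm mu * M) + 4) * s * vnorm u) =
   vnorm mu * (s * (t * (vnorm v + 2)) * vnorm u) + vnorm mu * (s * t * vnorm u) +
   vnorm mu * (M * vnorm u * (2 * s * t)) + t * (s * vnorm u) + t * (s * vnorm u) + 2 * (s * t * vnorm u) by ring.
lra.
Qed.

Lemma tangent_gph_reduced v us : section_normal zb xs ->
  (forall q : vec m, exists (u : vec n) y, lin_space K y /\
     A (vjoin q (@vzero n)) = A (vjoin (@vzero m) u) +v y) \/ polyhedral_cone K ->
  tangent_cone gph_section_normal (vjoin zb xs) (vjoin v us) <-> rhs_reduced v us.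
Proof.
move=> base HK; split; last exact: tangent_of_rhs_reduced.
move=> /multiplier_seq_exists [t [vs [uss [mus [mu MS]]]]].
by case: HK => HK; [exact: rhs_reduced_of_full MS HK|exact: rhs_reduced_of_polyhedral MS HK].
Qed.
End Reduced.

(** * Reduction from C to K *)

(** For mu to be polar, metric regularity lifts a ray t k of K to points of C that are o(t)-close to
    yb + t y0 with Dh y0 = k, and the normal inequality is tested there. Conversely <mu, h y> <= 0
    on C, and h agrees with its linearisation to first order. *)
Lemma normal_reduction l d (C : vec l -> Prop) (K : vec d -> Prop) h Dh (D2 : vec l -> vec l -> vec d) yb r mu :
  twice_diff h Dh D2 yb -> convex_cone K -> 0 < r -> h yb = @vzero d ->
  (forall e, exists y, Dh yb y = e) ->
  (forall y, vnorm (y -v yb) < r -> (C y <-> K (h y))) ->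
  normal_cone C yb (adj (Dh yb) mu) <-> polar K mu.
Proof.
move=> h2 [K0 [_ KZ]] r0 h0 surj CK.
have hl := td_lin h2; have nmu := vnorm_ge0 mu.
have dh : has_deriv h (Dh yb) yb.
  by case: (h2) => [[r' [rp H]] _]; apply: H; rewrite vsub_self vnorm0.
have Cyb : C yb by apply/CK; rewrite ?vsub_self ?vnorm0 ?h0.
split=> [[_ H] k Kk|pmu].
  have [y0 Hy0] := surj k; have n0 := vnorm_ge0 y0; have nk := vnorm_ge0 k.
  have [c [rm [c0 [rm0 Hm]]]] := metric_regularity h2 surj.
  have nlam := vnorm_ge0 (adj (Dh yb) mu).
  apply: (@le0_of_small _ (vnorm y0 + c * vnorm y0 + vnorm (adj (Dh yb) mu) * (c * vnorm y0))) => e [e0 e1].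
  have [d1 [d10 H1]] := proj2 dh e e0; have [d2 [d20 H2]] := H e e0.
  have cy : 0 <= vnorm y0 + c * vnorm y0 by nra.
  have [t1 [t10 Ht1]] := small_factor d10 n0.
  have [t2 [t20 Ht2]] := small_factor rm0 n0.
  have [t3 [t30 Ht3]] := small_factor rm0 nk.
  have [t4 [t40 Ht4]] := small_factor (Rmin_glb_lt _ _ _ r0 d20) cy.
  have [t [t0 [l1 [l2 [l3 l4]]]]] : exists t, 0 < t /\ t <= t1 /\ t <= t2 /\ t <= t3 /\ t <= t4.
    exists (Rmin (Rmin t1 t2) (Rmin t3 t4)).
    have a1 := Rmin_l (Rmin t1 t2) (Rmin t3 t4); have a2 := Rmin_r (Rmin t1 t2) (Rmin t3 t4).
    have a3 := Rmin_l t1 t2; have a4 := Rmin_r t1 t2; have a5 := Rmin_l t3 t4; have a6 := Rmin_r t3 t4.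
    by split; [do !apply: Rmin_glb_lt|lra].
  have {}Ht1 := Ht1 t (conj t0 l1); have {}Ht2 := Ht2 t (conj t0 l2).
  have {}Ht3 := Ht3 t (conj t0 l3); have {}Ht4 := Ht4 t (conj t0 l4).
  have nty : vnorm (t *v y0) = t * vnorm y0 by rewrite vnormZ_pos; lra.
  have [||y' [hy' Hy']] := Hm (yb +v t *v y0) (t *v k).
  - have -> : yb +v t *v y0 -v yb = t *v y0 by vext.
 by lra.
  - have -> : t *v k -v h yb = t *v k by rewrite h0; vext.
    by rewrite vnormZ_pos; lra.
  have h1 := H1 (t *v y0) ltac:(lra); rewrite h0 (linZ hl) Hy0 nty in h1.
  have dist : vnorm (y' -v (yb +v t *v y0)) <= c * (e * (t * vnorm y0)).
    apply: Rle_trans Hy' _; apply: Rmult_le_compat_l; first lra.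
    by have -> : h (yb +v t *v y0) -v t *v k = h (yb +v t *v y0) -v @vzero d -v t *v k by vext.
  have ec : c * (e * (t * vnorm y0)) <= c * (1 * (t * vnorm y0)).
    by apply: Rmult_le_compat_l; [lra|apply: Rmult_le_compat_r; [nra|lra]].
  have y'b : vnorm (y' -v yb) <= t * (vnorm y0 + c * vnorm y0).
    have -> : y' -v yb = (y' -v (yb +v t *v y0)) +v t *v y0 by vext.
    by have := vnormD (y' -v (yb +v t *v y0)) (t *v y0); lra.
  have m1 := Rmin_l r d2; have m2 := Rmin_r r d2.
  have Cy' : C y' by apply/CK; [lra|rewrite hy'; apply: KZ => //; lra].
  have h3 := H2 y' Cy' ltac:(lra).
  have h4 := dot_ge (Rle_refl (vnorm (adj (Dh yb) mu))) dist.
  have E : dot (adj (Dh yb) mu) (y' -v yb) = dot (adj (Dh yb) mu) (y' -v (yb +v t *v y0)) + t * dot mu k.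
    rewrite -{1}Hy0 -(dot_adj mu y0 hl) -dotZr -dotDr; congr dot; vext.
  have h5 : e * vnorm (y' -v yb) <= e * (t * (vnorm y0 + c * vnorm y0)) by apply: Rmult_le_compat_l; lra.
  apply: (Rmult_le_reg_l t) => //; rewrite E in h3; lra.
split=> // e e0.
have [d1 [d10 H1]] := proj2 dh (e / (vnorm mu + 1)) ltac:(apply: Rdiv_lt_0_compat; lra).
exists (Rmin r d1); split; first exact: Rmin_glb_lt.
move=> y Cy /Rmin_Rgt_l [y1 y2].
have h1 := H1 _ y2.
have E : yb +v (y -v yb) = y by vext.
rewrite E h0 in h1; rewrite dot_adj //.
have Kh : dot mu (h y) <= 0 by apply: pmu; apply/CK.
have h3 := dot_ge (ltac:(lra) : vnorm mu <= vnorm mu + 1) h1.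
have ny := vnorm_ge0 (y -v yb).
have E2 : (vnorm mu + 1) * (e / (vnorm mu + 1) * vnorm (y -v yb)) = e * vnorm (y -v yb) by field; lra.
rewrite E2 !dotBr dot0r in h3; lra.
Qed.

Lemma adj_inj a b (L : vec a -> vec b) x y : is_linear L -> (forall e, exists u, L u = e) ->
  adj L x = adj L y -> x = y.
Proof.
move=> Ll surj E; apply: dot_ext => e; have [u <-] := surj e.
by rewrite -!dot_adj // E.
Qed.

Section Bridge.
Variables (m n l d : nat) (g : vec (m + n) -> vec l).
Variables (Dg : vec (m + n) -> vec (m + n) -> vec l).
Variables (D2g : vec (m + n) -> vec (m + n) -> vec (m + n) -> vec l).
Variables (C : vec l -> Prop) (K : vec d -> Prop) (h : vec l -> vec d).
Variables (Dh : vec l -> vec l -> vec d) (D2h : vec l -> vec l -> vec l -> vec d).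
Variables (pb : vec m) (xb xs : vec n).
Let zb := vjoin pb xb.
Let yb := g zb.
Hypothesis g2 : twice_diff g Dg (D2g zb) zb.
Hypothesis h2 : twice_diff h Dh (D2h yb) yb.
Hypothesis Kccc : closed_convex_cone K.
Hypothesis hyb : h yb = @vzero d.
Hypothesis surj : forall e, exists y, Dh yb y = e.
Variable r : R.
Hypothesis r_gt0 : 0 < r.
Hypothesis CK : forall y, vnorm (y -v yb) < r -> (C y <-> K (h y)).

Definition compD2 (v w : vec (m + n)) : vec d :=
  Dh yb (D2g zb v w) +v D2h yb (Dg zb v) (Dg zb w).

Lemma comp_twice_diff : twice_diff (fun w => h (g w)) (fun w v => Dh (g w) (Dg w v)) compD2 zb.
Proof. exact: td_comp g2 h2. Qed.

(** A target k in K is lifted by metric regularity of h to a point y' of C with |g z - y'| <= c |h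
    (g z) - k|, so the distance from g z to C is bounded by the residual of the reduced system. *)
Lemma reduced_stability : robinson_stable g C pb xb -> exists r0 kap, 0 < r0 /\ 0 <= kap /\
  (forall z, vnorm (z -v zb) < r0 -> (gph_Gamma g C z <-> K (h (g z)))) /\
  (forall z k, vnorm (z -v zb) < r0 -> vnorm k < r0 -> K k ->
    exists x, gph_Gamma g C (vjoin (vfst z) x) /\ vnorm (x -v vsnd z) <= kap * vnorm (h (g z) -v k)).
Proof.
move=> [ka [rs [ka0 [rs0 Hs]]]].
have [Lg [rg [Lg0 [rg0 HLg]]]] := td_lipschitz g2.
have [LG [rG [LG0 [rG0 HLG]]]] := td_lipschitz comp_twice_diff.
have [c [rm [c0 [rm0 Hm]]]] := metric_regularity h2 surj.
(* [B * r0] bounds the distance of the lifted point y' from yb, which has to stay where C is the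
   preimage of K. *)
pose B := Lg + c * LG + c.
have B0 : 0 <= B by rewrite /B; nra.
have mr0 : 0 < Rmin r rm / 2 by have := Rmin_glb_lt _ _ _ r_gt0 rm0; lra.
have [t [t0 Ht]] := small_factor mr0 B0.
pose r0 := Rmin (Rmin rs rg) (Rmin rG (Rmin rm t)).
have a1 : r0 <= rs := Rle_trans _ _ _ (Rmin_l _ _) (Rmin_l _ _).
have a2 : r0 <= rg := Rle_trans _ _ _ (Rmin_l _ _) (Rmin_r _ _).
have a3 : r0 <= rG := Rle_trans _ _ _ (Rmin_r _ _) (Rmin_l _ _).
have a4 : r0 <= rm := Rle_trans _ _ _ (Rmin_r _ _) (Rle_trans _ _ _ (Rmin_r _ _) (Rmin_l _ _)).
have a5 : r0 <= t := Rle_trans _ _ _ (Rmin_r _ _) (Rle_trans _ _ _ (Rmin_r _ _) (Rmin_r _ _)).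
have r00 : 0 < r0 by do !apply: Rmin_glb_lt.
have {}Ht := Ht r0 (conj r00 a5).
have m1 := Rmin_l r rm; have m2 := Rmin_r r rm.
have zb0 : vnorm (zb -v zb) = 0 by rewrite vsub_self vnorm0.
have gz z : vnorm (z -v zb) < r0 -> vnorm (g z -v yb) <= Lg * r0.
  move=> zr; apply: Rle_trans (HLg z zb _ _) _; [lra|lra|].
  by apply: Rmult_le_compat_l; lra.
have cLG : 0 <= c * LG by nra.
have Lgr : Lg * r0 <= r0 * B by rewrite /B; have : 0 <= (c * LG + c) * r0; [nra|lra].
have OmK z : vnorm (z -v zb) < r0 -> (gph_Gamma g C z <-> K (h (g z))).
  by move=> zr; apply: CK; have := gz z zr; lra.
(* The distance to the section is an infimum; the summand 1 leaves room for a point that nearly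
   realises it. When the residual is 0 there is no room, and x itself is taken. *)
exists r0, (ka * c + 1); split=> //; split; first nra.
split=> // z k zr kr Kk.
have Gz : vnorm (h (g z)) <= LG * r0.
  have := HLG z zb ltac:(lra) ltac:(lra); rewrite -/yb hyb.
  have -> : h (g z) -v @vzero d = h (g z) by vext.
  move=> H; apply: Rle_trans H _; apply: Rmult_le_compat_l; lra.
have [||y' [hy' Hy']] := Hm (g z) k.
- by have := gz z zr; lra.
- have -> : k -v h yb = k by rewrite hyb; vext.
  exact: Rlt_le_trans kr a4.
have Cy' : C y'.
  apply/CK; last by rewrite hy'.
  have b1 := vnorm_tri (g z) y' yb; have b2 := gz z zr; have b3 := vnormB (h (g z)) k.
  have : c * vnorm (h (g z) -v k) <= c * (LG * r0 + r0) by apply: Rmult_le_compat_l; lra.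
  rewrite /B in Ht; lra.
have [N0|N0] := Rle_lt_dec (vnorm (h (g z) -v k)) 0.
  have E := vsub_eq0 (vnorm_eq0 N0).
  exists (vsnd z); rewrite vjoin_eta vsub_self vnorm0; split; first by apply/OmK => //; rewrite E.
  by apply: Rmult_le_pos; [nra|exact: vnorm_ge0].
have fE : vfst (z -v zb) = vfst z -v pb by rewrite vfstB /zb vfst_join.
have sE : vsnd (z -v zb) = vsnd z -v xb by rewrite vsndB /zb vsnd_join.
have [||d1 [d2 [[_ D1] [[D2' _] d12]]]] := Hs (vfst z) (vsnd z).
- by rewrite -fE; have := vnorm_fst_le (z -v zb); lra.
- by rewrite -sE; have := vnorm_snd_le (z -v zb); lra.
rewrite vjoin_eta in D2'; have d2y := D2' y' Cy'; rewrite vnormBC in d2y.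
have kd : ka * d2 <= ka * (c * vnorm (h (g z) -v k)) by apply: Rmult_le_compat_l; lra.
apply: NNPP => nx.
have := D1 (d1 + vnorm (h (g z) -v k)); suff : forall x, Gamma g C (vfst z) x ->
    d1 + vnorm (h (g z) -v k) <= vnorm (vsnd z -v x) by move=> H /(_ H); lra.
move=> x Gx; apply: Rnot_lt_le => lt; apply: nx; exists x; split=> //.
rewrite vnormBC; lra.
Qed.

Let hlin : is_linear (Dh yb). Proof. exact: td_lin h2. Qed.
Let glin : is_linear (Dg zb). Proof. exact: td_lin g2. Qed.
Let A (v : vec (m + n)) := Dh yb (Dg zb v).
Let Alin : is_linear A. Proof. exact: lin_comp glin hlin. Qed.

Lemma adj_comp mu : adj A mu = adj (Dg zb) (adj (Dh yb) mu).
Proof. by apply: dot_ext => x; rewrite !dot_adj. Qed.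

Lemma objE mu v : dot (adj (Dh yb) mu) (D2g zb v v) + dot mu (D2h yb (Dg zb v) (Dg zb v)) =
  dot mu (compD2 v v).
Proof. by rewrite /compD2 dotDr dot_adj. Qed.

(** [dxx] feeds the x-direction to the second derivative first, [H_op] feeds it last; the symmetry
    of the second derivative of h reconciles them. *)
Lemma dxx_compE mu v : dxx compD2 mu v = dDxg_adj D2g zb (adj (Dh yb) mu) v +v H_op g Dg D2h zb mu v.
Proof.
apply: functional_extensionality => j; rewrite /dxx /compD2 dotDr /vadd /dDxg_adj dot_adj //.
congr (_ + _); rewrite /H_op /adj /Dxg.
have := dot_adj mu (Dg zb (vjoin (@vzero m) (ebasis j))) (td_lin2 h2 (Dg zb v)).
by rewrite (td_sym h2 (Dg zb _)) => <-.
Qed.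

(** The multiplier mu behind [lam] occurs separately in the objective and in [H_op]; both
    occurrences agree since the adjoint of an onto map is injective. Once z^* = A^* mu with mu
    polar, normality of z^* to the tangent cone amounts to A v in K and <mu, A v> = 0. *)
Lemma rhs_set_reduced v us r0 kap : 0 < r0 -> 0 <= kap ->
  (forall z, vnorm (z -v zb) < r0 -> (gph_Gamma g C z <-> K (h (g z)))) ->
  (forall z k, vnorm (z -v zb) < r0 -> vnorm k < r0 -> K k ->
    exists x, gph_Gamma g C (vjoin (vfst z) x) /\ vnorm (x -v vsnd z) <= kap * vnorm (h (g z) -v k)) ->
  rhs_set g Dg D2g C Dh D2h zb xs v us <->
  rhs_reduced (fun w v => Dh (g w) (Dg w v)) compD2 K (gph_Gamma g C) zb xs v us.
Proof.
move=> r00 kap0 OmK rob.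
have TK u : tangent_cone (gph_Gamma g C) zb u <-> K (A u).
  exact: (tangent_iff comp_twice_diff Kccc hyb r00 OmK kap0 rob).
have Tc : convex_cone (tangent_cone (gph_Gamma g C) zb).
  exact: (tangent_Om_cone comp_twice_diff Kccc hyb r00 OmK kap0 rob).
have Npol mu : normal_cone C yb (adj (Dh yb) mu) <-> polar K mu.
  exact: normal_reduction h2 (ccc_cone Kccc) r_gt0 hyb surj CK.
split.
  move=> [zs [nzs [xzs [lam [[[Nlam Elam] [val [[mu1 [Emu1 Eval]] Hmax]]] [mu [Emu [w [nw ->]]]]]]]]].
  have mu1E : mu1 = mu by apply: adj_inj hlin surj _; rewrite Emu1.
  subst mu1 lam.
  have zsE : adj A mu = zs by rewrite adj_comp.
  have [Tv [_ zsv]] := proj1 (normal_cone_convex _ _ Tc) nzs.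
  exists mu; split; first exact/Npol.
  split; first exact/TK.
  split; first by rewrite -[dot _ _](dot_adj mu v Alin) zsE.
  split; first by rewrite [adj _ _]zsE.
  split.
    move=> mu' pmu' E'; have {}E' : adj A mu' = adj A mu by exact: E'.
    rewrite -!objE -Eval; apply: (Hmax (adj (Dh yb) mu')); last by exists mu'.
    by split; [exact/Npol|rewrite -adj_comp E'].
  by exists w; split; [rewrite [adj _ _]zsE|rewrite dxx_compE].
move=> [mu [pmu [Kv [cmu [xmu [Hmax [w [nw ->]]]]]]]].
exists (adj A mu); split.
  apply/normal_cone_convex => //; split; first exact/TK.
  split; last by rewrite dot_adj.
  by move=> x /TK Kx; rewrite dot_adj //; apply: pmu.
split; first exact: xmu.
exists (adj (Dh yb) mu); split.
  split; first by split; [exact/Npol|rewrite -adj_comp].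
  exists (dot mu (compD2 v v)); split; first by exists mu; rewrite objE.
  move=> lam' val' [Nlam' Elam'] [mu' [Emu' ->]]; subst lam'.
  by rewrite objE; apply: Hmax; [exact/Npol|rewrite -[LHS]/(adj A mu') adj_comp Elam'].
exists mu; split=> //; exists w; split=> //.
by rewrite dxx_compE.
Qed.
End Bridge.

Lemma tangent_gph_Psi m n l d (g : vec (m + n) -> vec l) Dg D2g C (K : vec d -> Prop) h Dh D2h
    (pb : vec m) (xb xs : vec n) : let zb := vjoin pb xb in
  C2_near g Dg D2g zb -> closed_convex_cone K -> cone_reducible C K h Dh D2h (g zb) ->
  normal_cone (Gamma g C pb) xb xs -> robinson_stable g C pb xb ->
  ((forall q : vec m, char_subspace g Dg K Dh zb q) \/ polyhedral_cone K) ->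
  forall v us, tangent_cone (gph_Psi g C) (vjoin zb xs) (vjoin v us) <->
    rhs_set g Dg D2g C Dh D2h zb xs v us.
Proof.
move=> zb [rg [rg0 Hg]] Kccc [rh [rh0 [Hh [hyb [surj CK]]]]] Nxs rob HK v us.
have g2 := C2_twice_diff rg0 Hg; have h2 := C2_twice_diff rh0 Hh.
have [r0 [kap [r00 [kap0 [OmK rob']]]]] := reduced_stability g2 h2 hyb surj rh0 CK rob.
have -> := rhs_set_reduced xs g2 h2 Kccc hyb surj rh0 CK v us r00 kap0 OmK rob'.
apply: (tangent_gph_reduced (comp_twice_diff g2 h2) Kccc hyb r00 OmK kap0 rob') => //.
by rewrite /section_normal /zb vfst_join vsnd_join.
Qed.

End NormalMapTangent.

Theorem theorem5p3 (m n l d : nat)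
  (g : vec (m + n) -> vec l)
  (Dg : vec (m + n) -> vec (m + n) -> vec l)
  (D2g : vec (m + n) -> vec (m + n) -> vec (m + n) -> vec l)
  (C : vec l -> Prop) (K : vec d -> Prop)
  (h : vec l -> vec d) (Dh : vec l -> vec l -> vec d)
  (D2h : vec l -> vec l -> vec l -> vec d)
  (pb : vec m) (xb : vec n) (xs : vec n) :
  let zb := vjoin pb xb in
  C2_near g Dg D2g zb ->
  vclosed C ->
  closed_convex_cone K ->
  cone_reducible C K h Dh D2h (g zb) ->
  Gamma g C pb xb ->
  normal_cone (Gamma g C pb) xb xs ->
  robinson_stable g C pb xb ->
  ((forall q : vec m, char_subspace g Dg K Dh zb q) \/ polyhedral_cone K) ->
  (forall (q : vec m) (u : vec n) (us : vec n),
     tangent_cone (gph_Psi g C) (vjoin zb xs) (vjoin (vjoin q u) us) <->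
     rhs_set g Dg D2g C Dh D2h zb xs (vjoin q u) us) /\
  (forall (v : vec (m + n)) (us : vec n),
     graph_deriv (gph_Psi g C) zb xs v us <->
     rhs_set g Dg D2g C Dh D2h zb xs v us).
Proof.
intros zb Hg _ HK Hred _ Hxs Hrob Hcase.
pose proof (NormalMapTangent.tangent_gph_Psi Hg HK Hred Hxs Hrob Hcase) as H.
split; intros; apply H.
Qed.
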